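(* Let $K$ be a field of characteristic $p>0$ and let $G$ be a nilpotent group such that $|G'|=p^{n}$. Then $t^{L}(KG)=|G'|-15p+16$ if and only if one of the following two conditions (1), (2) holds: (1) $p=2$ and one of the following holds: (i) $G'\cong C_{16}\times C_{2}$, $\gamma_{3}(G)\subseteq G'^{2}$ and $\gamma_{4}(G)\subseteq G'^{4}$; (ii) $G'\cong C_{8}\times C_{2}\times C_{2}$, $G'^{2}\subseteq\gamma_{3}(G)\cong C_{8}$ and $\gamma_{4}(G)\subseteq\gamma_{3}(G)^{2}$; (iii) either (a) $G'\cong S(32,17)$ or $S(32,38)$, and $G'^{2}\subseteq\gamma_{3}(G)\cong C_{8}$, $\gamma_{4}(G)\subseteq\gamma_{3}(G)^{2}$ and $\gamma_{5}(G)=1$; or (b) $G'\cong S(32,17)$ or $S(32,38)$, and $G'^{2}\subseteq\gamma_{3}(G)\cong C_{8}$, $\gamma_{4}(G)=\gamma_{3}(G)^{2}$ and $\gamma_{5}(G)\cong C_{2}$; (iv) $G'\cong S(32,37)$, $G'^{2}\subseteq\gamma_{3}(G)\cong C_{8}$, $\gamma_{4}(G)=\gamma_{3}(G)^{2}$ and $\gamma_{5}(G)\cong C_{2}$; (v) $G'\cong S(32,17)$, $\gamma_{3}(G)\subseteq G'^{2}\cong C_{8}$ and $\gamma_{3}(G)\cong C_{4}$; (vi) $G'\cong C_{8}\times C_{2}\times C_{2}$ or $C_{4}\times C_{4}\times C_{2}$ or $C_{4}\times C_{2}\times C_{2}\times C_{2}$, and $G'^{2}\subseteq\gamma_{3}(G)\cong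 C_{4}\times C_{2}\times C_{2}$, $\gamma_{4}(G)\cong C_{4}\times C_{2}$ and $\gamma_{6}(G)\subseteq\gamma_{3}(G)^{2}=\gamma_{4}(G)^{2}\subseteq\gamma_{5}(G)\cong C_{2}\times C_{2}$; (vii) $G'\cong S(32,m)$ for some $m\in\{5,24,25,37,48\}$, and $G'^{2}\subseteq\gamma_{3}(G)\cong C_{4}\times C_{2}\times C_{2}$, $\gamma_{4}(G)\cong C_{4}\times C_{2}$, $\gamma_{3}(G)^{2}\subseteq\gamma_{5}(G)\cong C_{2}\times C_{2}$ and $\gamma_{6}(G)=1$; (viii) $G'\cong S(32,m)$ for some $m\in\{28,29,30\}$, and $G'^{2}\subseteq\gamma_{3}(G)\cong C_{4}\times C_{2}\times C_{2}$, $\gamma_{4}(G)\cong C_{4}\times C_{2}$ and $\gamma_{6}(G)=\gamma_{3}(G)^{2}\subseteq\gamma_{5}(G)\cong C_{2}\times C_{2}$; (ix) $G'\cong S(32,m)$ for some $m\in\{2,5,22,23,24,25,37,46,47,48\}$, and $G'^{2}\subseteq\gamma_{3}(G)\cong C_{4}\times C_{2}\times C_{2}$, $\gamma_{4}(G)\cong C_{4}\times C_{2}$ and $\gamma_{6}(G)=\gamma_{3}(G)^{2}\subseteq\gamma_{5}(G)\cong C_{2}\times C_{2}$; (x) $G'\cong C_{8}\times C_{2}\times C_{2}$ or $C_{4}\times C_{4}\times C_{2}$ or $C_{4}\times C_{2}\times C_{2}\times C_{2}$, and $G'^{2}\subseteq\gamma_{3}(G)\cong C_{4}\times C_{2}\times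 C_{2}$, $\gamma_{4}(G)\cong C_{4}\times C_{2}$, $\gamma_{3}(G)^{2}\subseteq\gamma_{4}(G)$, $\gamma_{5}(G)\cong C_{2}$ and $\gamma_{5}(G)\cap\gamma_{3}(G)^{2}=1$; (xi) $G'\cong S(32,m)$ for some $m\in\{5,24,25,37,48\}$, and $G'^{2}\subseteq\gamma_{3}(G)\cong C_{4}\times C_{2}\times C_{2}$, $\gamma_{4}(G)\cong C_{4}\times C_{2}$, $\gamma_{3}(G)^{2}\subseteq\gamma_{4}(G)$, $\gamma_{5}(G)\cong C_{2}$ and $\gamma_{5}(G)\cap\gamma_{3}(G)^{2}=1$; (xii) $G'\cong C_{8}\times C_{4}$ or $C_{4}\times C_{4}\times C_{2}$, and $G'^{2}\subseteq\gamma_{3}(G)\cong C_{4}\times C_{4}$, $\gamma_{5}(G)\subseteq\gamma_{3}(G)^{2}\subseteq\gamma_{4}(G)\cong C_{4}\times C_{2}$; (xiii) $G'\cong S(32,m)$ for some $m\in\{4,12,24,25,26\}$, and $G'^{2}\subseteq\gamma_{3}(G)\cong C_{4}\times C_{4}$, $\gamma_{4}(G)\cong C_{4}\times C_{2}$, $\gamma_{5}(G)=\gamma_{3}(G)^{2}$ and $\gamma_{6}(G)=1$; (xiv) $G'\cong S(32,m)$ for some $m\in\{4,12,24,25,26,31,32,33,34,35\}$, and $G'^{2}\subseteq\gamma_{3}(G)\cong C_{4}\times C_{4}$, $\gamma_{4}(G)\cong C_{4}\times C_{2}$, $\gamma_{5}(G)=\gamma_{3}(G)^{2}$ and $\gamma_{6}(G)\cong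 C_{2}$; (xv) $G'\cong S(32,m)$ for some $m\in\{4,12,24,25,26\}$, and $G'^{2}\subseteq\gamma_{3}(G)\cong C_{4}\times C_{4}$, $\gamma_{5}(G)\subseteq\gamma_{3}(G)^{2}\subseteq\gamma_{4}(G)\cong C_{4}\times C_{2}$ and $\gamma_{5}(G)\cong C_{2}$; (xvi) $G'\cong C_{8}\times C_{4}$ or $C_{4}\times C_{4}\times C_{2}$, and $G'^{2}\subseteq\gamma_{3}(G)\cong C_{4}\times C_{4}$, $\gamma_{4}(G)\cong C_{4}$, $|\gamma_{3}(G)^{2}\cap\gamma_{4}(G)|=2$ and $\gamma_{5}(G)\subseteq\gamma_{3}(G)^{2}$; (xvii) $G'\cong S(32,m)$ for some $m\in\{4,12,24,25,26\}$, and $G'^{2}\subseteq\gamma_{3}(G)\cong C_{4}\times C_{4}$, $\gamma_{4}(G)\cong C_{4}$, $|\gamma_{3}(G)^{2}\cap\gamma_{4}(G)|=2$, $\gamma_{5}(G)\subseteq\gamma_{3}(G)^{2}$ and $\gamma_{5}(G)\cong C_{2}$; (xviii) $G'\cong S(32,m)$ for some $m\in\{4,5,12,17\}$, and $\gamma_{3}(G)\cong C_{4}\times C_{2}$, $|G'^{2}\cap\gamma_{3}(G)|=4$, $\gamma_{4}(G)\cong C_{4}$, $|\gamma_{3}(G)^{2}G'^{4}\cap\gamma_{4}(G)|=2$, $\gamma_{5}(G)\cong C_{2}$ and $\gamma_{5}(G)\subseteq\gamma_{3}(G)^{2}G'^{4}\cong C_{2}\times C_{2}$; (xix) $G'\cong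 C_{8}\times C_{2}\times C_{2}$ or $C_{4}\times C_{4}\times C_{2}$, and $\gamma_{3}(G)\cong C_{4}\times C_{2}$, $|G'^{2}\cap\gamma_{3}(G)|=2$, $\gamma_{4}(G)\cong C_{4}$, $|\gamma_{3}(G)^{2}G'^{4}\cap\gamma_{4}(G)|=2$ and $\gamma_{5}(G)\subseteq\gamma_{3}(G)^{2}G'^{4}\cong C_{2}\times C_{2}$; (xx) $G'\cong S(32,m)$ for some $m\in\{24,25,26,37,38\}$, and $\gamma_{3}(G)\cong C_{4}\times C_{2}$, $|G'^{2}\cap\gamma_{3}(G)|=2$, $\gamma_{4}(G)\cong C_{4}$, $|\gamma_{3}(G)^{2}G'^{4}\cap\gamma_{4}(G)|=2$, $\gamma_{5}(G)\cong C_{2}$ and $\gamma_{5}(G)\subseteq\gamma_{3}(G)^{2}G'^{4}\cong C_{2}\times C_{2}$. (2) $p=17$, $G'\cong C_{17}\times C_{17}$ and $\gamma_{3}(G)\cong C_{17}$.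
   Context: The group $G$ is not necessarily finite. $KG$ is the group algebra of $G$ over $K$. The upper Lie powers of $KG$ are defined by $KG^{(1)}=KG$ and, for $n\geq 2$, $KG^{(n)}$ is the two-sided ideal of $KG$ generated by all Lie commutators $[x,y]=xy-yx$ with $x\in KG^{(n-1)}$, $y\in KG$. The upper Lie nilpotency index of $KG$ is $t^{L}(KG)=\min\{n: KG^{(n)}=0\}$ (it is finite when $G$ is nilpotent and $G'$ is a finite $p$-group, $p=\operatorname{char}K$). $\gamma_i(G)$ is the $i$th term of the lower central series of $G$ ($\gamma_1(G)=G$, $\gamma_{i+1}(G)=[\gamma_i(G),G]$), and $G'=\gamma_2(G)$ is the commutator subgroup. For a group $H$ and positive integer $m$, $H^{m}$ denotes the subgroup generated by all $m$th powers of elements of $H$; thus $G'^{2}=(G')^{2}$, $G'^{4}=(G')^{4}$, and $\gamma_{3}(G)^{2}G'^{4}$ is the product of the two normal subgroups $\gamma_3(G)^2$ and $G'^4$. $C_m$ is the cyclic group of order $m$. $S(n,m)$ denotes the group number $m$ of order $n$ in the Small Groups Library of GAP, i.e. SmallGroup$(n,m)$. A chain such as $A\subseteq B\cong C$ means $A\subseteq B$ and $B\cong C$. *)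

(* Defs.v *)
From HB Require Import structures.
From mathcomp Require Import all_boot all_order all_algebra all_fingroup finmap.
From mathcomp Require Import monalg.
From mathcomp Require Import boolp classical_sets functions cardinality.

Set Implicit Arguments.
Unset Strict Implicit.
Unset Printing Implicit Defensive.

Import GRing.Theory.

Local Open Scope classical_set_scope.

(* {malg K[G]} is the free K-module on G, but its library ring structure needs
   a monomType, which excludes nontrivial groups; so the convolution product is
   put here on an alias. *)
Definition group_algebra (K : fieldType) (G : groupType) := {malg K[G]}.

HB.instance Definition _ (K : fieldType) (G : groupType) :=
  GRing.Lmodule.on (group_algebra K G).

Section GroupAlgebraRing.
Local Open Scope fset_scope.
Local Open Scope ring_scope.

Variables (K : fieldType) (G : groupType).
Local Notation KG := (group_algebra K G).
Implicit Types f g h : KG.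

Definition ga_one : KG := << 1%g >>.

Definition ga_mul f g : KG :=
  \sum_(x <- msupp f) \sum_(y <- msupp g) << f@_x * g@_y *g (x * y)%g >>.

Let ga_mulw (d1 d2 : {fset G}) f g :
  msupp f `<=` d1 -> msupp g `<=` d2 ->
  ga_mul f g = \sum_(x <- d1) \sum_(y <- d2) << f@_x * g@_y *g (x * y)%g >>.
Proof.
move=> le1 le2; rewrite /ga_mul (big_fset_incl _ le1) /=.
  apply/eq_bigr=> x _; apply/big_fset_incl => // y _ /mcoeff_outdom ->.
  by rewrite mulr0 monalgU0.
move=> x _ /mcoeff_outdom fx.
by rewrite big1 // => y _; rewrite fx mul0r monalgU0.
Qed.

Let ga_mul0g : left_zero 0 ga_mul.
Proof. by move=> g; rewrite /ga_mul msupp0 big_seq_fset0. Qed.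

Let ga_mulg0 : right_zero 0 ga_mul.
Proof.
by move=> g; rewrite /ga_mul big1 // => x _; rewrite msupp0 big_seq_fset0.
Qed.

Let ga_mulUU (a b : K) (x y : G) :
  ga_mul << a *g x >> << b *g y >> = << a * b *g (x * y)%g >>.
Proof. by rewrite (ga_mulw msuppU_le msuppU_le) !big_seq_fset1 !mcoeffUU. Qed.

Let ga_mulDl : left_distributive ga_mul +%R.
Proof.
move=> f g h.
rewrite [in RHS](ga_mulw (fsubsetUl _ (msupp g)) (fsubset_refl _)).
rewrite [in RHS](ga_mulw (fsubsetUr (msupp f) _) (fsubset_refl _)).
rewrite (ga_mulw (msuppD_le _ _) (fsubset_refl _)) -big_split /=.
apply/eq_bigr=> x _; rewrite -big_split /=; apply/eq_bigr=> y _.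
by rewrite mcoeffD mulrDl monalgUD.
Qed.

Let ga_mulDr : right_distributive ga_mul +%R.
Proof.
move=> h f g.
rewrite [in RHS](ga_mulw (fsubset_refl _) (fsubsetUl _ (msupp g))).
rewrite [in RHS](ga_mulw (fsubset_refl _) (fsubsetUr (msupp f) _)).
rewrite (ga_mulw (fsubset_refl _) (msuppD_le _ _)) -big_split /=.
apply/eq_bigr=> x _; rewrite -big_split /=; apply/eq_bigr=> y _.
by rewrite mcoeffD mulrDr monalgUD.
Qed.

Let ga_mulEl f g :
  ga_mul f g = \sum_(x <- msupp f) ga_mul << f@_x *g x >> g.
Proof.
apply/eq_bigr=> x _; rewrite (ga_mulw msuppU_le (fsubset_refl _)).
by rewrite big_seq_fset1 mcoeffUU.
Qed.

Let ga_mulEr f g :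
  ga_mul f g = \sum_(y <- msupp g) ga_mul f << g@_y *g y >>.
Proof.
rewrite /ga_mul exchange_big /=; apply/eq_bigr=> y _.
rewrite -/(ga_mul _ _) (ga_mulw (fsubset_refl _) msuppU_le).
by apply/eq_bigr=> x _; rewrite big_seq_fset1 mcoeffUU.
Qed.

Let ga_mul1g : left_id ga_one ga_mul.
Proof.
move=> g; rewrite ga_mulEr [RHS]monalgE.
by apply/eq_bigr=> x _; rewrite ga_mulUU mul1r mul1g.
Qed.

Let ga_mulg1 : right_id ga_one ga_mul.
Proof.
move=> g; rewrite ga_mulEl [RHS]monalgE.
by apply/eq_bigr=> x _; rewrite ga_mulUU mulr1 mulg1.
Qed.

Let ga_mulA : associative ga_mul.
Proof.
move=> f g h.
rewrite [RHS](big_morph (ga_mul^~ _) (fun _ _ => ga_mulDl _ _ _) (ga_mul0g _)).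
rewrite ga_mulEl; apply/eq_bigr=> x _.
rewrite [LHS](big_morph (ga_mul _) (fun _ _ => ga_mulDr _ _ _) (ga_mulg0 _)).
rewrite [RHS](big_morph (ga_mul^~ _) (fun _ _ => ga_mulDl _ _ _) (ga_mul0g _)).
apply/eq_bigr=> y _.
rewrite [LHS](big_morph (ga_mul _) (fun _ _ => ga_mulDr _ _ _) (ga_mulg0 _)).
by rewrite ga_mulEr; apply/eq_bigr=> z _; rewrite !ga_mulUU mulrA mulgA.
Qed.

Let ga_oner_neq0 : ga_one != 0.
Proof. by rewrite monalgU_eq0 oner_eq0. Qed.

HB.instance Definition _ := GRing.Zmodule_isNzRing.Build (group_algebra K G)
  ga_mulA ga_mul1g ga_mulg1 ga_mulDl ga_mulDr ga_oner_neq0.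

End GroupAlgebraRing.

Section UpperLie.
Local Open Scope ring_scope.

Definition two_sided_ideal (R : pzRingType) (I : set R) : Prop :=
  [/\ I 0, forall x y, I x -> I y -> I (x - y)
    & forall r x, I x -> I (r * x) /\ I (x * r)].

Definition ideal_gen (R : pzRingType) (A : set R) : set R :=
  smallest (@two_sided_ideal R) A.

(* The n-th upper Lie power, for n >= 1; index 0 repeats index 1. *)
Definition upper_lie_power (R : pzRingType) (n : nat) : set R :=
  iter n.-1
    (fun I => ideal_gen [set x * y - y * x | x in I & y in [set: R]])
    [set: R].
Arguments upper_lie_power : clear implicits.

Definition is_upper_lie_index (R : pzRingType) (n : nat) : Prop :=
  [/\ (0 < n)%N, upper_lie_power R n = [set 0]
    & forall m, (0 < m)%N -> upper_lie_power R m = [set 0] -> (n <= m)%N].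

(* Takes the value 0 when no upper Lie power vanishes. *)
Definition upper_lie_index (R : pzRingType) : nat :=
  xget 0%N [set n | is_upper_lie_index R n].

End UpperLie.

Section Subgroups.
Local Open Scope group_scope.
Variable G : groupType.

Definition subgroup_set (H : set G) : Prop :=
  [/\ H 1, forall x y, H x -> H y -> H (x * y) & forall x, H x -> H x^-1].

Definition subgroup_gen (A : set G) : set G := smallest subgroup_set A.

(* The i-th term for i >= 1; index 0 repeats index 1. *)
Definition lower_central (i : nat) : set G :=
  iter i.-1
    (fun H => subgroup_gen [set [~ x, y] | x in H & y in [set: G]])
    [set: G].

Definition nilpotent_group : Prop :=
  exists c : nat, lower_central c.+1 = [set 1].

Definition power_subgroup (H : set G) (m : nat) : set G :=
  subgroup_gen [set x ^+ m | x in H].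

Definition set_mulg (A B : set G) : set G := [set x * y | x in A & y in B].

Definition isog_type (H : set G) (T : groupType) : Prop :=
  exists f : T -> G,
    {morph f : x y / x * y} /\ set_bij [set: T] H f.

End Subgroups.

Arguments lower_central : clear implicits.
Arguments nilpotent_group : clear implicits.

Notation "''gamma_' i ( G )" := (lower_central G i)
  (at level 8, i at level 2, format "''gamma_' i ( G )").
Notation "H ^^ m" := (power_subgroup H m) (at level 30).
Notation "A <**> B" := (set_mulg A B) (at level 40, left associativity).
Notation "H ~= T" := (isog_type H T%type) (at level 70, T at level 69).

Section SmallGroups.
Local Open Scope group_scope.

(* T is isomorphic to SmallGroup(32, m) of the GAP library, for the values of m
   used here. Each group is given by a presentation of order 32, where x ^ y is
   y^-1 x y, together with its usual name (M_r: the modular maximal-cyclic group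
   of order r; ":" a semidirect product; "o" a central product). *)
Definition is_small_group_32 (m : nat) (T : finGroupType) : Prop :=
  let S : {set T} := [set: T]%SET in
  match m with
  (* central extension of C4 x C4 by C2 = <[a, b]> *)
  | 2 => S \isog Grp (a : b : c :
           (a ^+ 4, b ^+ 4, c ^+ 2, [~ a, b] = c, [~ a, c], [~ b, c]))
  (* C8 : C4, with b acting as a |-> a^5 *)
  | 4 => S \isog Grp (a : b : (a ^+ 8, b ^+ 4, a ^ b = a ^+ 5))
  (* (C2 x C2) : C8 *)
  | 5 => S \isog Grp (a : b : c :
           (a ^+ 2, b ^+ 2, c ^+ 8, [~ a, b], [~ b, c], a ^ c = a * b))
  (* C4 : C8 *)
  | 12 => S \isog Grp (a : b : (a ^+ 4, b ^+ 8, a ^ b = a^-1))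
  (* M_32 *)
  | 17 => S \isog Grp (a : b : (a ^+ 16, b ^+ 2, a ^ b = a ^+ 9))
  (* C2 x ((C2 x C2) : C4) *)
  | 22 => S \isog Grp (a : b : c : d :
           (a ^+ 2, b ^+ 2, c ^+ 4, [~ a, b], [~ b, c], a ^ c = a * b,
            d ^+ 2, [~ a, d], [~ b, d], [~ c, d]))
  (* C2 x (C4 : C4) *)
  | 23 => S \isog Grp (a : b : c :
           (a ^+ 4, b ^+ 4, a ^ b = a^-1, c ^+ 2, [~ a, c], [~ b, c]))
  (* (C4 x C4) : C2, with b central and [a, c] = b^2 *)
  | 24 => S \isog Grp (a : b : c :
           (a ^+ 4, b ^+ 4, c ^+ 2, [~ a, b], [~ b, c], a ^ c = a * b ^+ 2))
  (* C4 x D8 *)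
  | 25 => S \isog Grp (a : b : c :
           (a ^+ 4, [~ a, b], [~ a, c], b ^+ 4, c ^+ 2, b ^ c = b^-1))
  (* C4 x Q8 *)
  | 26 => S \isog Grp (a : b : c :
           (a ^+ 4, [~ a, b], [~ a, c], b ^+ 4, c ^+ 2 = b ^+ 2, b ^ c = b^-1))
  (* C4 : D8 *)
  | 28 => S \isog Grp (a : b : c :
           (a ^+ 4, b ^+ 4, c ^+ 2, a ^ b = a^-1, a ^ c = a^-1, b ^ c = b^-1))
  (* (C2 x C2) : Q8 *)
  | 29 => S \isog Grp (a : b : c : d :
           (a ^+ 2, b ^+ 2, [~ a, b], c ^+ 4, d ^+ 2 = c ^+ 2, c ^ d = c^-1,
            [~ a, c], [~ b, c], a ^ d = a * b, [~ b, d]))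
  (* (C2 x C2).D8 *)
  | 30 => S \isog Grp (a : b : c : d :
           (a ^+ 2, b ^+ 2, c ^+ 4, d ^+ 2 = b, a ^ c = a * b, [~ a, d],
            [~ b, c], [~ b, d], c ^ d = c^-1))
  (* C4.D8 = (C4 x C4) : C2 *)
  | 31 => S \isog Grp (a : b : c :
           (a ^+ 4, b ^+ 4, [~ a, b], c ^+ 2,
            a ^ c = a * b ^+ 2, b ^ c = a ^+ 2 * b))
  (* (C4 x C4).C2 *)
  | 32 => S \isog Grp (a : b : c :
           (a ^+ 4, b ^+ 4, [~ a, b], c ^+ 2 = a ^+ 2,
            a ^ c = a * b ^+ 2, b ^ c = a ^+ 2 * b))
  (* (C4 x C4) : C2 *)
  | 33 => S \isog Grp (a : b : c :
           (a ^+ 4, b ^+ 4, [~ a, b], c ^+ 2,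
            a ^ c = a * b ^+ 2, b ^ c = a ^+ 2 * b^-1))
  (* (C4 x C4) : C2, acting by inversion *)
  | 34 => S \isog Grp (a : b : c :
           (a ^+ 4, b ^+ 4, [~ a, b], c ^+ 2, a ^ c = a^-1, b ^ c = b^-1))
  (* C4 : Q8 *)
  | 35 => S \isog Grp (a : b : c :
           (a ^+ 4, b ^+ 4, [~ a, b], c ^+ 2 = b ^+ 2,
            a ^ c = a^-1, b ^ c = b^-1))
  (* C2 x M_16 *)
  | 37 => S \isog Grp (a : b : c :
           (a ^+ 8, b ^+ 2, a ^ b = a ^+ 5, c ^+ 2, [~ a, c], [~ b, c]))
  (* C8 o D8 *)
  | 38 => S \isog Grp (a : b : c :
           (a ^+ 8, [~ a, b], [~ a, c], b ^+ 2 = a ^+ 4, c ^+ 2, b ^ c = b^-1))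
  (* C2 x C2 x D8 *)
  | 46 => S \isog Grp (a : b : c : d :
           (a ^+ 4, b ^+ 2, a ^ b = a^-1, c ^+ 2, d ^+ 2,
            [~ a, c], [~ b, c], [~ a, d], [~ b, d], [~ c, d]))
  (* C2 x C2 x Q8 *)
  | 47 => S \isog Grp (a : b : c : d :
           (a ^+ 4, b ^+ 2 = a ^+ 2, a ^ b = a^-1, c ^+ 2, d ^+ 2,
            [~ a, c], [~ b, c], [~ a, d], [~ b, d], [~ c, d]))
  (* C2 x (C4 o D8) *)
  | 48 => S \isog Grp (a : b : c : d :
           (a ^+ 4, [~ a, b], [~ a, c], b ^+ 2 = a ^+ 2, c ^+ 2, b ^ c = b^-1,
            d ^+ 2, [~ a, d], [~ b, d], [~ c, d]))
  | _ => False
  end.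

(* H is isomorphic to SmallGroup(32, m) for some m in ms. *)
Definition isog_S32 (G : groupType) (H : set G) (ms : seq nat) : Prop :=
  exists2 m : nat, m \in ms &
    exists2 T : finGroupType, is_small_group_32 m T & H ~= T.

End SmallGroups.

(* Main.v *)
From HB Require Import structures.
Require Import Defs.
From mathcomp Require Import all_boot all_order all_algebra all_fingroup all_solvable.
From mathcomp Require Import zify ring.

(* Write G' for the commutator subgroup and let D_1 = G', D_(m+1) = [D_m, G] D_r^p
   with r = floor(m / p) + 1, the Lie dimension subgroups with indices lowered by
   one.  The elements h - 1 with h in D_m lie in KG^(m+1), and monomials in such
   elements, weighted by m, span the upper Lie powers.  Refining the D_m to a chain
   of subgroups of index p, the sum of the elements of G' is a nonzero element of
   weight (p - 1) S, where S = sum of log_p |D_m|, while everything of larger weight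
   vanishes; hence t^L(KG) = 2 + (p - 1) S.

   Since G' acts on itself through commutators of G, [D_m, G'] <= D_(m+2), and the
   recursion restricts the possible orders severely: the value of the theorem forces
   p = 17 and (|D_m|) = (17^2, 17), or p = 2 and (|D_m|) = (32, 8, 4, 4, 2, 2, 2, 2)
   or (32, 16, 8, 4, 2, 2).  In the second case D_2 is cyclic of order 8, which makes
   G' abelian: cases (i) and (ii).  In the third one picks x in G' and s in G such
   that y = [x, s] and z = [y, s] generate D_2 = C4 x C4 = gamma_3(G), and computes
   the action of x on y and z: cases (xii) and (xiv), the latter only with the groups
   4, 32, 34 and 35.  The conditions of the remaining cases are contradictory. *)

(** The value in the theorem amounts to S = 1 + p + ... + p^(n-1) - 15. If w_k denotes the last
    index at which the order of the series is at least p^(n-k), then S is the sum of the w_k and w_k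
    <= p^k, so 15 is the total shortfall and few sequences survive. The restrictions on them come
    from the Frattini subgroup, from nilpotency, and from the Hall-Witt identity, which is what
    gives the commutators with G' their extra degree.

    G may be infinite, but all the group theory depends only on the finite group G' and on the
    automorphisms that G induces on it. It is carried out in a finite permutation group containing
    copies [N] of G' and [Gam] of this group of automorphisms.

    In the group algebra, collecting factors along the chain shows only that the upper Lie powers
    become stationary beyond the expected index; a separate argument shows that some power is 0.

    For the converse, S is computed directly under (2), (i), (ii), (xii) and (xiv). There the groups
    of order 32 matter only through an upper bound on their order and, for 17, 37 and 38, through
    their not being abelian. *)

(** * Numerical sequences with total shortfall 15 *)

Section Weights.
(** In the application [w k] is the last index at which the dimension series has order at least
    p^(n-k). The hypotheses [w_le], [w_dvd], [w_gap] and [w_2] are the numerical forms of [dim_gap],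
    [dim_mod_dvd], [dim_gap_pow] and [dim_gap_two]. *)
Variables (p n : nat) (w : nat -> nat).
Hypothesis pr_p : prime p.
Hypothesis w0 : 0 < n -> w 0 = 1.
Hypothesis w_mono : forall k, k.+1 < n -> w k <= w k.+1.
Hypothesis w_le : forall k, k.+1 < n -> w k.+1 <= p * w k.
Hypothesis w_dvd : forall k, k.+1 < n -> (w k).+1 < w k.+1 -> p %| w k.+1.
Hypothesis w_gap : forall a k l, 0 < a -> a.+1 < p * a -> k.+1 < n -> l < n ->
  w k <= a -> p * a <= w k.+1 -> (w l <= p * a) || (p * (p * a) <= w l).
Hypothesis w_2 : p = 2 -> forall k, k.+1 < n -> w k <= 3 -> w k.+1 < 6.
Hypothesis w_sum : \sum_(k < n) w k + 15 = \sum_(k < n) p ^ k.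

Let p_gt1 : 1 < p. Proof. exact: prime_gt1. Qed.

Let w_le_from k c : (k < n -> w k <= c) -> forall j, k + j < n -> w (k + j) <= c * p ^ j.
Proof.
move=> hk; elim=> [|j IH] h; first by rewrite addn0 expn0 muln1 hk // -(addn0 k).
rewrite addnS in h; rewrite addnS; apply: (leq_trans (w_le _ h)).
by rewrite expnS [leqRHS]mulnCA leq_mul2l IH ?orbT // ltnW.
Qed.

Let w_pow k : k < n -> w k <= p ^ k.
Proof.
move=> kn; have := @w_le_from 0 1 _ k; rewrite add0n mul1n; apply=> // n0.
by rewrite w0.
Qed.

Let deficit : \sum_(k < n) (p ^ k - w k) = 15.
Proof.
have E : \sum_(k < n) (p ^ k - w k) + \sum_(k < n) w k = \sum_(k < n) p ^ k.
  by rewrite -big_split; apply: eq_bigr => i _ /=; rewrite subnK // w_pow.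
lia.
Qed.

Let deficit1 k : k < n -> p ^ k <= w k + 15.
Proof.
move=> kn; rewrite -deficit (bigD1 (Ordinal kn)) //=; lia.
Qed.

Let deficit2 k l : k < l -> l < n -> p ^ k + p ^ l <= w k + w l + 15.
Proof.
move=> kl ln; have kn := ltn_trans kl ln.
rewrite -deficit (bigD1 (Ordinal kn)) //= (bigD1 (Ordinal ln)) /=; first lia.
by rewrite -val_eqE /= gtn_eqF.
Qed.

Let n_gt1 : 1 < n.
Proof.
move: deficit w0; case: n => [|[|m]] //; first by rewrite big_ord0.
by move=> d h; move: d; rewrite big_ord1 expn0 h.
Qed.

Let first_gap : exists2 k, [&& 0 < k, k < n & w k < p ^ k] &
  forall j, j < k -> w j = p ^ j.
Proof.
have ex : exists k, (k < n) && (w k < p ^ k).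
  case: (boolP [exists k : 'I_n, w k < p ^ k]) => [/existsP[k hk]|].
    by exists k; rewrite ltn_ord.
  rewrite negb_exists => /forallP h; move: deficit; rewrite big1 // => k _.
  by apply/eqP; rewrite subn_eq0 leqNgt h.
case: (ex_minnP ex) => k /andP[kn wk] kmin; exists k.
  by rewrite kn wk !andbT; case: k wk {kmin kn} => //; rewrite w0 // ltnW.
move=> j jk; have jn := ltn_trans jk kn; apply/eqP; rewrite eqn_leq w_pow //=.
rewrite leqNgt; apply/negP => h; have := kmin j; rewrite jn h => /(_ isT); lia.
Qed.

(** Let k be the first index with w_k < p^k. If k = 1, divisibility leaves w_1 <= 2, and n = 2 gives
    p = 15 + w_1; for larger n the shortfall is too big or divisibility fails. If k >= 2, [w_gap] at
    a = p^(k-2) pushes w_k down to p^(k-1), so the last term alone falls short by at least p^(n-1) -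
    p^(n-2), which exceeds 15. *)
Lemma weights_odd : odd p -> p = 17 /\ n = 2 /\ w 1 = 2.
Proof.
move=> podd; have p_gt2 : 2 < p by case: p pr_p podd p_gt1 => [|[|[]]].
have [k /and3P[k0 kn wk] wj] := first_gap.
have p5 : p <> 3 -> 4 < p.
  by move: pr_p podd p_gt2; case: p => [|[|[|[|[]]]]].
(* Here the right-hand side of [w_sum] would be 1 + 3 + 9 = 13, below 15. *)
have sum3 : p = 3 -> n != 3.
  move=> p3; apply/eqP=> n3; move: w_sum; rewrite n3 p3 !big_ord_recr !big_ord0 /=; lia.
have [k1|k1] := eqVneq k 1.
  rewrite k1 expn1 in wk kn; have w02 : w 0 = 1 by rewrite w0 // ltnW.
  have w1 : w 1 <= 2.
    rewrite leqNgt; apply/negP=> h; have := @w_dvd 0 kn; rewrite w02 => /(_ h) d.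
    by have := dvdn_leq _ d; lia.
  have wl j : 1 + j < n -> w (1 + j) <= 2 * p ^ j by apply: w_le_from.
  have [n2|n2] := eqVneq n 2.
    move: w_sum; rewrite n2 !big_ord_recr !big_ord0 /= w02 ?expn0 ?expn1 => E.
    have : p \in [:: 16; 17] by rewrite !inE; have := @w_mono 0 kn; lia.
    by rewrite !inE => /orP[/eqP p16|/eqP p17]; [move: pr_p; rewrite p16|split=> //; split=> //;
      lia].
  have n3 : 2 < n by lia.
  have d12 := @deficit2 1 2 isT n3; have w2 : w 2 <= 2 * p ^ 1 := wl 1 n3.
  have [p3|/eqP/p5 p5'] := eqVneq p 3; last first.
    have pp : 5 * p <= p * p by rewrite leq_mul2r p5' orbT.
    by rewrite /= !expnS !expn0 !muln1 in d12 w2; lia.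
  rewrite p3 in d12 w2 wl.
  have E := w_sum; have le_w := w_le; have dvd_w := w_dvd; have def1 := deficit1;
    rewrite p3 in E le_w dvd_w def1.
  have := sum3 p3 => n3'; have n4 : 3 < n by lia.
  have [n4'|n4'] := eqVneq n 4; last first.
    have n5 : 4 < n by lia.
    by have : w 4 <= 2 * 3 ^ 3 := wl 3 n5; have := def1 _ n5; rewrite /=; lia.
  move: E; rewrite n4' !big_ord_recr !big_ord0 /= w02 => E.
  have := le_w _ n3; have := le_w _ n4; have := dvd_w _ n4.
  rewrite /= in w2; move=> d h1 h2.
  (* Only the weights 1, 2, 6, 16 reach the sum 25, and 16 jumps over 7 without being a multiple of
     3. *)
  have e1 : w 2 = 6 by lia.
  have e2 : w 3 = 16 by lia.
  by move: d; rewrite e1 e2 => /(_ isT).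
have {k1} k2 : 1 < k by lia.
case: k k2 kn wk wj {k0} => [|[|k]] // _ kn wk wj.
have wk' : w k.+2 <= p * p ^ k.
  have a0 : 0 < p ^ k by rewrite expn_gt0 prime_gt0.
  have ak : (p ^ k).+1 < p * p ^ k by nia.
  have := w_gap (p ^ k) k k.+2 a0 ak (ltnW kn) kn.
  rewrite (wj k) // (wj k.+1) // -expnS => /(_ (leqnn _) (leqnn _)); case/orP=> // h.
  by rewrite leqNgt -expnS wk in h.
have hn : k.+2 + (n - k.+3) < n by lia.
have wn := @w_le_from k.+2 _ (fun _ => wk') (n - k.+3) hn.
have dn := deficit1 _ hn; rewrite -expnS -expnD in wn.
have e : k.+2 + (n - k.+3) = n.-1 by lia.
have e' : k.+1 + (n - k.+3) = n.-2 by lia.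
rewrite e e' in wn dn; have e2 : n.-1 = n.-2.+1 by lia.
rewrite e2 expnS in dn; rewrite {1}e2 in wn.
have [p3|/eqP/p5 p5'] := eqVneq p 3.
  have n4 : 3 < n by have := sum3 p3; lia.
  have : 3 ^ 2 <= p ^ n.-2 by rewrite p3 leq_exp2l //; lia.
  rewrite -[3 ^ 2]/9; rewrite p3 in dn wn *; lia.
have : p ^ 1 <= p ^ n.-2 by rewrite leq_exp2l //; lia.
rewrite expn1; nia.
Qed.

(** Since 1 + 2 + 4 + 8 = 15, at least five terms are needed; for n >= 6 the last one or two terms
    already fall short by 16 or more. For n = 5 the weights sum to 16, and besides the two solutions
    the growth bound leaves (1,2,2,4,7) and (1,2,3,5,5), excluded by [w_dvd], and (1,2,4,4,5),
    excluded by [w_gap] at a = 2. *)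
Lemma weights_two : p = 2 ->
  n = 5 /\ ((forall k, k < 5 -> w k = nth 0 [:: 1; 1; 2; 4; 8] k) \/
            (forall k, k < 5 -> w k = nth 0 [:: 1; 2; 3; 4; 6] k)).
Proof.
move=> p2; have [k /and3P[k0 kn wk] wj] := first_gap.
have pow j : p ^ j.+1 = 2 * p ^ j by rewrite expnS p2.
have n5 : 4 < n.
  rewrite ltnNge; apply/negP=> n4.
  have : \sum_(i < n) p ^ i <= 15.
    rewrite p2; case: n n4 => [|[|[|[|[|]]]]] // _; by rewrite ?big_ord_recr ?big_ord0.
  have : 0 < \sum_(i < n) w i.
    have n0 : 0 < n by lia.
    by rewrite (bigD1 (Ordinal n0)) //= w0.
  lia.
have w00 : w 0 = 1 by rewrite w0 // ltnW // ltnW // ltnW // ltnW.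
have [n1 n2 n3] : [/\ 1 < n, 2 < n & 3 < n] by split; lia.
have sum5 : n = 5 -> w 1 + w 2 + w 3 + w 4 = 15.
  move=> e; move: w_sum; rewrite e p2 !big_ord_recr !big_ord0 /= w00; lia.
have := w_mono _ n1; have := w_mono _ n2; have := w_mono _ n3; have := w_mono _ n5.
have := w_le _ n1; have := w_le _ n2; have := w_le _ n3; have := w_le _ n5.
move=> l4 l3 l2 l1 m4 m3 m2 m1; rewrite p2 w00 in l1 l2 l3 l4 m1.
(* A bound [c] on one weight doubles at each step up to the last weight; the room [d] that it leaves
   below 2^(n-1) is part of the total shortfall. *)
have last d c k' : k' <= 5 -> (k' < n -> w k' <= c) -> n != 5 ->
    c * 2 ^ (n.-1 - k') + d <= 2 ^ n.-1 -> d <= 15.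
  move=> k5 hc nn5; have hh : k' + (n.-1 - k') < n by lia.
  have := w_le_from _ _ hc _ hh; have := deficit1 _ hh.
  have -> : k' + (n.-1 - k') = n.-1 by lia.
  rewrite p2; lia.
have n32 : n != 5 -> 2 ^ 5 <= 2 ^ n.-1 by move=> ?; rewrite leq_exp2l //; lia.
have [k1|k1] := eqVneq k 1.
  rewrite k1 p2 expn1 in wk; have w1 : w 1 = 1 by lia.
  have [e|ne] := eqVneq n 5.
    split=> //; left; have := sum5 e => s.
    by case=> [|[|[|[|[|]]]]] //= _; lia.
  have h : forall j, n.-1 = j.+1 -> 2 ^ n.-1 = 2 * 2 ^ (n.-1 - 1).
    by move=> j ->; rewrite subn1 expnS.
  have := @last 16 1 1 isT (fun _ => eq_leq w1) ne; rewrite mul1n.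
  have := n32 ne; rewrite (h n.-2); last by lia.
  rewrite -[2 ^ 5]/32; lia.
have wj1 : w 1 = 2 by rewrite wj ?p2 //; lia.
rewrite wj1 in l2 m2.
have [k2|k2] := eqVneq k 2.
  rewrite k2 p2 -[2 ^ 2]/4 in wk.
  have [e|ne] := eqVneq n 5.
    split=> //; right; have s := sum5 e.
    have d3 := w_dvd _ n3; have d4 := w_dvd _ n5; rewrite p2 in d3 d4.
    have g4 := w_2 p2 _ n5.
    have : w 2 \in [:: 2; 3] by rewrite !inE; lia.
    rewrite !inE => /orP[/eqP w2|/eqP w2]; rewrite wj1 w2 in s l3 l4 m3 m4 d3 d4.
      have : w 3 \in [:: 4] by rewrite inE; lia.
      rewrite inE => /eqP w3; have w4 : w 4 = 7 by lia.
      by move: d4; rewrite w3 w4 => /(_ isT).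
    have : w 3 \in [:: 4; 5] by rewrite !inE; lia.
    rewrite !inE => /orP[/eqP w3|/eqP w3].
      by case=> [|[|[|[|[|]]]]] //= _; lia.
    by move: d3; rewrite w3 => /(_ isT).
  have h j : j <= n.-1 -> 2 ^ n.-1 = 2 ^ j * 2 ^ (n.-1 - j).
    by move=> hj; rewrite -expnD subnKC.
  have [e6|ne6] := eqVneq n 6.
    have n5' : 5 < n by lia.
    have : w 2 = 2 \/ w 2 = 3 by lia.
    case=> w2.
      have := @last 16 2 2 isT (fun _ => eq_leq w2) ne.
      by rewrite e6 /= => /(_ isT).
    have w3 := w_2 p2 _ n3; rewrite w2 in w3.
    have := @w_le _ n5; have := @w_le _ n5'; have := deficit1 _ n5'.
    have := @deficit2 3 4 isT n5; have := w_sum.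
    rewrite e6 p2 !big_ord_recr !big_ord0 /= w00 wj1 w2; lia.
  have n6 : 2 <= n.-1 by lia.
  have w2 : w 2 <= 3 by lia.
  have := @last 16 3 2 isT (fun _ => w2) ne; rewrite (h 2) //.
  have : 2 ^ 4 <= 2 ^ (n.-1 - 2) by rewrite leq_exp2l //; lia.
  by lia.
have {k0 k1 k2} k3 : 2 < k by lia.
case: k k3 kn wk wj => [|[|k]] // k3 kn wk wj.
have k1 : 0 < k by lia.
have wk' : w k.+2 <= p * p ^ k.
  have a1 : 2 ^ 1 <= p ^ k by rewrite p2 leq_exp2l.
  have a0 : 0 < p ^ k by lia.
  have ak : (p ^ k).+1 < p * p ^ k by rewrite p2 in a1 *; lia.
  have := w_gap (p ^ k) k k.+2 a0 ak (ltnW kn) kn.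
  rewrite (wj k) // (wj k.+1) // -expnS => /(_ (leqnn _) (leqnn _)); case/orP=> // h.
  by rewrite leqNgt -expnS wk in h.
have hn : k.+2 + (n - k.+3) < n by lia.
have wn := @w_le_from k.+2 _ (fun _ => wk') (n - k.+3) hn.
have dn := deficit1 _ hn; rewrite -expnS -expnD in wn.
have e : k.+2 + (n - k.+3) = n.-1 by lia.
have e' : k.+1 + (n - k.+3) = n.-2 by lia.
rewrite e e' in wn dn; have e2 : n.-1 = n.-2.+1 by lia.
rewrite e2 expnS in dn; rewrite {1}e2 in wn; rewrite !p2 in wn dn.
have [e5|ne] := eqVneq n 5; last first.
  have : 2 ^ 4 <= 2 ^ n.-2 by rewrite leq_exp2l //; lia.
  by rewrite -[2 ^ 4]/16; lia.
have s := sum5 e5; have w2 : w 2 = 4 by rewrite wj ?p2 //; lia.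
have : k = 1 \/ k = 2 by lia.
case=> ek; rewrite ek p2 -?[2 * 2 ^ 1]/4 in wk' wj; last first.
  by have := wj 3 isT; rewrite -[2 ^ 3]/8 => w3; lia.
have w3 : w 3 = 4 by lia.
have w4 : w 4 = 5 by lia.
have := @w_gap 2 1 4 isT; rewrite p2 wj1 w2 w4 => /(_ isT n2 n5 isT isT).
by [].
Qed.

End Weights.

Set Implicit Arguments.
Unset Strict Implicit.
Unset Printing Implicit Defensive.

(** * The Lie dimension series and the constraints on its jumps *)

Section DimensionSeries.
Local Open Scope group_scope.

(* On a model [M] of G' with operators [L], this is the term of index i + 2 of
   the lower central series of G. *)
Definition rel_lower (X : finGroupType) (M L : {group X}) i :=
  iter i (fun H : {group X} => [~: H, L]%G) M.

Definition pow_group (X : finGroupType) (H : {set X}) k : {group X} :=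
  <<[set x ^+ k | x in H]>>%G.

Variables (X : finGroupType) (N Gam : {group X}) (p : nat).

(** [dim_rec k i] is the term of index i + 1. The argument [k] is fuel, since the recursion also
    calls the index [i %/ p]; every [k >= i] gives the same group. *)
Fixpoint dim_rec (k i : nat) : {group X} :=
  match k, i with
  | k'.+1, i'.+1 => ([~: dim_rec k' i', Gam] <*> pow_group (dim_rec k' (i %/ p)) p)%G
  | _, _ => N
  end.

(* Jennings' recursion with all indices lowered by one: [dim_series m] is the
   Lie dimension subgroup of index m + 1; index 0 repeats index 1. *)
Definition dim_series m := dim_rec m.-1 m.-1.
Local Notation D := dim_series.

Hypothesis pr_p : prime p.
Hypothesis pN : p.-group N.
Hypothesis nNG : Gam \subset 'N(N).
(** An element of G' acts on G' both as a member of [N] and as a member of the derived subgroup of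
    [Gam], although [N] need not lie in [Gam]. *)
Hypothesis innN : forall x, x \in N ->
  exists2 c, c \in [~: Gam, Gam] & {in N, forall y, y ^ x = y ^ c}.
Hypothesis nilN : exists c, iter c (fun H : {group X} => [~: H, Gam]%G) N :=: 1.

Lemma eq_group_sub (A B : {group X}) : A \subset B -> B \subset A -> A = B.
Proof. by move=> sAB sBA; apply/val_inj/eqP; rewrite eqEsubset; apply/andP. Qed.

Lemma mem_pow_group (H : {set X}) k x : x \in H -> x ^+ k \in pow_group H k.
Proof. by move=> Hx; apply/mem_gen/imset_f. Qed.

Lemma pow_groupS (A B : {set X}) k : A \subset B -> pow_group A k \subset pow_group B k.
Proof. by move=> sAB; apply/genS/imsetS. Qed.

Lemma pow_group_sub (H L : {group X}) k :
  (forall x, x \in H -> x ^+ k \in L) -> pow_group H k \subset L.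
Proof. by move=> h; rewrite gen_subG; apply/subsetP=> _ /imsetP[x Hx ->]; apply: h. Qed.

Lemma pow_group_subset (H : {group X}) k : pow_group H k \subset H.
Proof. by apply: pow_group_sub => x Hx; apply: groupX. Qed.

Lemma pow_group_norm (H : {group X}) k (A : {set X}) :
  A \subset 'N(H) -> A \subset 'N(pow_group H k).
Proof.
move=> nHA; apply: norms_gen; apply/subsetP=> a Aa; rewrite inE.
apply/subsetP=> _ /imsetP[_ /imsetP[x Hx ->] ->].
by rewrite conjXg; apply/imset_f; rewrite memJ_norm // (subsetP nHA).
Qed.

Lemma dim_recE k i : i <= k -> dim_rec k i = dim_rec i i.
Proof.
elim/ltn_ind: i k => -[|i] IH [|k] //= ik; rewrite (IH i) //.
have h : i.+1 %/ p <= i by rewrite -ltnS ltn_Pdiv // prime_gt1.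
by rewrite (IH _ _ k) ?(IH _ _ i) // (leq_trans h).
Qed.

Lemma dim_seriesS m : 0 < m ->
  D m.+1 = ([~: D m, Gam] <*> pow_group (D (m %/ p).+1) p)%G.
Proof.
case: m => // m _; rewrite /D /= [dim_rec m (_ %/ _)]dim_recE //.
by rewrite -ltnS ltn_Pdiv // prime_gt1.
Qed.

Lemma dim_series1 : D 1 = N. Proof. by []. Qed.

Lemma dim_sub_norm m : (D m \subset N) && (Gam \subset 'N(D m)).
Proof.
elim/ltn_ind: m => -[|[|m]] IH; try by rewrite subxx.
rewrite dim_seriesS //; have /andP[s1 n1] := IH m.+1 (ltnSn _).
have h : (m.+1 %/ p).+1 < m.+2 by rewrite ltnS ltn_Pdiv // prime_gt1.
have /andP[s2 n2] := IH _ h; apply/andP; split.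
  by rewrite join_subG (subset_trans (pow_group_subset _ _)) // (subset_trans _ s1) ?commg_subl.
rewrite normsY ?pow_group_norm // normsR // ?normG.
Qed.

Lemma dim_sub m : D m \subset N. Proof. by have /andP[] := dim_sub_norm m. Qed.
Lemma dim_norm m : Gam \subset 'N(D m). Proof. by have /andP[] := dim_sub_norm m. Qed.

Lemma inner_norm (H : {group X}) : H \subset N -> Gam \subset 'N(H) -> N \subset 'N(H).
Proof.
move=> sHN nHG; apply/subsetP=> x Nx; rewrite inE; have [c Gc cE] := innN Nx.
apply/subsetP=> _ /imsetP[y Hy ->]; rewrite cE ?(subsetP sHN) //.
rewrite memJ_norm //; apply: (subsetP nHG); apply: subsetP Gc.
by rewrite commg_subl normG.
Qed.

Lemma dim_anti m : D m.+1 \subset D m.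
Proof.
case: m => [//|m]; elim/ltn_ind: m => -[|m] IH; first exact: dim_sub.
rewrite [D m.+3]dim_seriesS // [in X in _ \subset X]dim_seriesS //; apply: genS; apply: setUSS.
  by apply: commSg; apply: IH.
apply: pow_groupS; rewrite [m.+2 %/ p]divnS ?prime_gt0 //.
case: (p %| m.+2); rewrite ?add0n // add1n.
by apply: IH; rewrite ltn_Pdiv // prime_gt1.
Qed.

Lemma dim_le i j : i <= j -> D j \subset D i.
Proof.
move=> /subnKC <-; elim: (j - i) => [|k IH]; first by rewrite addn0.
by rewrite addnS (subset_trans (dim_anti _)).
Qed.

Lemma dim_comm m : [~: D m, Gam] \subset D m.+1.
Proof.
case: m => [|m]; last by rewrite [in X in _ \subset X]dim_seriesS //= joing_subl.
by rewrite commg_subl dim_norm.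
Qed.

Lemma dim_commg m x g : x \in D m -> g \in Gam -> [~ x, g] \in D m.+1.
Proof. by move=> Dx Gg; apply: (subsetP (dim_comm _)); apply: mem_commg. Qed.

(** At index pm the recursion takes p-th powers of the term of index floor((pm - 1)/p) + 1 = m. *)
Lemma dim_pow m x : x \in D m -> x ^+ p \in D (p * m).
Proof.
case: m => [|m] Dx; first by rewrite muln0 groupX.
have pm : (0 < (p * m.+1).-1)%N.
  by have := prime_gt1 pr_p; nia.
have e : (p * m.+1 = (p * m.+1).-1.+1)%N by rewrite prednK //; move: pm; lia.
rewrite e dim_seriesS // (subsetP (joing_subr _ _)) //.
have -> : ((p * m.+1).-1 %/ p)%N = m.
  have p0 := prime_gt0 pr_p; have -> : ((p * m.+1).-1 = m * p + p.-1)%N by nia.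
  by rewrite divnMDl // divn_small ?addn0 // prednK.
exact: mem_pow_group.
Qed.

(** When p does not divide m, the quotients of m and m - 1 by p have the same floor, so the terms m
    + 1 and m are built from the same p-th powers, and from the same commutators by assumption. *)
Lemma dim_mod_dvd m : 1 < m -> ~~ (p %| m) -> D m.-1 = D m -> D m.+1 = D m.
Proof.
case: m => [|[|m]] // _ pm /= e; rewrite [in LHS]dim_seriesS // -e.
by rewrite [m.+2 %/ p]divnS ?prime_gt0 // (negbTE pm) add0n -dim_seriesS.
Qed.

Lemma pgroup_sub (H : {group X}) : H \subset N -> p.-group H.
Proof. by move=> sHN; apply: pgroupS pN. Qed.

(** Substituting the inclusion into itself places [B] in C_i Q for every term C_i of the series N,
    [N, Gam], [N, Gam, Gam], ..., which reaches 1. *)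
Lemma sub_of_comm_sub (B Q : {group X}) :
  B \subset N -> N \subset 'N(Q) -> Gam \subset 'N(Q) ->
  B \subset [~: B, Gam] <*> Q -> B \subset Q.
Proof.
move=> sBN nQN nQG sB; have [c c1] := nilN.
have nC i : Gam \subset 'N(iter i (fun H : {group X} => [~: H, Gam]%G) N).
  by elim: i => [|i IH] //=; rewrite normsR ?normG.
have sC i : iter i (fun H : {group X} => [~: H, Gam]%G) N \subset N.
  by elim: i => [|i IH] //=; apply: subset_trans IH; rewrite commg_subl.
suff: forall i, B \subset iter i (fun H : {group X} => [~: H, Gam]%G) N <*> Q.
  by move/(_ c); rewrite c1 joing1G.
elim=> [|i IH]; first by rewrite (subset_trans sBN) ?joing_subl.
have {IH} := commSg Gam IH; move=> IH.
apply: subset_trans sB _; rewrite join_subG joing_subr andbT /=.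
apply: subset_trans IH _; rewrite gen_subG.
pose C := iter i (fun H : {group X} => [~: H, Gam]%G) N; rewrite -/C.
have nQC : C \subset 'N(Q) := subset_trans (sC i) nQN.
apply/subsetP=> _ /imset2P[x g + Gg ->]; rewrite norm_joinEl //.
case/mulsgP=> y q Cy Qq ->; rewrite commMgJ groupM //.
  have /= nq : q \in 'N([~: C, Gam] <*> Q)
    by rewrite (subsetP (normG _)) // (subsetP (joing_subr _ _)).
  by rewrite memJ_norm // (subsetP (joing_subl _ _)) // mem_commg.
rewrite (subsetP (joing_subr _ _)) // commgEl groupM ?groupV //.
by rewrite memJ_norm // (subsetP nQG).
Qed.

Lemma comm_sub_trivial (H : {group X}) : H \subset N -> H \subset [~: H, Gam] -> H :=: 1.
Proof.
move=> sHN sH; apply/trivgP; apply: sub_of_comm_sub => //; try by rewrite norms1.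
by rewrite joingG1.
Qed.

Lemma frattini_trivial (H : {group X}) : H \subset N -> Gam \subset 'N(H) ->
  H \subset [~: H, Gam] <*> pow_group H p -> H :=: 1.
Proof.
move=> sHN nHG sH; apply: comm_sub_trivial => //; have pH := pgroup_sub sHN.
have s1 : [~: H, Gam] \subset H by rewrite commg_subl.
suff: [~: H, Gam] = H by move=> ->.
rewrite -[LHS]genGid; apply: (@Phi_nongen _ H); apply/eqP;
  rewrite eqEsubset join_subG Phi_sub s1 /=.
apply: subset_trans sH _; rewrite joingC join_subG joing_subr andbT.
apply: subset_trans (joing_subl _ _); rewrite (Phi_joing pH).
apply: pow_group_sub => x Hx; apply: (subsetP (joing_subr _ _)).
by have := Mho_p_elt 1 Hx (mem_p_elt pH Hx); rewrite expn1.
Qed.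

(** The series is a constant H from a + 1 to pa + 1, and the recursion at pa reads H = [H, Gam]
    H^p. *)
Lemma dim_gap a : 0 < a -> D a.+1 = D (p * a).+1 -> D a.+1 :=: 1.
Proof.
move=> a0 e; apply: frattini_trivial (dim_sub _) (dim_norm _) _.
have pa : (a < p * a)%N by rewrite ltn_Pmull // prime_gt1.
have e' : D (p * a) = D a.+1.
  by apply: eq_group_sub; [rewrite dim_le | rewrite e dim_le].
rewrite {1}e (@dim_seriesS (p * a)); last by rewrite muln_gt0 prime_gt0.
by rewrite mulKn ?prime_gt0 // e' subxx.
Qed.

(** The three subgroups argument: the Hall-Witt identity puts [a, b, h] into [H, Gam, Gam] for a, b
    in [Gam], and the elements of [N] act through products of such [a, b]. *)
Lemma comm_inner (H : {group X}) : H \subset N -> Gam \subset 'N(H) ->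
  [~: H, N] \subset [~: H, Gam, Gam].
Proof.
move=> sHN nHG; set L := [~: H, Gam, Gam].
have nG1 : Gam \subset 'N([~: H, Gam]) by rewrite normsR ?normG.
have nGL : Gam \subset 'N(L) by rewrite normsR ?normG.
have s1 : [~: H, Gam] \subset H by rewrite commg_subl.
have sLN : L \subset N by rewrite (subset_trans _ sHN) // (subset_trans _ s1) // commg_subl.
have nHL : H \subset 'N(L) by rewrite (subset_trans sHN) // inner_norm.
have comG a b h : a \in Gam -> b \in Gam -> h \in H -> [~ [~ a, b], h] \in L.
  move=> Ga Gb Hh; rewrite -(memJ_norm _ (subsetP nGL _ (groupVr Gb))).
  have := Hall_Witt_identity a b^-1 h; rewrite invgK => hw.
  have -> : [~ a, b, h] ^ b^-1 =
    ([~ b^-1, h^-1, a] ^ h * [~ h, a^-1, b^-1] ^ a)^-1.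
    by apply/eqP; rewrite -mulg_eq1 mulgA hw.
  rewrite groupV groupM //.
    rewrite memJ_norm ?(subsetP nHL) //; apply: mem_commg => //.
    by rewrite commGC mem_commg ?groupV.
  by rewrite memJ_norm ?(subsetP nGL) // !mem_commg ?groupV.
rewrite gen_subG; apply/subsetP=> _ /imset2P[h x Hh Nx ->].
have [c Gc cE] := innN Nx; rewrite commgEl cE ?(subsetP sHN) // -commgEl.
have nLG' : [~: Gam, Gam] \subset [set y in Gam | [forall z in H, [~ y, z] \in L]].
  have gS : group_set [set y in Gam | [forall z in H, [~ y, z] \in L]].
    apply/group_setP; split=> [|y z].
      by rewrite inE group1; apply/forall_inP=> z Hz; rewrite comm1g group1.
    rewrite !inE => /andP[Gy /forall_inP hy] /andP[Gz /forall_inP hz].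
    rewrite groupM //; apply/forall_inP=> t Ht; rewrite commMgJ groupM ?hz //.
    by rewrite memJ_norm ?hy // (subsetP nGL).
  rewrite (gen_subG _ (Group gS)); apply/subsetP=> _ /imset2P[a b Ga Gb ->].
  by rewrite inE groupR //; apply/forall_inP=> z Hz; apply: comG.
have := subsetP nLG' _ Gc; rewrite inE => /andP[_ /forall_inP/(_ _ Hh)].
by rewrite -groupV invg_comm.
Qed.

Lemma expgMn_mod (Q : {group X}) x y k : x \in 'N(Q) -> y \in 'N(Q) -> [~ x, y] \in Q ->
  (x ^+ k * y ^+ k)^-1 * (x * y) ^+ k \in Q.
Proof.
move=> nx ny Qxy; have nX z j : z \in 'N(Q) -> z ^+ j \in 'N(Q) by apply: groupX.
have cxy : commute (coset Q x) (coset Q y).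
  by apply/commgP; rewrite -morphR //= coset_id.
apply: coset_idr; first by rewrite groupM ?groupV ?groupM ?nX ?groupM.
rewrite morphM ?morphV ?groupV ?groupM ?nX ?groupM //= morphX ?groupM // !morphM ?nX //=.
by rewrite !morphX // expgMn // mulVg.
Qed.

(** From a + 1 to pa the series is a constant H, and H = [H, Gam] D_a^p. For l in D_a, [l^p, g] is
    congruent to [l, g]^p modulo R = [H, Gam, Gam] H^p because [l, [l, g]] lies in [H, N], so it
    belongs to R. Hence [H, Gam] is contained in R, and then in H^p. The next term is therefore H^p,
    and it stays so up to index p^2 a, as the recursion keeps adding the p-th powers of H. *)
Lemma dim_gap_pow a : 0 < a -> a.+1 < p * a -> D a.+1 = D (p * a) ->
  D (p * a).+1 = D (p * (p * a)).
Proof.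
move=> a0 ap e; set H := D a.+1; set Q := pow_group H p.
have p1 := prime_gt1 pr_p; have p0 := prime_gt0 pr_p.
have sHN : H \subset N := dim_sub _.
have nHG : Gam \subset 'N(H) := dim_norm _.
have sQH : Q \subset H := pow_group_subset _ _.
have nQG : Gam \subset 'N(Q) by apply: pow_group_norm.
have nQN : N \subset 'N(Q) by apply: inner_norm; rewrite ?(subset_trans sQH).
have DH i : a < i -> i <= p * a -> D i = H.
  by move=> ai ip; apply: eq_group_sub; [exact: dim_le | rewrite /H e dim_le].
have HE : H \subset [~: H, Gam] <*> pow_group (D a) p.
  have h1 : (0 < (p * a).-1)%N by lia.
  have {1}-> : H = D (p * a).-1.+1 by rewrite DH //; lia.
  (* The assumption [a.+1 < p * a] keeps the index pa - 1 inside the constant range. *)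
  rewrite (dim_seriesS h1) [D (p * a).-1]DH; try lia.
  have -> : ((p * a).-1 %/ p)%N = a.-1.
    have -> : ((p * a).-1 = a.-1 * p + p.-1)%N by nia.
    by rewrite divnMDl // divn_small ?addn0 // prednK.
  by rewrite prednK // subxx.
have sHG : [~: H, Gam] \subset H by rewrite commg_subl.
pose R := ([~: H, Gam, Gam] <*> Q)%G.
have sRH : R \subset H.
  rewrite join_subG sQH andbT (subset_trans _ sHG) // commSg //.
have nRG : Gam \subset 'N(R) by rewrite normsY // normsR ?normG // normsR ?normG.
have nRN : N \subset 'N(R) by apply: inner_norm; rewrite ?(subset_trans sRH).
have gS : group_set [set h in H | [forall g in Gam, [~ h, g] \in R]].
  apply/group_setP; split=> [|y z].
    by rewrite inE group1; apply/forall_inP=> z Hz; rewrite comm1g group1.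
  rewrite !inE => /andP[Hy /forall_inP hy] /andP[Hz /forall_inP hz].
  rewrite groupM //; apply/forall_inP=> g Gg; rewrite commMgJ groupM ?hz //.
  by rewrite memJ_norm ?hy // (subsetP nRN) // (subsetP sHN).
have sS : H \subset Group gS.
  apply: subset_trans HE _; rewrite join_subG; apply/andP; split.
    apply/subsetP=> h Hh; rewrite inE (subsetP sHG) //=; apply/forall_inP=> g Gg.
    by rewrite (subsetP (joing_subl _ _)) // mem_commg.
  apply: pow_group_sub => l Dl.
  have Hlp : l ^+ p \in H by rewrite /H e dim_pow.
  rewrite inE Hlp /=; apply/forall_inP=> g Gg.
  have Nl := subsetP (dim_sub _) _ Dl.
  have Hc : [~ l, g] \in H by apply: dim_commg.
  have Nc := subsetP sHN _ Hc.
  have Qc : [~ l, g] ^+ p \in R by rewrite (subsetP (joing_subr _ _)) // mem_pow_group.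
  have clc : [~ l, [~ l, g]] \in R.
    rewrite -groupV invg_comm (subsetP (joing_subl _ _)) //.
    by apply: (subsetP (comm_inner sHN nHG)); apply: mem_commg.
  have := expgMn_mod p (subsetP nRN _ Nl) (subsetP nRN _ Nc) clc.
  rewrite -conjg_mulR invMg -mulgA groupMl ?groupV //.
  by rewrite commgEl conjXg.
have HQ : [~: H, Gam] \subset Q.
  apply: (@sub_of_comm_sub [~: H, Gam]%G) => //; first exact: subset_trans sHN.
  rewrite gen_subG; apply/subsetP=> _ /imset2P[h g Hh Gg ->].
  by have := subsetP sS _ Hh; rewrite inE => /andP[_ /forall_inP]; apply.
have E1 : D (p * a).+1 \subset Q.
  have h1 : (0 < p * a)%N by rewrite muln_gt0 p0.
  rewrite (dim_seriesS h1) mulKn // join_subG; apply/andP; split; last exact: subxx.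
  by rewrite -e.
apply/esym/eq_group_sub; first by rewrite dim_le // ltn_Pmull // muln_gt0 p0.
apply: subset_trans E1 _.
suff: forall i, p * a <= i -> i < p * (p * a) -> Q \subset D i.+1.
  have ppa : 0 < p * (p * a) by rewrite !muln_gt0 p0.
  move/(_ (p * (p * a)).-1); rewrite prednK //; apply=> //.
  by rewrite -ltnS prednK // ltn_Pmull // muln_gt0 p0.
move=> i i1 i2; have i0 : (0 < i)%N by apply: leq_trans i1; rewrite muln_gt0 p0.
rewrite (dim_seriesS i0) (subset_trans _ (joing_subr _ _)) //= DH //.
  by rewrite ltnS leq_divRL // mulnC.
by rewrite ltn_divLR // mulnC.
Qed.

(** Modulo Q = [H, Gam] H^2 squaring is multiplicative on D_3, because [D_3, N] is contained in Q;
    so it can be tested on the generators of D_3 = [D_2, Gam] D_2^2. For y in D_2 the square y^2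
    lies in H, [y, g]^2 is congruent to [y^2, g], and y^4 lies in H^2. Thus D_3^2 is contained in Q,
    and H = [H, Gam] D_3^2. *)
Lemma dim_gap_two : p = 2 -> D 4 = D 6 -> D 4 :=: 1.
Proof.
move=> p2 e; set H := D 4.
have e5 : D 5 = H.
  by apply: eq_group_sub; [exact: dim_le | rewrite /H e dim_le].
have sHN : H \subset N := dim_sub _.
have nHG : Gam \subset 'N(H) := dim_norm _.
apply: frattini_trivial => //; set Q := ([~: H, Gam] <*> pow_group H p)%G.
have sHG : [~: H, Gam] \subset H by rewrite commg_subl.
have sQH : Q \subset H by rewrite join_subG sHG pow_group_subset.
have nQG : Gam \subset 'N(Q) by rewrite normsY ?pow_group_norm // normsR ?normG.
have nQN : N \subset 'N(Q) by apply: inner_norm; rewrite ?(subset_trans sQH).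
have s3 : [~: D 3, N] \subset Q.
  apply: subset_trans (comm_inner (dim_sub _) (dim_norm _)) _.
  by rewrite (subset_trans _ (joing_subl _ _)) // commSg // dim_comm.
have HE : H \subset [~: H, Gam] <*> pow_group (D 3) p.
  by rewrite -{1}e5 (@dim_seriesS 4) // (_ : 4 %/ p = 2)%N ?subxx // p2.
apply: subset_trans HE _; rewrite join_subG joing_subl /=.
have sq x : x ^+ p = x * x by rewrite p2.
apply: pow_group_sub => x.
have gS : group_set [set h in D 3 | h ^+ p \in Q].
  apply/group_setP; split=> [|y z]; first by rewrite inE group1 expg1n group1.
  rewrite !inE => /andP[Dy Qy] /andP[Dz Qz]; rewrite groupM //=.
  have Ny := subsetP (dim_sub _) _ Dy; have Nz := subsetP (dim_sub _) _ Dz.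
  have Qyz : [~ y, z] \in Q by apply: (subsetP s3); apply: mem_commg.
  have := expgMn_mod p (subsetP nQN _ Ny) (subsetP nQN _ Nz) Qyz.
  by rewrite groupMl // groupV groupM.
suff sS : D 3 \subset Group gS by move/(subsetP sS); rewrite inE => /andP[].
have D3E : D 3 \subset [~: D 2, Gam] <*> pow_group (D 2) p.
  by rewrite (@dim_seriesS 2) // (_ : 2 %/ p = 1)%N ?subxx // p2.
apply: subset_trans D3E _; rewrite join_subG.
have D2N := dim_sub 2.
apply/andP; split.
  rewrite gen_subG; apply/subsetP=> _ /imset2P[y g Dy Gg ->]; rewrite inE.
  have D3c : [~ y, g] \in D 3 := dim_commg Dy Gg.
  rewrite D3c /=; have H2 : y ^+ p \in H by have := dim_pow Dy; rewrite (_ : p * 2 = 4)%N // p2.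
  have Q2 : [~ y ^+ p, g] \in Q by rewrite (subsetP (joing_subl _ _)) // mem_commg.
  have Qc : [~ y, g, y] \in Q.
    by apply: (subsetP s3); rewrite mem_commg // (subsetP D2N).
  have nc : [~ y, g] \in 'N(Q) by rewrite (subsetP nQN) // (subsetP (dim_sub 3)).
  by move: Q2; rewrite !sq commMgJ conjg_mulR -mulgA [_ * [~ y, g]]conjgC mulgA groupMr
    // memJ_norm.
apply: pow_group_sub => y Dy; rewrite inE; have H2 : y ^+ p \in H.
  by have := dim_pow Dy; rewrite (_ : p * 2 = 4)%N // p2.
rewrite (subsetP (dim_le _) _ H2) //= (subsetP (joing_subr _ _)) //.
by rewrite mem_pow_group.
Qed.

End DimensionSeries.

(** * From the orders of the series to its weights *)

Lemma sum_initial_segment (b : nat -> bool) m :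
    (forall i j, i <= j -> b j -> b i) ->
  forall j, j < m -> b j = (j < \sum_(i < m) b i).
Proof.
move=> b_anti; elim: m => // m IH j; rewrite big_ord_recr ltnS /= => jm.
have S_le : \sum_(i < m) b i <= m.
  by rewrite -[leqRHS]card_ord -sum1_card leq_sum // => i _; case: (b i).
case bm: (b m).
  have -> : \sum_(i < m) b i = m.
    rewrite (eq_bigr (fun=> 1)) ?sum1_card ?card_ord // => i _.
    by rewrite (b_anti i m) // ltnW.
  by rewrite addn1 ltnS jm (b_anti j m).
rewrite addn0; case: (ltngtP j m) jm => // [/IH //|-> _].
by rewrite bm ltnNge S_le.
Qed.

Lemma sum_lt_ord n e : \sum_(k < n) (k < e) = minn n e.
Proof. by elim: n => [|n IH]; rewrite ?big_ord0 ?big_ord_recr /= ?IH; lia. Qed.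

Section DimensionWeights.
Local Open Scope group_scope.
Variables (X : finGroupType) (N Gam : {group X}) (p : nat).
Hypothesis pr_p : prime p.
Hypothesis pN : p.-group N.
Hypothesis nNG : Gam \subset 'N(N).
Hypothesis innN : forall x, x \in N ->
  exists2 c, c \in [~: Gam, Gam] & {in N, forall y, y ^ x = y ^ c}.
Hypothesis nilN : exists c, iter c (fun H : {group X} => [~: H, Gam]%G) N :=: 1.
Local Notation D := (dim_series N Gam p).
Local Notation n := (logn p #|N|).

Definition dim_log j := logn p #|D j|.
Local Notation e := dim_log.

Local Open Scope nat_scope.

Lemma card_dim j : #|D j| = (p ^ e j)%N.
Proof.
have pD : p.-group (D j) by apply: pgroupS pN; apply: dim_sub.
by rewrite /dim_log -card_pgroup.
Qed.

Lemma dim_log_le i j : i <= j -> e j <= e i.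
Proof. by move=> ij; apply: dvdn_leq_log; rewrite ?cardG_gt0 ?cardSg ?dim_le. Qed.

Lemma dim_log_eq i j : i <= j -> e i = e j -> D i = D j.
Proof.
move=> ij eij; apply/val_inj/eqP; rewrite eq_sym eqEcard !card_dim eij leqnn andbT.
exact: dim_le.
Qed.

Lemma dim_log0 j : D j :=: 1%g -> e j = 0.
Proof. by rewrite /dim_log => ->; rewrite cards1 logn1. Qed.

Lemma dim_log2 : 0 < n -> e 2 < n.
Proof.
move=> n0; rewrite ltn_neqAle (@dim_log_le 1 2) // andbT; apply/eqP => en.
have e12 := @dim_log_eq 1 2 isT (esym en).
have h : (N \subset [~: N, Gam] <*> pow_group N p)%g.
  have : D 1 \subset D 2 by rewrite -e12 subxx.
  by rewrite (@dim_seriesS _ _ _ _ pr_p 1) // divn_small ?prime_gt1.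
have N1 := frattini_trivial pN nNG nilN (subxx N) nNG h.
by move: n0; rewrite N1 cards1 logn1.
Qed.

Lemma dim_log_gap a : 0 < a -> e a.+1 = e (p * a).+1 -> e a.+1 = 0.
Proof.
move=> a0 ee; apply: dim_log0; apply: (dim_gap pr_p pN nNG nilN a0).
by apply: dim_log_eq => //; rewrite ltnS leq_pmull // prime_gt0.
Qed.

(** By [dim_log_gap] the logarithm, while positive, drops at least once between p^k + 1 and p^(k+1)
    + 1; hence it is at most n - k - 1 at p^k + 1. *)
Lemma dim_log_big j : p ^ n < j -> e j = 0.
Proof.
have h k : e (p ^ k).+1 <= n - k.+1.
  elim: k => [|k IH].
    rewrite expn0; case: (posnP n) => [n0|/dim_log2]; last by rewrite subn1; case: n.
    by apply: leq_trans (@dim_log_le 1 2 isT) _; rewrite /dim_log dim_series1 n0.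
  have p0 : 0 < p ^ k by rewrite expn_gt0 prime_gt0.
  have le1 : e (p ^ k.+1).+1 <= e (p ^ k).+1.
    by apply: dim_log_le; rewrite ltnS leq_exp2l ?prime_gt1.
  have [/(dim_log_gap p0) e0|] := eqVneq (e (p ^ k).+1) (e (p * p ^ k).+1).
    by rewrite e0 leqn0 in le1; rewrite (eqP le1).
  by rewrite -expnS => ne; have : e (p ^ k.+1).+1 < e (p ^ k).+1;
    [rewrite ltn_neqAle eq_sym ne | move: IH; clear; lia].
move=> pj; apply/eqP; rewrite -leqn0; apply: leq_trans (dim_log_le pj) _.
by apply: leq_trans (h n) _; rewrite subnS subnn.
Qed.

(* The k-th weight is the last index at which the order is at least p ^ (n - k). *)
Let w k := \sum_(j < (p ^ n).+1) (n - k <= e j.+1).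

(** As the series decreases, the indices counted by [w k] form an initial segment, and by
    [dim_log_big] none lies beyond the range of the sum. *)
Let wP k j : 0 < j -> k < n -> (j <= w k) = (n - k <= e j).
Proof.
case: j => // j _ kn; rewrite /w.
have anti i i' : i <= i' -> n - k <= e i'.+1 -> n - k <= e i.+1.
  by move=> ii' h; apply: leq_trans h _; apply: dim_log_le.
have [jb|jb] := ltnP j (p ^ n).+1.
  by rewrite -(sum_initial_segment (b := fun j => n - k <= e j.+1) anti jb).
rewrite (@dim_log_big j.+1); last by rewrite ltnW.
rewrite leqn0 subn_eq0 [RHS]leqNgt kn; apply/negbTE; rewrite -ltnNge ltnS.
rewrite big_ord_recr /= (@dim_log_big (p ^ n).+1) // leqn0 subn_eq0 [n <= k]leqNgt kn addn0.
apply: leq_trans (ltnW jb); rewrite -[leqRHS]card_ord -[leqRHS]sum1_card.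
by apply: leq_sum => i _; apply: leq_b1.
Qed.

(** Both sides count the pairs (k, j) with n - k <= e_(j+1). *)
Let w_sumE : \sum_(k < n) w k = \sum_(j < (p ^ n).+1) e j.+1.
Proof.
rewrite exchange_big /=; apply: eq_bigr => j _.
rewrite (reindex_inj rev_ord_inj) /=.
under eq_bigr => k _ do rewrite subKn //.
by rewrite sum_lt_ord; apply/minn_idPr; apply: (@dim_log_le 1).
Qed.

Lemma dim_log_sum_cases :
    \sum_(j < (p ^ n).+1) e j.+1 + 15 = \sum_(k < n) p ^ k ->
  [/\ p = 17, n = 2, e 2 = 1 & e 3 = 0] \/
  [/\ p = 2, n = 5 & [/\ e 2 = 3, e 3 = 2, e 4 = 2, e 5 = 1 & e 8 = 1 /\ e 9 = 0] \/
                     [/\ e 2 = 4, e 3 = 3, e 4 = 2, e 5 = 1 & e 6 = 1 /\ e 7 = 0]].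
Proof.
rewrite -w_sumE => sumE.
have w_pos k : k < n -> 0 < w k by move=> kn; rewrite wP // leq_subr.
have eW k : k < n -> n - k <= e (w k) by move=> kn; rewrite -wP // w_pos.
have eWS k : k < n -> e (w k).+1 < n - k by move=> kn; rewrite ltnNge -wP // ltnn.
have p0 := prime_gt0 pr_p.
have w_mono k : k.+1 < n -> w k <= w k.+1.
  move=> kn; rewrite wP //; last exact: w_pos (ltnW kn).
  by apply: leq_trans (eW _ (ltnW kn)); rewrite leq_sub2l.
have w0 : 0 < n -> w 0 = 1.
  move=> n0; apply/eqP; rewrite eqn_leq w_pos // andbT -ltnS ltnNge wP //.
  by rewrite subn0 -ltnNge dim_log2.
have w_le k : k.+1 < n -> w k.+1 <= p * w k.
  move=> kn; rewrite leqNgt; apply/negP => h; have k0 := w_pos _ (ltnW kn).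
  have h1 : n - k.+1 <= e (p * w k).+1 by rewrite -wP.
  have h2 := eWS _ (ltnW kn).
  have h3 : e (p * w k).+1 <= e (w k).+1 by apply: dim_log_le; rewrite ltnS leq_pmull.
  have := dim_log_gap k0; move: h1 h2 h3 kn; clear; lia.
have w_dvd k : k.+1 < n -> (w k).+1 < w k.+1 -> p %| w k.+1.
  move=> kn h; apply/negPn/negP => nd; have k0 := w_pos _ (ltnW kn).
  have w1 : 1 < w k.+1 by apply: leq_ltn_trans h.
  have h1 := eW _ kn; have h2 := eWS _ (ltnW kn); have h4 := eWS _ kn.
  have h3 : e (w k.+1).-1 <= e (w k).+1.
    by apply: dim_log_le; rewrite -ltnS prednK // ltnW.
  have h5 : e (w k.+1) <= e (w k.+1).-1 by apply: dim_log_le; apply: leq_pred.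
  have e1 : D (w k.+1).-1 = D (w k.+1).
    by apply: dim_log_eq; [apply: leq_pred | move: h1 h2 h3 h5 kn; clear; lia].
  move: h4; rewrite /dim_log (dim_mod_dvd pr_p w1 nd e1) -/(dim_log _).
  by rewrite ltnNge h1.
have w_gap a k l : 0 < a -> a.+1 < p * a -> k.+1 < n -> l < n ->
  w k <= a -> p * a <= w k.+1 -> (w l <= p * a) || (p * (p * a) <= w l).
  move=> a0 ap kn ln h1 h2; case: leqP => //= h3.
  have pa0 : 0 < p * a by rewrite muln_gt0 p0.
  have h5 : n - k.+1 <= e (p * a) by rewrite -wP.
  have h6 : e a.+1 < n - k.
    by apply: leq_ltn_trans (eWS _ (ltnW kn)); apply: dim_log_le.
  have h7 : e (p * a) <= e a.+1 by apply: dim_log_le; apply: ltnW.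
  have e1 : D a.+1 = D (p * a).
    by apply: dim_log_eq; [apply: ltnW | move: h5 h6 h7 kn; clear; lia].
  have e2 := dim_gap_pow pr_p pN nNG innN nilN a0 ap e1.
  rewrite wP // ?muln_gt0 ?p0 //.
  by rewrite /dim_log -e2 -/(dim_log _) -wP.
have w_2 : p = 2 -> forall k, k.+1 < n -> w k <= 3 -> w k.+1 < 6.
  move=> p2 k kn h; rewrite ltnNge wP //; apply/negP => h6.
  have h4 : e 4 < n - k by apply: leq_ltn_trans (eWS _ (ltnW kn)); apply: dim_log_le.
  have h5 : e 6 <= e 4 by apply: dim_log_le.
  have e1 : D 4 = D 6 by apply: dim_log_eq; move: h4 h5 h6 kn; clear; lia.
  have := dim_log0 (dim_gap_two pr_p pN nNG innN nilN p2 e1); move: h4 h5 h6 kn; clear; lia.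
have ev j k : k < n -> w k = j -> n - k <= e j /\ e j.+1 < n - k.
  by move=> kn <-; rewrite eW // eWS.
have [podd|] := boolP (odd p).
  have [p17 [n2 w1]] := weights_odd _ _ _ pr_p w0 w_mono w_le w_dvd w_gap w_2 sumE podd.
  left; have n1 : 1 < n by rewrite n2.
  have := ev _ _ n1 w1; have := ev _ _ (ltnW n1) (w0 (ltnW n1)).
  by rewrite n2 => -[_ h1] [h2 h3]; split=> //; move: h1 h2 h3; clear; lia.
move=> peven; have p2 : p = 2 by apply/eqP;
  move: (prime_oddPn pr_p) peven => /rwP[_ +] => /[apply] ->.
have [n5 ww] := weights_two _ _ _ pr_p w0 w_mono w_le w_dvd w_gap w_2 sumE p2.
right; split=> //; move: ev dim_log2; rewrite n5 => ev /(_ isT) e2n.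
have e34 := @dim_log_le 3 4 isT; have e58 := @dim_log_le 5 8 isT.
have e56 := @dim_log_le 5 6 isT.
case: ww => ww; [left|right].
  have := ev _ 1 isT (ww 1 isT); have := ev _ 2 isT (ww 2 isT).
  have := ev _ 3 isT (ww 3 isT); have := ev _ 4 isT (ww 4 isT).
  by rewrite /=; move: e34 e58; clear; split; lia.
have := ev _ 1 isT (ww 1 isT); have := ev _ 2 isT (ww 2 isT).
have := ev _ 3 isT (ww 3 isT); have := ev _ 4 isT (ww 4 isT).
by rewrite /=; move: e56 e2n; clear; split; lia.
Qed.

End DimensionWeights.

Local Open Scope group_scope.

(** * Groups of order 32 given by generators and relations *)

Section Presentations.

(** Every element of the join can be written x c^i with x in [A] and i < k. *)
Lemma card_extend (gT : finGroupType) (A : {group gT}) (c : gT) k m :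
    0 < k -> c \in 'N(A) -> c ^+ k \in A -> #|A| <= m ->
  #|A <*> <[c]>| <= m * k.
Proof.
move=> k0 nAc Ack mA.
pose S := [set d.1 * c ^+ (d.2 : 'I_k) | d in setX A [set: 'I_k]].
have sS : A <*> <[c]> \subset S.
  rewrite norm_joinEr ?cycle_subG //; apply/subsetP=> _ /mulsgP[x _ Ax /cycleP[i ->] ->].
  apply/imsetP; exists (x * (c ^+ k) ^+ (i %/ k), Ordinal (ltn_pmod i k0)).
    by rewrite !inE andbT groupM // groupX.
  by rewrite /= -mulgA -expgM -expgD mulnC -divn_eq.
apply: leq_trans (subset_leq_card sS) _; apply: leq_trans (leq_imset_card _ _) _.
by rewrite cardsX cardsT card_ord leq_mul2r mA orbT.
Qed.

Lemma card_cycle_le (gT : finGroupType) (a : gT) k : 0 < k -> a ^+ k = 1 -> #|<[a]>| <= k.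
Proof. by move=> k0 ak; apply: dvdn_leq => //; rewrite order_dvdn ak. Qed.

Lemma card_extend_cycle (gT : finGroupType) (a c : gT) m k :
    0 < m -> 0 < k -> a ^+ m = 1 -> c \in 'N(<[a]>) -> c ^+ k \in <[a]> ->
  #|<[a]> <*> <[c]>| <= m * k.
Proof. by move=> m0 k0 am nac ack; apply: card_extend => //; apply: card_cycle_le. Qed.

Lemma norm_joing_cycles (gT : finGroupType) (a b c : gT) :
  a ^ c \in <[a]> <*> <[b]> -> b ^ c \in <[a]> <*> <[b]> -> c \in 'N(<[a]> <*> <[b]>).
Proof. by move=> ha hb; rewrite inE conjYg -!cycleJ join_subG !cycle_subG ha. Qed.

Lemma mem_joing1 (gT : finGroupType) (a b : gT) i : a ^+ i \in <[a]> <*> <[b]>.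
Proof. by rewrite (subsetP (joing_subl _ _)) ?mem_cycle. Qed.

Lemma mem_joing2 (gT : finGroupType) (a b : gT) i : b ^+ i \in <[a]> <*> <[b]>.
Proof. by rewrite (subsetP (joing_subr _ _)) ?mem_cycle. Qed.

Lemma card_extend_cycles (gT : finGroupType) (a b c : gT) l m k :
    0 < l -> 0 < m -> 0 < k -> a ^+ l = 1 -> b \in 'N(<[a]>) -> b ^+ m \in <[a]> ->
    a ^ c \in <[a]> <*> <[b]> -> b ^ c \in <[a]> <*> <[b]> ->
    c ^+ k \in <[a]> <*> <[b]> ->
  #|<[a]> <*> <[b]> <*> <[c]>| <= l * m * k.
Proof.
move=> l0 m0 k0 al nab abm ac bc ck; apply: card_extend => //.
  exact: norm_joing_cycles.
exact: card_extend_cycle.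
Qed.

(* A common cover inside the direct product: a group satisfying the relations is
   a quotient of another one as soon as the relations bound the order. *)
Lemma homg_of_cover (gT rT : finGroupType) (P : {group gT * rT}) :
  #|P| <= #|fst @* P| -> snd @* P \homg fst @* P.
Proof.
move=> cP; have i1 : 'injm (restrm (subsetT P) (@fst gT rT)).
  apply/injmP/imset_injP; rewrite -morphimEdom morphim_restrm setIid.
  by rewrite eqn_leq cP andbT leq_morphim.
have iP : P \isog fst @* P.
  by apply/isogP; exists (restrm_morphism (subsetT P) (fst_morphism gT rT));
    rewrite ?morphim_restrm ?setIid.
have hP : snd @* P \homg P.
  by apply/homgP; exists (restrm_morphism (subsetT P) (snd_morphism gT rT));
    rewrite morphim_restrm setIid.
by apply: homg_trans hP _; apply: isog_hom.
Qed.

Lemma homg_cover2 (gT rT : finGroupType) (a b : gT) (a' b' : rT) :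
  #|<[(a, a')]> <*> <[(b, b')]>| <= #|<[a]> <*> <[b]>| ->
  <[a']> <*> <[b']> \homg <[a]> <*> <[b]>.
Proof.
have := @homg_of_cover _ _ (<[(a, a')]> <*> <[(b, b')]>).
by rewrite !morphimY ?subsetT // !morphim_cycle ?inE.
Qed.

Lemma homg_cover3 (gT rT : finGroupType) (a b c : gT) (a' b' c' : rT) :
  #|<[(a, a')]> <*> <[(b, b')]> <*> <[(c, c')]>| <= #|<[a]> <*> <[b]> <*> <[c]>| ->
  <[a']> <*> <[b']> <*> <[c']> \homg <[a]> <*> <[b]> <*> <[c]>.
Proof.
have := @homg_of_cover _ _ (<[(a, a')]> <*> <[(b, b')]> <*> <[(c, c')]>).
by rewrite !morphimY ?subsetT // !morphim_cycle ?inE.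
Qed.

Lemma commg1_conj (gT : finGroupType) (a c : gT) : [~ a, c] = 1 -> a ^ c = a.
Proof. by move=> h; apply/conjg_fixP/eqP. Qed.

Lemma norm_cycle_mem (gT : finGroupType) (a c : gT) : a ^ c \in <[a]> -> c \in 'N(<[a]>).
Proof. by move=> ac; rewrite inE -cycleJ cycle_subG. Qed.

Section TwoGenerators.
Variables (gT : finGroupType) (a b : gT).

Lemma S32_4_le : a ^+ 8 = 1 -> b ^+ 4 = 1 -> a ^ b = a ^+ 5 -> #|<[a]> <*> <[b]>| <= 32.
Proof.
move=> a8 b4 ab; apply: (@card_extend_cycle _ _ _ 8 4) => //; last by rewrite b4.
by rewrite norm_cycle_mem // ab mem_cycle.
Qed.

Lemma S32_12_le : a ^+ 4 = 1 -> b ^+ 8 = 1 -> a ^ b = a^-1 -> #|<[a]> <*> <[b]>| <= 32.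
Proof.
move=> a4 b8 ab; apply: (@card_extend_cycle _ _ _ 4 8) => //; last by rewrite b8.
by rewrite norm_cycle_mem // ab groupV cycle_id.
Qed.

Lemma S32_17_le : a ^+ 16 = 1 -> b ^+ 2 = 1 -> a ^ b = a ^+ 9 -> #|<[a]> <*> <[b]>| <= 32.
Proof.
move=> a16 b2 ab; apply: (@card_extend_cycle _ _ _ 16 2) => //; last by rewrite b2.
by rewrite norm_cycle_mem // ab mem_cycle.
Qed.

End TwoGenerators.

Section ThreeGenerators.
Variables (gT : finGroupType) (a b c : gT).

Lemma S32_32_le : a ^+ 4 = 1 -> b ^+ 4 = 1 -> [~ a, b] = 1 -> c ^+ 2 = a ^+ 2 ->
  a ^ c = a * b ^+ 2 -> b ^ c = a ^+ 2 * b -> #|<[a]> <*> <[b]> <*> <[c]>| <= 32.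
Proof.
move=> a4 b4 ab c2 ac bc; have := mem_joing1 a b 1; have := mem_joing2 a b 1.
rewrite !expg1 => mb ma; apply: (@card_extend_cycles _ a b c 4 4 2);
  rewrite ?ac ?bc ?c2 ?b4 ?groupM ?groupX //.
by rewrite norm_cycle_mem // (commg1_conj ab) cycle_id.
Qed.

Lemma S32_inv_le : a ^+ 4 = 1 -> b ^+ 4 = 1 -> [~ a, b] = 1 -> c ^+ 2 \in <[b]> ->
  a ^ c = a^-1 -> b ^ c = b^-1 -> #|<[a]> <*> <[b]> <*> <[c]>| <= 32.
Proof.
move=> a4 b4 ab c2 ac bc; have := mem_joing1 a b 1; have := mem_joing2 a b 1.
rewrite !expg1 => mb ma; apply: (@card_extend_cycles _ a b c 4 4 2);
  rewrite ?ac ?bc ?b4 ?groupV //.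
  by rewrite norm_cycle_mem // (commg1_conj ab) cycle_id.
by apply: subsetP c2; apply: joing_subr.
Qed.

End ThreeGenerators.

(** For any other solution (a', b') the pairs (a, a') and (b, b') satisfy the same relations, so
    [S32_4_le] bounds the order of the cover by 32, the order of [H]. The three lemmas that follow
    have the same form. *)
Lemma S32_4_isoGrp (gT : finGroupType) (H : {group gT}) (a b : gT) :
    <[a]> <*> <[b]> = H -> #|H| = 32 ->
    a ^+ 8 = 1 -> b ^+ 4 = 1 -> a ^ b = a ^+ 5 ->
  H \isog Grp (a : b : (a ^+ 8, b ^+ 4, a ^ b = a ^+ 5)).
Proof.
move=> HE cH a8 b4 ab; apply: intro_isoGrp => [|rT L].
  by apply/existsP; exists (a, b); rewrite /= !xpair_eqE HE a8 b4 ab !eqxx.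
case/existsP=> -[a' b'] /=; rewrite !xpair_eqE /=.
case/and4P=> /eqP<- /eqP a8' /eqP b4' /eqP ab'; rewrite -HE; apply: homg_cover2.
rewrite HE cH; apply: S32_4_le.
- exact: (congr2 pair a8 a8').
- exact: (congr2 pair b4 b4').
exact: (congr2 pair ab ab').
Qed.

Lemma S32_32_isoGrp (gT : finGroupType) (H : {group gT}) (a b c : gT) :
    <[a]> <*> <[b]> <*> <[c]> = H -> #|H| = 32 ->
    a ^+ 4 = 1 -> b ^+ 4 = 1 -> [~ a, b] = 1 -> c ^+ 2 = a ^+ 2 ->
    a ^ c = a * b ^+ 2 -> b ^ c = a ^+ 2 * b ->
  H \isog Grp (a : b : c : (a ^+ 4, b ^+ 4, [~ a, b], c ^+ 2 = a ^+ 2,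
    a ^ c = a * b ^+ 2, b ^ c = a ^+ 2 * b)).
Proof.
move=> HE cH a4 b4 ab c2 ac bc; apply: intro_isoGrp => [|rT L].
  by apply/existsP; exists (a, b, c); rewrite /= !xpair_eqE HE a4 b4 ab c2 ac bc !eqxx.
case/existsP=> -[[a' b'] c'] /=; rewrite !xpair_eqE /=.
case/and5P=> /eqP<- /eqP a4' /eqP b4' /eqP ab' /and3P[/eqP c2' /eqP ac' /eqP bc'].
rewrite -HE; apply: homg_cover3; rewrite HE cH; apply: S32_32_le.
- exact: (congr2 pair a4 a4').
- exact: (congr2 pair b4 b4').
- exact: (congr2 pair ab ab').
- exact: (congr2 pair c2 c2').
- exact: (congr2 pair ac ac').
exact: (congr2 pair bc bc').
Qed.

Lemma S32_34_isoGrp (gT : finGroupType) (H : {group gT}) (a b c : gT) :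
    <[a]> <*> <[b]> <*> <[c]> = H -> #|H| = 32 ->
    a ^+ 4 = 1 -> b ^+ 4 = 1 -> [~ a, b] = 1 -> c ^+ 2 = 1 ->
    a ^ c = a^-1 -> b ^ c = b^-1 ->
  H \isog Grp (a : b : c : (a ^+ 4, b ^+ 4, [~ a, b], c ^+ 2, a ^ c = a^-1, b ^ c = b^-1)).
Proof.
move=> HE cH a4 b4 ab c2 ac bc; apply: intro_isoGrp => [|rT L].
  by apply/existsP; exists (a, b, c); rewrite /= !xpair_eqE HE a4 b4 ab c2 ac bc !eqxx.
case/existsP=> -[[a' b'] c'] /=; rewrite !xpair_eqE /=.
case/and5P=> /eqP<- /eqP a4' /eqP b4' /eqP ab' /and3P[/eqP c2' /eqP ac' /eqP bc'].
rewrite -HE; apply: homg_cover3; rewrite HE cH; apply: S32_inv_le.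
- exact: (congr2 pair a4 a4').
- exact: (congr2 pair b4 b4').
- exact: (congr2 pair ab ab').
- by rewrite (congr2 pair c2 c2' : (c, c') ^+ 2 = 1) group1.
- exact: (congr2 pair ac ac').
exact: (congr2 pair bc bc').
Qed.

Lemma S32_35_isoGrp (gT : finGroupType) (H : {group gT}) (a b c : gT) :
    <[a]> <*> <[b]> <*> <[c]> = H -> #|H| = 32 ->
    a ^+ 4 = 1 -> b ^+ 4 = 1 -> [~ a, b] = 1 -> c ^+ 2 = b ^+ 2 ->
    a ^ c = a^-1 -> b ^ c = b^-1 ->
  H \isog Grp (a : b : c : (a ^+ 4, b ^+ 4, [~ a, b], c ^+ 2 = b ^+ 2,
    a ^ c = a^-1, b ^ c = b^-1)).
Proof.
move=> HE cH a4 b4 ab c2 ac bc; apply: intro_isoGrp => [|rT L].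
  by apply/existsP; exists (a, b, c); rewrite /= !xpair_eqE HE a4 b4 ab c2 ac bc !eqxx.
case/existsP=> -[[a' b'] c'] /=; rewrite !xpair_eqE /=.
case/and5P=> /eqP<- /eqP a4' /eqP b4' /eqP ab' /and3P[/eqP c2' /eqP ac' /eqP bc'].
rewrite -HE; apply: homg_cover3; rewrite HE cH; apply: S32_inv_le.
- exact: (congr2 pair a4 a4').
- exact: (congr2 pair b4 b4').
- exact: (congr2 pair ab ab').
- by rewrite (congr2 pair c2 c2' : (c, c') ^+ 2 = (b, b') ^+ 2) mem_cycle.
- exact: (congr2 pair ac ac').
exact: (congr2 pair bc bc').
Qed.

(** The relations let each generator normalise the group generated by the previous ones, and a power
    of it falls into that group; [card_extend] then bounds the order. *)
Lemma small_group_32_le m (T : finGroupType) :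
    m \in [:: 4; 5; 12; 17; 24; 25; 26; 31; 32; 33; 34; 35; 37; 38] ->
  is_small_group_32 m T -> #|T| <= 32.
Proof.
have two (gT : finGroupType) (a b : gT) : (a \in <[a]> <*> <[b]>) * (b \in <[a]> <*> <[b]>).
  by split; rewrite -[X in X \in _]expg1 ?mem_joing1 ?mem_joing2.
have com (gT : finGroupType) (a b : gT) : [~ a, b] = 1 -> b \in 'N(<[a]>).
  by move=> /commg1_conj ab; rewrite norm_cycle_mem // ab cycle_id.
rewrite -cardsT !inE; do 13?[case/orP=> [/eqP->|]]; last move/eqP->.
all: move/isoGrp_hom/existsP.
- by case=> -[a b]; rewrite /= !xpair_eqE /= => /and4P[/eqP<- /eqP h1 /eqP h2 /eqP h3];
    apply: S32_4_le.
- case=> -[[a b] c]; rewrite /= !xpair_eqE /=.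
  case/and5P=> /eqP<- /eqP a2 /eqP b2 /eqP c8 /and3P[/eqP ab /eqP bc /eqP ac].
  by apply: (@card_extend_cycles _ a b c 2 2 8);
    rewrite ?com ?ac ?(commg1_conj bc) ?c8 ?b2 ?groupM ?two.
- by case=> -[a b]; rewrite /= !xpair_eqE /= => /and4P[/eqP<- /eqP h1 /eqP h2 /eqP h3];
    apply: S32_12_le.
- by case=> -[a b]; rewrite /= !xpair_eqE /= => /and4P[/eqP<- /eqP h1 /eqP h2 /eqP h3];
    apply: S32_17_le.
- case=> -[[a b] c]; rewrite /= !xpair_eqE /=.
  case/and5P=> /eqP<- /eqP a4 /eqP b4 /eqP c2 /and3P[/eqP ab /eqP bc /eqP ac].
  by apply: (@card_extend_cycles _ a b c 4 4 2);
    rewrite ?com ?ac ?(commg1_conj bc) ?c2 ?b4 ?groupM ?groupX ?two.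
- case=> -[[a b] c]; rewrite /= !xpair_eqE /=.
  case/and5P=> /eqP<- /eqP a4 /eqP ab /eqP ac /and3P[/eqP b4 /eqP c2 /eqP bc].
  by apply: (@card_extend_cycles _ a b c 4 4 2);
    rewrite ?com ?bc ?(commg1_conj ac) ?c2 ?b4 ?groupV ?two.
- case=> -[[a b] c]; rewrite /= !xpair_eqE /=.
  case/and5P=> /eqP<- /eqP a4 /eqP ab /eqP ac /and3P[/eqP b4 /eqP c2 /eqP bc].
  by apply: (@card_extend_cycles _ a b c 4 4 2);
    rewrite ?com ?bc ?(commg1_conj ac) ?c2 ?b4 ?groupV ?groupX ?two.
all: case=> -[[a b] c]; rewrite /= !xpair_eqE /=.
all: try by case/and5P=> /eqP<- /eqP a4 /eqP b4 /eqP ab /and3P[/eqP c2 /eqP ac /eqP bc];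
  apply: (@card_extend_cycles _ a b c 4 4 2);
    rewrite ?com ?ac ?bc ?c2 ?b4 ?groupM ?groupV ?groupX ?two.
- case/and5P=> /eqP<- /eqP a8 /eqP b2 /eqP ab /and3P[/eqP c2 /eqP ac /eqP bc].
apply: (@card_extend_cycles _ a b c 8 2 2);
  rewrite ?(commg1_conj ac) ?(commg1_conj bc) ?c2 ?b2 ?two //.
  by rewrite norm_cycle_mem // ab mem_cycle.
case/and5P=> /eqP<- /eqP a8 /eqP ab /eqP ac /and3P[/eqP b2 /eqP c2 /eqP bc].
by apply: (@card_extend_cycles _ a b c 8 2 2);
  rewrite ?com ?bc ?(commg1_conj ac) ?c2 ?b2 ?groupV ?two ?mem_cycle.
Qed.

(* Monomial permutations of two copies of Z/n satisfy the presentations of the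
   groups 17, 37 and 38 without commuting. *)
Section Monomial.
Variable n : nat.
Implicit Types (f g : bool -> 'Z_n) (u v : bool).

Lemma mono_inj f u : injective (fun x : bool * 'Z_n => (x.1 (+) u, x.2 + f x.1)%R).
Proof. move=> [s i] [t j] e; have /= /addIb st := congr1 fst e.
by have /= := congr1 snd e; rewrite st => /GRing.addIr->. Qed.

Definition mono f u : {perm bool * 'Z_n} := perm (@mono_inj f u).

Lemma eq_mono f g u : f =1 g -> mono f u = mono g u.
Proof. by move=> fg; apply/permP=> -[s i]; rewrite !permE fg. Qed.

Lemma monoM f g u v :
  mono f u * mono g v = mono (fun s => f s + g (s (+) u))%R (u (+) v).
Proof. by apply/permP=> -[s i]; rewrite permM !permE /= addbA GRing.addrA. Qed.

Lemma mono1 : 1 = mono (fun=> 0%R) false.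
Proof. by apply/permP=> -[s i]; rewrite perm1 permE /= addbF GRing.addr0. Qed.

Lemma monoX f k : mono f false ^+ k = mono (fun s => f s *+ k)%R false.
Proof.
elim: k => [|k IH]; first by rewrite expg0 mono1; apply: eq_mono => s; rewrite GRing.mulr0n.
by rewrite expgS IH monoM; apply: eq_mono => s; rewrite addbF GRing.mulrS.
Qed.

Lemma mono_inj_fun f g u v : mono f u = mono g v -> f =1 g.
Proof. by move=> e s; have := congr1 (fun x : {perm _} => (x (s, 0%R)).2) e;
  rewrite !permE !GRing.add0r. Qed.

End Monomial.

Lemma conjg_eq (gT : finGroupType) (a b c : gT) : a * b = b * c -> a ^ b = c.
Proof. by move=> h; rewrite conjgE h mulKg. Qed.

Lemma not_abelian_homg (gT : finGroupType) (T : finGroupType) (H : {group gT}) (a b : gT) :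
  H \homg [set: T] -> a \in H -> b \in H -> a * b <> b * a -> ~~ abelian [set: T].
Proof.
move=> /homgP[f fT] Ha Hb ab; apply/negP => abT; apply: ab.
have /centsP/(_ a Ha b Hb) // : abelian H by rewrite -fT morphim_abelian.
Qed.

(** For 17 and 37 the generator a acts on the two copies by the shifts 1 and 9 modulo 16,
    respectively 1 and 5 modulo 8. Its 9th, respectively 5th, power exchanges the two shifts, as 81
    = 1 modulo 16 and 25 = 1 modulo 8, and so does conjugation by the swap b. For 38, a shifts both
    copies by 1, b shifts them by 2 and -2, and c is the swap. *)
Lemma small_group_32_nonabelian m (T : finGroupType) :
  m \in [:: 17; 37; 38] -> is_small_group_32 m T -> ~~ abelian [set: T].
Proof.
rewrite !inE => /or3P[]/eqP-> isoT.
- pose a := mono (fun s => if s then 9%:R else 1 : 'Z_16)%R false.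
  pose b := mono (fun=> 0 : 'Z_16)%R true.
  have ab : a * b = b * a ^+ 9.
    by rewrite monoX !monoM; apply: eq_mono => -[]; apply/val_inj.
  have hH : <[a]> <*> <[b]> \homg [set: T].
    rewrite isoT; apply/existsP; exists (a, b); rewrite /= !xpair_eqE eqxx /=.
    rewrite (conjg_eq ab) eqxx andbT; apply/andP; split; apply/eqP.
      by rewrite monoX mono1; apply: eq_mono => -[]; apply/val_inj.
    by rewrite expgS expg1 monoM mono1; apply: eq_mono => s; rewrite GRing.addr0.
  apply: (not_abelian_homg hH (a := a) (b := b)).
  + by rewrite -[X in X \in _]expg1 mem_joing1.
  + by rewrite -[X in X \in _]expg1 mem_joing2.
  by rewrite ab => /mulgI; rewrite monoX => /mono_inj_fun/(_ false)/(congr1 val).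
- pose a := mono (fun s => if s then 5%:R else 1 : 'Z_8)%R false.
  pose b := mono (fun=> 0 : 'Z_8)%R true.
  have ab : a * b = b * a ^+ 5.
    by rewrite monoX !monoM; apply: eq_mono => -[]; apply/val_inj.
  (* The central factor generated by c is sent to 1; a nonabelian quotient suffices. *)
  have hH : <[a]> <*> <[b]> <*> <[1]> \homg [set: T].
    rewrite isoT; apply/existsP; exists (a, b, 1); rewrite /= !xpair_eqE eqxx /=.
    rewrite (conjg_eq ab) !commg1 expg1n !eqxx !andbT; apply/andP; split; apply/eqP.
      by rewrite monoX mono1; apply: eq_mono => -[]; apply/val_inj.
    by rewrite expgS expg1 monoM mono1; apply: eq_mono => s; rewrite GRing.addr0.
  apply: (not_abelian_homg hH (a := a) (b := b)).
  + by rewrite (subsetP (joing_subl _ _)) // -[X in X \in _]expg1 mem_joing1.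
  + by rewrite (subsetP (joing_subl _ _)) // -[X in X \in _]expg1 mem_joing2.
  by rewrite ab => /mulgI; rewrite monoX => /mono_inj_fun/(_ false)/(congr1 val).
pose a := mono (fun=> 1 : 'Z_8)%R false.
pose b := mono (fun s => if s then 2%:R else - 2%:R : 'Z_8)%R false.
pose c := mono (fun=> 0 : 'Z_8)%R true.
have bb : b * mono (fun s => if s then - 2%:R else 2%:R : 'Z_8)%R false = 1.
  by rewrite monoM mono1; apply: eq_mono => -[]; apply/val_inj.
have bc : b ^ c = b^-1.
  by apply: conjg_eq; rewrite (mulg1_eq bb) !monoM; apply: eq_mono => -[]; apply/val_inj.
have cab : [~ a, b] = 1.
  by apply/eqP/commgP; rewrite /commute !monoM; apply: eq_mono => -[]; apply/val_inj.
have cac : [~ a, c] = 1.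
  by apply/eqP/commgP; rewrite /commute !monoM; apply: eq_mono => -[]; apply/val_inj.
have hH : <[a]> <*> <[b]> <*> <[c]> \homg [set: T].
  rewrite isoT; apply/existsP; exists (a, b, c); rewrite /= !xpair_eqE eqxx /=.
  rewrite bc cab cac !eqxx !andbT /=; apply/and3P; split; apply/eqP.
  - by rewrite monoX mono1; apply: eq_mono => -[]; apply/val_inj.
  - by rewrite !monoX; apply: eq_mono => -[]; apply/val_inj.
  by rewrite expgS expg1 monoM mono1; apply: eq_mono => s; rewrite GRing.addr0.
apply: (not_abelian_homg hH (a := b) (b := c)).
- by rewrite (subsetP (joing_subl _ _)) // -[X in X \in _]expg1 mem_joing2.
- by rewrite (subsetP (joing_subr _ _)) // cycle_id.
by rewrite !monoM => /mono_inj_fun/(_ false)/(congr1 val).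
Qed.

End Presentations.

(** * Recognising cyclic groups and their products *)

Lemma order_two_power (X : finGroupType) (x : X) k :
  x ^+ (2 ^ k.+1) = 1 -> x ^+ (2 ^ k) != 1 -> #[x] = (2 ^ k.+1)%N.
Proof.
move=> /eqP xk xk1; have d : #[x] %| 2 ^ k.+1 by rewrite order_dvdn.
have [m mk om] := elimT (dvdn_pfactor _ _ (isT : prime 2)) d.
move: xk1; rewrite -order_dvdn om dvdn_Pexp2l // -ltnNge => km; congr (2 ^ _)%N.
by apply/eqP; rewrite eqn_leq mk.
Qed.

Lemma cycle_isog_Zp (X : finGroupType) (x : X) k : #[x] = k.+2 -> <[x]> \isog [set: 'Z_k.+2].
Proof.
move=> ox; rewrite isog_cyclic_card ?cycle_cyclic //= cardsT card_ord -orderE ox eqxx andbT.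
by apply/cyclicP; exists (zmodp.Zp1 : 'Z_k.+2); apply: zmodp.Zp_cycle.
Qed.

Lemma isog_prod (X S T : finGroupType) (A B H : {group X}) : A \x B = H ->
  A \isog [set: S] -> B \isog [set: T] -> H \isog [set: S * T].
Proof.
move=> dH iA iB; have dT := setX_dprod [set: S] [set: T].
have eT : setX [set: S] [set: T] = [set: S * T] by apply/setP=> -[a b]; rewrite !inE.
rewrite /= eT in dT; apply: (isog_dprod dH dT).
- by rewrite (isog_trans iA) // isog_setX1.
- by rewrite (isog_trans iB) // isog_set1X.
Qed.

Lemma dprod_involution (X : finGroupType) (H : {group X}) v :
  v \in 'C(H) -> v \notin H -> v ^+ 2 = 1 ->
  [/\ H \x <[v]> = H <*> <[v]>, #[v] = 2 & #|H <*> <[v]>| = (2 * #|H|)%N].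
Proof.
move=> Cv Hv v2; have v1 : v != 1 by apply: contraNneq Hv => ->.
have ov : #[v] = 2 by apply: nt_prime_order.
have dH : H \x <[v]> = H <*> <[v]>.
  rewrite dprodEY ?cycle_subG //; apply/trivgP/subsetP=> x /setIP[Hx].
  by rewrite /= cycle2g // !inE => /orP[//|/eqP xv]; rewrite xv (negbTE Hv) in Hx.
by split=> //; rewrite -(dprod_card dH) mulnC -orderE ov.
Qed.

Lemma dim_log_sum_trunc (X : finGroupType) (N Gam : {group X}) p k m :
    prime p -> Gam \subset 'N(N) -> k <= m -> dim_series N Gam p k.+1 :=: 1 ->
  \sum_(j < m) dim_log N Gam p j.+1 = \sum_(j < k) dim_log N Gam p j.+1.
Proof.
move=> pr_p nNG km D1; rewrite -!(big_mkord xpredT (fun j => dim_log N Gam p j.+1)).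
have e0 : \sum_(k <= j < m) dim_log N Gam p j.+1 = 0.
  rewrite big_nat_cond big1 // => j; rewrite andbT => /andP[kj _].
  by apply/dim_log0/trivgP; rewrite -D1; apply: dim_le.
by rewrite (big_cat_nat (leq0n k) km) /= e0 addn0.
Qed.

(** * The orders 32, 8, 4, 4, 2, 2, 2, 2: a cyclic second term *)

Section CyclicSecond.
Variables (X : finGroupType) (N Gam : {group X}).
Hypothesis pN : 2.-group N.
Hypothesis nNG : Gam \subset 'N(N).
Hypothesis innN : forall x, x \in N ->
  exists2 c, c \in [~: Gam, Gam] & {in N, forall y, y ^ x = y ^ c}.
Hypothesis nilN : exists c, iter c (fun H : {group X} => [~: H, Gam]%G) N :=: 1.
Local Notation D := (dim_series N Gam 2).
Local Notation L := (rel_lower N Gam).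
Let pr2 : prime 2 := isT.
Let sDN := dim_sub pr2 nNG.
Let DS m : 0 < m -> D m.+1 = ([~: D m, Gam] <*> pow_group (D (m %/ 2).+1) 2)%G.
Proof. exact: dim_seriesS. Qed.

(** If gh and hg move [y] to the same element for all g, h, then [Gam, Gam] fixes [y], and [N] acts
    on it through [Gam, Gam]. *)
Lemma cent_of_comm_action y : y \in N ->
  {in Gam &, forall g h, y ^ (g * h) = y ^ (h * g)} -> N \subset 'C[y].
Proof.
move=> Ny yc; have sGC : [~: Gam, Gam] \subset 'C[y].
  rewrite gen_subG; apply/subsetP=> _ /imset2P[g h Gg Gh ->].
  apply/cent1P; apply/esym/commgP/conjg_fixP.
  have -> : [~ g, h] = (g^-1 * h^-1) * (h^-1 * g^-1)^-1.
    by rewrite invMg !invgK commgEl conjgE !mulgA.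
  by rewrite conjgM yc ?groupV // conjgK.
apply/subsetP=> x Nx; have [c Gc cE] := innN Nx.
apply/cent1P; apply/esym/commgP/conjg_fixP; rewrite cE //.
by have /cent1P/esym/commgP/conjg_fixP := subsetP sGC _ Gc.
Qed.

(** Automorphisms of a cyclic group commute. *)
Lemma cent_of_norm_cycle y : y \in N -> Gam \subset 'N(<[y]>) -> N \subset 'C[y].
Proof.
move=> Ny nyG; apply: cent_of_comm_action => // g h Gg Gh.
have yJ k : k \in Gam -> exists i, y ^ k = y ^+ i.
  by move=> Gk; apply/cycleP; rewrite memJ_norm ?cycle_id // (subsetP nyG).
have [i yi] := yJ g Gg; have [j yj] := yJ h Gh.
by rewrite !conjgM yi yj !conjXg yi yj -!expgM mulnC.
Qed.

(** A cyclic group has at most one element of order 2. *)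
Lemma involution_fixed (c t g : X) :
  t \in <[c]> -> t ^+ 2 = 1 -> g \in 'N(<[c]>) -> t ^ g = t.
Proof.
move=> ct t2 ng; have [->|t1] := eqVneq t 1; first by rewrite conj1g.
have o2 : #[t] = 2 by apply: nt_prime_order.
have : t ^ g \in <[t]>.
  have ctg : t ^ g \in <[c]> by rewrite memJ_norm.
  have := cardSg_cyclic (cycle_cyclic c) (H := <[t ^ g]>%G) (K := <[t]>%G).
  by rewrite /= !cycle_subG ct ctg -!orderE orderJ dvdnn => /(_ isT isT)/esym.
rewrite cycle2g // !inE => /orP[|/eqP //].
by rewrite conjg_eq1 (negbTE t1).
Qed.

Lemma cycle_expg_odd (c : X) i : c \in N -> odd i -> <[c ^+ i]> = <[c]>.
Proof.
move=> Nc oi; apply/eqP; rewrite eq_sym; have := generator_coprime c i.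
rewrite /generator => ->; apply: (@pnat_coprime 2); first exact: mem_p_elt pN Nc.
by rewrite p'natE // ?dvdn2 ?oi //; case: i oi.
Qed.

(* Each element [m] is centralised: either [m ^+ 2] generates [D 2], and then
   <[m]> is invariant, or [m] times an element of [D 2] is an involution moved by
   invariant elements only. *)
Lemma abelian_of_cyclic_dim2 : cyclic (D 2) -> abelian N.
Proof.
case/cyclicP=> c cE; have Dc : c \in D 2 by rewrite cE cycle_id.
have Nc := subsetP (sDN 2) _ Dc.
have nc : Gam \subset 'N(<[c]>) by rewrite -cE dim_norm.
have Cc := cent_of_norm_cycle Nc nc.
have comD m g : m \in N -> g \in Gam -> [~ m, g] \in <[c]>.
  by move=> Nm Gg; rewrite -cE; apply: (@dim_commg _ N Gam 2 pr2 nNG 1).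
suff h m : m \in N -> N \subset 'C[m].
  by apply/centsP=> x Nx y Ny; apply/cent1P; apply: (subsetP (h y Ny)).
move=> Nm; have : m ^+ 2 \in D 2 by exact: (dim_pow pr2 pN nNG (m := 1)).
have cm : commute c m by apply/esym/cent1P; apply: (subsetP Cc).
rewrite cE => /cycleP[i mi]; have [oi|ei] := boolP (odd i).
  apply: cent_of_norm_cycle => //; apply/subsetP=> g Gg; rewrite inE -cycleJ cycle_subG.
  rewrite conjg_mulR groupM ?cycle_id //; apply: (subsetP _ _ (comD _ _ Nm Gg)).
  by rewrite -(cycle_expg_odd Nc oi) -mi cycle_subG mem_cycle.
pose k := i./2; have ik : i = (k * 2)%N by rewrite muln2 even_halfK.
pose t := m * c ^- k; have Nt : t \in N by rewrite groupM ?groupV ?groupX.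
have ct : commute c t by apply: commuteM => //; apply/commuteV/commuteX.
have t2 : t ^+ 2 = 1.
  rewrite expgMn; last by apply/commute_sym/commute_sym; rewrite /commute;
    apply/commuteV/commuteX/commute_sym.
  by rewrite mi ik expgM expVgn mulgV.
have comt g : g \in Gam -> [~ t, g] \in <[c]> by move=> Gg; apply: comD.
have fixt g h : g \in Gam -> h \in Gam -> [~ t, g] ^ h = [~ t, g].
  move=> Gg Gh; apply: (@involution_fixed c); rewrite ?comt ?(subsetP nc) //.
  have /cycleP[j jE] := comt g Gg.
  have : (t * [~ t, g]) ^+ 2 = 1 by rewrite -conjg_mulR -conjXg t2 conj1g.
  by rewrite expgMn ?t2 ?mul1g // jE; apply/commuteX/commute_sym.
have Ct : N \subset 'C[t].
  apply: cent_of_comm_action => // g h Gg Gh.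
  (* Because [t, g] is fixed by [Gam], the map g |-> [t, g] is a homomorphism to the abelian group
     <c>, so gh and hg move [t] to the same element. *)
  have tJ g' h' : g' \in Gam -> h' \in Gam -> t ^ (g' * h') = t * [~ t, h'] * [~ t, g'].
    by move=> Gg' Gh'; rewrite conjgM (conjg_mulR t) conjMg fixt // conjg_mulR.
  rewrite !tJ //; have /cycleP[j ->] := comt g Gg; have /cycleP[l ->] := comt h Gh.
  by rewrite -(mulgA t) -[RHS]mulgA -!expgD addnC.
apply/subsetP=> x Nx; apply/cent1P; have -> : m = t * c ^+ k by rewrite /t mulgKV.
have ctx := cent1P (subsetP Ct _ Nx); have ccx := cent1P (subsetP Cc _ Nx).
by apply: commuteM => //; apply: commuteX.
Qed.

Let DX m x : x \in D m -> x ^+ 2 \in D (2 * m).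
Proof. exact: dim_pow. Qed.
Let eqD i j : i <= j -> #|D i| = #|D j| -> D i = D j.
Proof.
move=> ij c; apply/esym/eq_group_sub; first exact: dim_le.
by have /eqP <- : D j == D i :> {set X} by rewrite eqEcard c leqnn dim_le.
Qed.

(** The series is constant from 5 to 8 and [D_7, Gam] is contained in D_9 = 1, so D_8 is generated
    by the squares of D_4, which must be cyclic of order 4. As D_3 = D_4, [D_3, Gam] lies in D_5, so
    D_4 needs the square of some d in D_2 outside D_5. This square has order 4, and d has order
    8. *)
Lemma cyclic_dim2 : #|D 2| = 8 -> #|D 3| = 4 -> #|D 4| = 4 -> #|D 5| = 2 ->
  #|D 8| = 2 -> D 9 :=: 1 -> cyclic (D 2).
Proof.
move=> c2 c3 c4 c5 c8 D9; have e58 : D 5 = D 8 by apply: eqD; rewrite ?c5 ?c8.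
have e78 : D 7 = D 8.
  by apply: eq_group_sub; [rewrite -e58|]; apply: dim_le.
have c71 : [~: D 7, Gam] :=: 1.
  by apply/trivgP; rewrite e78 -D9 (@dim_comm _ N Gam 2).
have e8 : D 8 = pow_group (D 4) 2.
  by apply: val_inj; rewrite (@DS 7) //= c71 joing1G.
have [t D4t t2] : exists2 t, t \in D 4 & t ^+ 2 != 1.
  apply/exists_inP; apply: contraT => /exists_inPn h.
  have : D 8 \subset [1 X].
    by rewrite e8 pow_group_sub // => x Dx; rewrite !inE; apply: contraNT (h x Dx).
  by move/trivgP/(congr1 (fun A : {set X} => #|A|)); rewrite cards1 c8.
have t4 : #[t] = 4.
  have := cardSg (_ : <[t]> \subset D 4); rewrite cycle_subG D4t c4 -orderE => /(_ isT).
  by move: t2; rewrite -order_dvdn; case: #[t] => [|[|[|[|[|]]]]].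
have D4E : D 4 :=: <[t]>.
  by apply/esym/eqP; rewrite eqEcard cycle_subG D4t c4 -orderE t4.
have e34 : D 3 = D 4 by apply: eqD; rewrite ?c3 ?c4.
have [d Dd d2] : exists2 d, d \in D 2 & d ^+ 2 \notin D 5.
  apply/exists_inP; apply: contraT => /exists_inPn h.
  have : D 4 \subset D 5.
    rewrite {1}(@DS 3) // join_subG e34 (@dim_comm _ N Gam 2) //=.
    by apply: pow_group_sub => x /h; rewrite negbK.
  by move/subset_leq_card; rewrite c4 c5.
apply/cyclicP; exists d; apply/esym/eqP; rewrite eqEcard cycle_subG Dd c2 -orderE.
suff -> : #[d] = 8 by [].
apply: (@order_two_power _ d 2).
  by have := order_dvdG Dd; rewrite c2 order_dvdn => /eqP.
apply: contraNneq d2 => d4; have D4d : d ^+ 2 \in D 4 by apply: (@DX 2).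
have e : (<[d ^+ 2]> \subset D 5) = (#|<[d ^+ 2]>| %| #|D 5|).
  have cyc4 : cyclic (D 4) by rewrite D4E cycle_cyclic.
  by apply/esym/(cardSg_cyclic cyc4); rewrite ?cycle_subG // dim_le.
by rewrite -cycle_subG e c5 -orderE order_dvdn -expgM d4.
Qed.

Lemma cycle_gen_notin_sqr (c g : X) :
  c \in N -> g \in <[c]> -> g \notin <[c ^+ 2]> -> <[g]> = <[c]>.
Proof.
move=> Nc /cycleP[i ->] nc; apply: cycle_expg_odd => //; apply: contraNT nc => ei.
by rewrite -[i]even_halfK // -muln2 mulnC expgM mem_cycle.
Qed.

Lemma rel_lower_dim i : L i \subset D i.+1.
Proof.
by elim: i => [|i IH] //; apply: subset_trans (dim_comm pr2 nNG _); apply: commSg.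
Qed.

(** [N] is abelian and its squares lie in D_2 = <c>. A square outside <c^2> generates <c>, so its
    root has order 16 and an involution splits off. Otherwise v^2 is an even power c^(2k) for every
    v and v c^(-k) has trivial square, so two involutions split off; the squares then miss the
    generators of <c>, and [N, Gam] has to supply one. *)
Lemma cyclic_dim2_cases : #|N| = 32 -> #|D 2| = 8 -> #|D 3| = 4 -> cyclic (D 2) ->
  [/\ N \isog [set: 'Z_16 * 'Z_2], L 1 \subset pow_group N 2 & L 2 \subset pow_group N 4] \/
  [/\ N \isog [set: 'Z_8 * 'Z_2 * 'Z_2], pow_group N 2 \subset L 1, L 1 \isog [set: 'Z_8]
    & L 2 \subset pow_group (L 1) 2].
Proof.
move=> cN c2 c3 cyc; have abN := abelian_of_cyclic_dim2 cyc.
case/cyclicP: (cyc) => c cE; have oc : #[c] = 8 by rewrite orderE -cE c2.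
have D2c : c \in D 2 by rewrite cE cycle_id.
have Nc := subsetP (sDN 2) _ D2c.
have comN x y : x \in N -> y \in N -> commute x y by move=> Nx Ny; apply: (centsP abN).
have cD3 : D 3 :=: <[c ^+ 2]>.
  apply/eqP; rewrite eqEcard c3 -orderE orderXdiv oc // andbT.
  rewrite -(cardSg_cyclic cyc) ?dim_le // ?cE ?cycle_subG ?mem_cycle //.
  by rewrite c3 -orderE orderXdiv oc.
have L1D : L 1 \subset D 2 := rel_lower_dim 1.
have L2D : L 2 \subset <[c ^+ 2]> by rewrite -cD3; apply: rel_lower_dim 2.
have sq x : x \in N -> x ^+ 2 \in <[c]> by rewrite -cE => Nx; apply: (@DX 1).
have sN (A : {set X}) : #|A| < 32 -> exists2 v, v \in N & v \notin A.
  move=> cA; apply/exists_inP; apply: contraLR cA => /exists_inPn h.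
  rewrite -leqNgt -cN; apply/subset_leq_card/subsetP=> x Nx; by have := h x Nx; rewrite negbK.
have [/exists_inP[u Nu un]|/exists_inPn h] := boolP [exists u in N, u ^+ 2 \notin <[c ^+ 2]>].
  have uc := cycle_gen_notin_sqr Nc (sq u Nu) un.
  have ou2 : #[u ^+ 2] = 8 by rewrite orderE uc -orderE.
  have ou : #[u] = 16.
    apply: (@order_two_power _ u 3).
      by rewrite (expgM u 2 8) -ou2 expg_order.
    rewrite (expgM u 2 4); apply/eqP=> /eqP.
    by rewrite -order_dvdn ou2.
  have [v Nv vu] : exists2 v, v \in N & v \notin <[u]>.
    by apply: sN; rewrite -orderE ou.
  have /cycleP[k vk] : v ^+ 2 \in <[u ^+ 2]> by rewrite uc sq.
  pose w := v * u ^- k.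
  have Nw : w \in N by rewrite groupM ?groupV ?groupX.
  have w2 : w ^+ 2 = 1.
    rewrite expgMn; last by apply: comN; rewrite ?groupV ?groupX.
    by rewrite vk -expgM expgVn -expgM mulnC mulgV.
  have wu : w \notin <[u]> by rewrite groupMr // groupV mem_cycle.
  have Cw : w \in 'C(<[u]>).
    by rewrite cent_cycle; apply/cent1P; apply: comN.
  have [dw ow cw] := dprod_involution Cw wu w2.
  have NE : <[u]> <*> <[w]> = N.
    apply/eqP; rewrite eqEcard join_subG !cycle_subG Nu Nw /=.
    by rewrite cw cN -orderE ou.
  left; split.
  - by rewrite NE in dw; apply: (isog_prod dw); apply: cycle_isog_Zp.
  - by rewrite (subset_trans L1D) // cE -uc cycle_subG mem_pow_group.
  - rewrite (subset_trans L2D) //.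
    have /cycleP[k' ->] : c \in <[u ^+ 2]> by rewrite uc cycle_id.
    by rewrite cycle_subG -expgM mulnC expgM groupX // -expgM mem_pow_group.
have pD : pow_group N 2 \subset <[c ^+ 2]>.
  by apply: pow_group_sub => x Nx; have := h x Nx; rewrite negbK.
have c2c : <[c ^+ 2]> \subset <[c]> by rewrite cycle_subG mem_cycle.
have L1E : L 1 :=: <[c]>.
  apply/eqP; rewrite eqEsubset -cE L1D /=.
  have : ~~ (L 1 \subset <[c ^+ 2]>).
    apply/negP=> sL; have : D 2 \subset <[c ^+ 2]>.
      by rewrite (@DS 1) // join_subG sL.
    by rewrite -cD3 => /subset_leq_card; rewrite c2 c3.
  case/subsetPn=> g Lg gn; rewrite cE -(cycle_gen_notin_sqr Nc _ gn) ?cycle_subG //.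
  by rewrite -cE (subsetP L1D).
have invol (A : {group X}) : #|A| < 32 -> c \in A ->
    exists w, [/\ w \in N, w \notin A & w ^+ 2 = 1].
  move=> cA Ac; have [v Nv vA] := sN A cA.
  have := h v Nv; rewrite negbK => /cycleP[k vk]; exists (v * c ^- k).
  split; first by rewrite groupM ?groupV ?groupX.
    by rewrite groupMr // groupV groupX.
  rewrite expgMn; last by apply: comN; rewrite ?groupV ?groupX.
  by rewrite vk -expgM expgVn -expgM mulnC mulgV.
have CN (A : {group X}) w : A \subset N -> w \in N -> w \in 'C(A).
  by move=> sAN Nw; apply: subsetP Nw; rewrite (subset_trans abN) // centS.
have [w [Nw wc w2]] : exists w, [/\ w \in N, w \notin <[c]> & w ^+ 2 = 1].
  by apply: (invol <[c]>%G); rewrite ?cycle_id // -orderE oc.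
have sc : <[c]> \subset N by rewrite cycle_subG.
have [dw ow cw] := dprod_involution (CN _ _ sc Nw) wc w2.
have sw : <[c]> <*> <[w]> \subset N by rewrite join_subG sc cycle_subG.
have [v [Nv vc v2]] : exists v, [/\ v \in N, v \notin <[c]> <*> <[w]> & v ^+ 2 = 1].
  apply: (invol (<[c]> <*> <[w]>)%G); first by rewrite /= cw -orderE oc.
  by rewrite (subsetP (joing_subl _ _)) // cycle_id.
have [dv ov cv] := dprod_involution (CN (<[c]> <*> <[w]>)%G _ sw Nv) vc v2.
have NE : <[c]> <*> <[w]> <*> <[v]> = N.
  apply/eqP; rewrite eqEcard join_subG sw cycle_subG Nv /=.
  by rewrite cv cw cN -orderE oc.
right; split; last 1 first.
- rewrite (subset_trans L2D) // cycle_subG mem_pow_group //.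
  by rewrite L1E cycle_id.
- rewrite /= NE in dv; apply: (isog_prod (A := <[c]> <*> <[w]>) dv); last exact: cycle_isog_Zp.
  by apply: (isog_prod dw); apply: cycle_isog_Zp.
- by rewrite L1E (subset_trans pD).
- by rewrite L1E; apply: cycle_isog_Zp.
Qed.

Lemma pow_group_cycle (b : X) k : pow_group <[b]> k :=: <[b ^+ k]>.
Proof.
apply/eqP; rewrite eqEsubset cycle_subG mem_pow_group ?cycle_id // andbT.
apply: (@pow_group_sub _ <[b]>%G <[b ^+ k]>%G) => _ /cycleP[i ->].
by rewrite -expgM mulnC expgM mem_cycle.
Qed.

(** An element of [<b>, Gam] outside <b^2> would generate <b>, against nilpotency. *)
Lemma comm_cycle_sqr (b : X) : b \in N -> Gam \subset 'N(<[b]>) ->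
  [~: <[b]>, Gam] \subset <[b ^+ 2]>.
Proof.
move=> Nb nb; have sb : [~: <[b]>, Gam] \subset <[b]> by rewrite commg_subl.
apply: contraT => /subsetPn[g Lg gn].
have e := cycle_gen_notin_sqr Nb (subsetP sb _ Lg) gn.
have b1 : <[b]> = 1.
  apply: (@comm_sub_trivial _ N Gam nNG nilN <[b]>%G); rewrite /= ?cycle_subG //.
  by rewrite -cycle_subG -{1}e cycle_subG.
by move: gn; rewrite (_ : g = 1) ?group1 //; apply/set1P; rewrite -[[set 1]]b1 (subsetP sb).
Qed.

(** All terms from D_2 on are generated by powers c^(2^i). Commutators of a cyclic term fall into
    its squares, so each new term is given by its power part alone, and the logarithms add up to 5 +
    3 + 2 + 2 + 1 + 1 + 1 + 1. *)
Lemma dim_log_sum_cyclic : #|N| = 32 -> #|D 2| = 8 -> cyclic (D 2) ->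
  \sum_(j < (2 ^ 5).+1) dim_log N Gam 2 j.+1 = 16.
Proof.
move=> cN c2 /cyclicP[c D2]; have oc : #[c] = 8 by rewrite orderE -D2 c2.
have Nc : c \in N by rewrite (subsetP (sDN 2)) // D2 cycle_id.
have step m b d : 0 < m -> D m :=: <[b]> -> D (m %/ 2).+1 :=: <[d]> ->
    <[b ^+ 2]> \subset <[d ^+ 2]> -> D m.+1 :=: <[d ^+ 2]>.
  move=> m0 Db Dd sbd; have Nb : b \in N by rewrite (subsetP (sDN m)) // Db cycle_id.
  apply/eqP; rewrite DS // eqEsubset join_subG Dd pow_group_cycle subxx joing_subr !andbT.
  by rewrite Db (subset_trans _ sbd) // comm_cycle_sqr // -Db dim_norm.
have sc i j : <[c ^+ (i * j)]> \subset <[c ^+ i]> by rewrite cycle_subG expgM mem_cycle.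
have {}step m i j : 0 < m -> D m :=: <[c ^+ (2 ^ i)]> -> D (m %/ 2).+1 :=: <[c ^+ (2 ^ j)]> ->
    j <= i -> D m.+1 :=: <[c ^+ (2 ^ j.+1)]>.
  move=> m0 Dm Dj ij; rewrite (step _ _ _ m0 Dm Dj) -?expgM -?expnSr //.
  by rewrite -(subnKC ij) -addSn expnD.
have D2' : D 2 :=: <[c ^+ (2 ^ 0)]> by [].
have D3 := @step 2 _ _ isT D2' D2' isT; have D4 := @step 3 _ _ isT D3 D2' isT.
have D5 := @step 4 _ _ isT D4 D3 isT; have D6 := @step 5 _ _ isT D5 D3 isT.
have D7 := @step 6 _ _ isT D6 D4 isT; have D8 := @step 7 _ _ isT D7 D4 isT.
have D9 : D 9 :=: 1.
  have {1}-> : D 9 :=: <[c ^+ #[c]]> by rewrite oc; apply: (@step 8 _ _ isT D8 D5 isT).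
  by rewrite expg_order cycle1.
have eE j k : #|D j| = (2 ^ k)%N -> dim_log N Gam 2 j = k.
  by move=> h; rewrite /dim_log h pfactorK.
have oX k : k <= 3 -> #|<[c ^+ (2 ^ k)]>| = (2 ^ (3 - k))%N.
  by move=> k3; rewrite -orderE orderXdiv oc (_ : 8 = 2 ^ 3)%N // ?expnB // dvdn_exp2l.
rewrite (@dim_log_sum_trunc _ _ _ _ 8) // !big_ord_recr big_ord0 /=.
rewrite (eE 1%N 5) // (eE 2 3) // (eE 3 2) ?D3 ?oX // (eE 4 2) ?D4 ?oX //.
by rewrite (eE 5 1%N) ?D5 ?oX // (eE 6 1%N) ?D6 ?oX // (eE 7 1%N) ?D7 ?oX // (eE 8 1%N) ?D8 ?oX.
Qed.
End CyclicSecond.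

(** * The orders 32, 16, 8, 4, 2, 2: a chain x, y, z of commutators *)

Lemma index2_mem (X : finGroupType) (A B : {group X}) a b : B \subset A -> #|A| = (2 * #|B|)%N ->
  a \in A -> a \notin B -> b \in A -> b \notin B -> b * a^-1 \in B.
Proof.
move=> sBA cA Aa Ba Ab Bb; have i2 : #|A : B| = 2.
  by rewrite -divgS // cA mulnK.
have : b \in B :* a by rewrite (rcoset_index2 sBA i2) inE ?Ba ?Bb.
by rewrite mem_rcoset.
Qed.

Lemma index2_sub (X : finGroupType) (A B M : {group X}) a : B \subset A -> #|A| = (2 * #|B|)%N ->
  a \in A -> a \notin B -> B \subset M -> a \in M -> A \subset M.
Proof.
move=> sBA cA Aa Ba sBM Ma; apply/subsetP=> b Ab.
have [Bb|Bb] := boolP (b \in B); first exact: (subsetP sBM).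
by rewrite -(groupMr _ (groupVr Ma)) (subsetP sBM) // (index2_mem sBA cA).
Qed.

Lemma cycle_dprod (X : finGroupType) (x y : X) (H : {group X}) : commute x y ->
  <[x]> <*> <[y]> = H -> #|H| = (#[x] * #[y])%N -> <[x]> \x <[y]> = H.
Proof.
move=> cxy HE cH; have sC : <[y]> \subset 'C(<[x]>).
  by rewrite cycle_subG /= cent_cycle; apply/cent1P/commute_sym.
rewrite -HE dprodEY //; apply/trivgP; rewrite -[_ \subset _]/(_ \subset _).
have := mul_cardG <[x]>%G <[y]>%G; rewrite -(cent_joinEr sC) HE cH /= -!orderE.
rewrite -[LHS]muln1 => /eqP; rewrite eqn_pmul2l ?muln_gt0 ?order_gt0 // => /eqP h.
by rewrite -(@card1_trivg _ (<[x]> :&: <[y]>)%G) //=.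
Qed.

Section SecondPattern.
Variables (X : finGroupType) (N Gam : {group X}).
Hypothesis pN : 2.-group N.
Hypothesis nNG : Gam \subset 'N(N).
Hypothesis innN : forall x, x \in N ->
  exists2 c, c \in [~: Gam, Gam] & {in N, forall y, y ^ x = y ^ c}.
Hypothesis innG : {in Gam &, forall g h,
  exists2 n, n \in N & {in N, forall y, y ^ [~ g, h] = y ^ n}}.
Local Notation D := (dim_series N Gam 2).
Local Notation L := (rel_lower N Gam).
Let pr2 : prime 2 := isT.
Hypothesis cN : #|N| = 32.
Hypothesis c2 : #|D 2| = 16.
Hypothesis c3 : #|D 3| = 8.
Hypothesis c4 : #|D 4| = 4.
Hypothesis c5 : #|D 5| = 2.
Hypothesis c6 : #|D 6| = 2.
Hypothesis D7 : D 7 :=: 1.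

Let DS m : 0 < m -> D m.+1 = ([~: D m, Gam] <*> pow_group (D (m %/ 2).+1) 2)%G.
Proof. exact: dim_seriesS. Qed.
Let Dle i j : i <= j -> D j \subset D i.
Proof. exact: dim_le. Qed.
Let DN m x : x \in D m -> x \in N.
Proof. exact: (subsetP (dim_sub pr2 nNG m)). Qed.
Let DR m x g : x \in D m -> g \in Gam -> [~ x, g] \in D m.+1.
Proof. exact: dim_commg. Qed.
Let DJ m x g : x \in D m -> g \in Gam -> x ^ g \in D m.
Proof. by move=> Dx Gg; rewrite memJ_norm // (subsetP (dim_norm pr2 nNG m)). Qed.
Let nND m n : n \in N -> n \in 'N(D m).
Proof. by move=> Nn; apply: (subsetP (inner_norm innN (dim_sub pr2 nNG m) (dim_norm pr2 nNG
  m))). Qed.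
Let DJN m x n : x \in D m -> n \in N -> x ^ n \in D m.
Proof. by move=> Dx Nn; rewrite memJ_norm // nND. Qed.
Let DRNs m : [~: D m, N] \subset [~: D m, Gam, Gam].
Proof. exact: (comm_inner innN (dim_sub _ _ _) (dim_norm _ _ _)). Qed.
Let DRN m x n : x \in D m -> n \in N -> [~ x, n] \in D m.+2.
Proof.
move=> Dx Nn; have := subsetP (DRNs m) _ (mem_commg Dx Nn); apply: subsetP.
by apply: subset_trans (dim_comm pr2 nNG _); apply: commSg; apply: dim_comm.
Qed.
Let D2X m x : x \in D m -> x ^+ 2 \in D (2 * m).
Proof. exact: dim_pow. Qed.

Let e56 : D 5 = D 6.
Proof.
apply/esym/eq_group_sub; first exact: Dle.
by have /eqP <- : D 6 == D 5 :> {set X} by rewrite eqEcard c5 c6 leqnn Dle.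
Qed.

Let D5G x g : x \in D 5 -> g \in Gam -> [~ x, g] = 1.
Proof. by rewrite e56 => Dx Gg; apply/set1P; rewrite -[[set 1]]D7; apply: DR. Qed.

(** [D_4, N] is contained in [D_4, Gam, Gam], hence in [D_5, Gam], which is trivial because D_5 =
    D_6 and D_7 = 1. *)
Let D4N x n : x \in D 4 -> n \in N -> [~ x, n] = 1.
Proof.
move=> Dx Nn; have := subsetP (DRNs 4) _ (mem_commg Dx Nn) => h; apply/set1P.
suff : [~: D 4, Gam, Gam] \subset [set 1] by move/subsetP; apply.
apply: subset_trans (commSg _ (dim_comm pr2 nNG 4)) _.
by rewrite gen_subG; apply/subsetP=> _ /imset2P[a g Da Gg ->]; rewrite inE D5G.
Qed.

Let D4C x n : x \in D 4 -> n \in N -> commute x n.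
Proof. by move=> Dx Nn; apply/commgP; rewrite D4N. Qed.

Let D4sq x : x \in D 4 -> x ^+ 2 = 1.
Proof. by move=> Dx; apply/set1P; rewrite -[[set 1]]D7; apply: (subsetP (@Dle 7 8 isT));
  apply: (@D2X 4). Qed.

(** D_6 is generated by the squares of D_3, since [D_5, Gam] = 1. Elements of D_4 commute with [N]
    and have trivial square, so all elements of D_3 outside D_4 share one square, which cannot be
    1. *)
Lemma dim3_sqr z : z \in D 3 -> z \notin D 4 -> z ^+ 2 != 1.
Proof.
move=> Dz nz; apply/eqP=> z2; have : D 6 \subset [1 X].
  rewrite (@DS 5) // join_subG; apply/andP; split.
    by rewrite gen_subG; apply/subsetP=> _ /imset2P[a g Da Gg ->]; rewrite inE D5G.
  apply: (@pow_group_sub _ (D 3)) => w Dw; apply/set1P.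
  have [Dw4|nw] := boolP (w \in D 4); first exact: D4sq.
  have D4h : w * z^-1 \in D 4 by apply: (index2_mem (A := D 3)); rewrite ?Dle ?c3 ?c4.
  rewrite -[w](mulgKV z) expgMn; last by apply: D4C; rewrite ?(DN Dz).
  by rewrite z2 D4sq ?mul1g.
by move/subset_leq_card; rewrite c6 cards1.
Qed.

Lemma dim3_sqr_cycle z : z \in D 3 -> z \notin D 4 -> D 5 :=: <[z ^+ 2]> /\ #[z] = 4.
Proof.
move=> Dz nz; have z2 := dim3_sqr Dz nz.
have D6z : z ^+ 2 \in D 6 by apply: (@D2X 3).
have z4 : z ^+ 4 = 1.
  by rewrite (expgM z 2 2); apply: D4sq; apply: (subsetP (@Dle 4 6 isT)).
have oz : #[z] = 4 by apply: (@order_two_power _ z 1).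
split=> //; apply/esym/eqP; rewrite eqEcard cycle_subG e56 D6z c6 -orderE orderXdiv oz //.
Qed.

Let comm_indep m h k g : #|D m| = (2 * #|D m.+1|)%N -> h \in D m -> h \notin D m.+1 ->
  k \in D m -> k \notin D m.+1 -> g \in Gam -> [~ h, g] \in D m.+2 -> [~ k, g] \in D m.+2.
Proof.
move=> cD Dh nh Dk nk Gg Dhg; have Dkh := index2_mem (Dle (leqnSn m)) cD Dh nh Dk nk.
by rewrite -(mulgKV h k) commMgJ groupM // DJN ?(DN Dh) // DR.
Qed.

(* The maps g |-> [x, g] mod D 3 and g |-> [u, g] mod D 4 are nontrivial
   homomorphisms to groups of order 2, hence nontrivial at a common point. *)
Lemma chain_exists : exists x s,
  [/\ x \in N, s \in Gam, [~ x, s] \notin D 3 & [~ x, s, s] \notin D 4].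
Proof.
have c43 : #|D 3| = (2 * #|D 4|)%N by rewrite c3 c4.
have c32 : #|D 2| = (2 * #|D 3|)%N by rewrite c2 c3.
have n34 : ~~ (D 3 \subset D 4) by apply/negP=> /subset_leq_card; rewrite c3 c4.
have sq4 : pow_group (D 2) 2 \subset D 4 by apply: pow_group_sub => h; apply: (@D2X 2).
have hb : ~~ ([~: D 2, Gam] \subset D 4).
  by apply: contra n34 => h; rewrite (@DS 2) // join_subG h.
(* Otherwise D_2 would be generated by the squares w^2 and elements of D_3, while [w^2, g] =
   [w, g]^2 modulo D_4 with [w, g] in D_3, so that [D_2, Gam] would be contained in D_4, against
   [hb]. *)
have ha : ~~ ([~: N, Gam] \subset D 3).
  apply: contra hb => LD3; have gS : group_set [set w in D 2 | [forall g in Gam, [~ w, g] \in D 4]].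
    apply/group_setP; split=> [|a b].
      by rewrite inE group1; apply/forall_inP=> g _; rewrite comm1g group1.
    rewrite !inE => /andP[Da /forall_inP ha] /andP[Db /forall_inP hb]; rewrite groupM //.
    by apply/forall_inP=> g Gg; rewrite commMgJ groupM ?hb // DJN ?ha // (DN Db).
  suff sG : D 2 \subset Group gS.
    rewrite gen_subG; apply/subsetP=> _ /imset2P[w g Dw Gg ->].
    by have := subsetP sG _ Dw; rewrite inE => /andP[_ /forall_inP]; apply.
  rewrite {1}(@DS 1) // join_subG; apply/andP; split.
    apply/subsetP=> w Lw; rewrite inE (subsetP (dim_comm pr2 nNG 1) _ Lw).
    by apply/forall_inP=> g Gg; apply: DR => //; apply: (subsetP LD3).
  apply: (@pow_group_sub _ (D 1) (Group gS)) => w Nw; rewrite inE (D2X (m := 1)) //=.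
  apply/forall_inP=> g Gg; have Dwg : [~ w, g] \in D 3 by rewrite (subsetP LD3) ?mem_commg.
  rewrite expgS expg1 commMgJ conjg_mulR -mulgA.
  have Dww : [~ [~ w, g], w] \in D 4 by apply: (subsetP (@Dle 4 5 isT)); apply: DRN.
  rewrite (D4C Dww) ?(DN Dwg) // mulgA groupM //.
  by apply: (subsetP (@Dle 4 6 isT)); apply: (@D2X 3).
have [x [g [Nx Gg xg]]] : exists x g, [/\ x \in N, g \in Gam & [~ x, g] \notin D 3].
  move: ha; rewrite gen_subG => /subsetPn[_ /imset2P[x g Nx Gg ->] n]; by exists x, g.
have [u [h [Du Gh uh]]] : exists u h, [/\ u \in D 2, h \in Gam & [~ u, h] \notin D 4].
  move: hb; rewrite gen_subG => /subsetPn[_ /imset2P[x' g' Nx' Gg' ->] n]; by exists x', g'.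
have nu : u \notin D 3 by apply: contra uh => Du3; apply: DR.
have DD2 g' : g' \in Gam -> [~ x, g'] \in D 2 by move=> ?; apply: (@DR 1).
have beta g' k : g' \in Gam -> k \in D 2 -> k \notin D 3 -> [~ u, g'] \notin D 4 ->
  [~ k, g'] \notin D 4.
  by move=> Gg' Dk nk; apply: contra; apply: comm_indep.
have sol g' : g' \in Gam -> [~ x, g'] \notin D 3 -> [~ u, g'] \notin D 4 -> exists x s,
  [/\ x \in N, s \in Gam, [~ x, s] \notin D 3 & [~ x, s, s] \notin D 4].
  by move=> Gg' h1 h2; exists x, g'; split=> //; apply: beta => //; apply: DD2.
have [ug|ug] := boolP ([~ u, g] \in D 4); last exact: sol Gg xg ug.
have [xh|xh] := boolP ([~ x, h] \in D 3); last exact: sol Gh xh uh.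
apply: (sol (g * h)); first exact: groupM.
  by rewrite commgMJ groupMl // memJ_norm // (subsetP (dim_norm pr2 nNG 3)).
by rewrite commgMJ groupMr // DJ.
Qed.

Section Chain.
Variables x s y z : X.
Hypothesis Nx : x \in N.
Hypothesis Gs : s \in Gam.
Hypothesis Ey : [~ x, s] = y.
Hypothesis Ez : [~ y, s] = z.
Hypothesis ny : y \notin D 3.
Hypothesis nz : z \notin D 4.

Let Dy : y \in D 2. Proof. by rewrite -Ey; apply: (@DR 1). Qed.
Let Dz : z \in D 3. Proof. by rewrite -Ez; apply: DR. Qed.
Let Ny := DN Dy.
Let Nz := DN Dz.
Let xs : x ^ s = x * y. Proof. by rewrite conjg_mulR Ey. Qed.
Let ys : y ^ s = y * z. Proof. by rewrite conjg_mulR Ez. Qed.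

Let rel_y2 : [~ x ^+ 2, s] = y ^+ 2 * [~ y, x].
Proof.
have cyx : commute y [~ y, x] by apply/commute_sym/D4C => //; apply: DRN.
rewrite expgS expg1 commMgJ Ey conjg_mulR.
by rewrite -[LHS]mulgA -cyx mulgA.
Qed.

Let D3y h : h \in D 2 -> h \notin D 3 -> [~ h, s] \notin D 4.
Proof.
move=> Dh nh; have D3h : h * y^-1 \in D 3 by apply: (index2_mem (A := D 2)); rewrite ?Dle ?c2 ?c3.
apply: contra nz => Dhs; have := Dhs; rewrite -{1}(mulgKV y h) commMgJ Ez.
by rewrite groupMl // DJN // DR.
Qed.

(** [x^2, s] = y^2 [y, x] lies in D_4, whereas [h, s] does not for h in D_2 outside D_3. *)
Lemma chain_x2 : x ^+ 2 \in D 3.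
Proof.
apply: contraT => nx2; have := D3y (D2X (m := 1) Nx) nx2.
by rewrite rel_y2 groupM //; [apply: (@D2X 2) | apply: DRN].
Qed.

(* [y] acts as the commutator of [x] and [s], so it suffices to compare
   [z ^ (x * s)] with [z ^ (s * x)]. *)
Lemma chain_comm : commute z y.
Proof.
have [d Dd zs] : exists2 d, d \in D 4 & z ^ s = z * d.
  by exists [~ z, s]; [apply: DR | rewrite conjg_mulR].
have [w Dw zx] : exists2 w, w \in D 5 & z ^ x = z * w.
  by exists [~ z, x]; [apply: DRN | rewrite conjg_mulR].
have D4w : w \in D 4 by apply: (subsetP (Dle _)) Dw.
have fixN c n : c \in D 4 -> n \in N -> c ^ n = c.
  by move=> Dc Nn; rewrite conjg_mulR D4N ?mulg1.
have ws : w ^ s = w by rewrite conjg_mulR D5G ?mulg1.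
have e : z ^ (s * (x * y)) = z ^ (x * s) by rewrite -xs conjgE mulKVg.
have eL : z ^ (s * (x * y)) = z ^ y * w * d.
  by rewrite mulgA conjgM conjgM zs (conjMg z d) zx (fixN d x)
    // (conjMg _ d y) (conjMg z w y) (fixN d y) // (fixN w y).
have eR : z ^ (x * s) = z * w * d.
  by rewrite conjgM zx conjMg zs ws -!mulgA (D4C Dd) ?(DN Dw).
apply/commgP/conjg_fixP; apply: (@mulIg _ w); apply: (@mulIg _ d).
by rewrite -eL e eR.
Qed.

Let zy : z ^ y = z. Proof. by apply/conjg_fixP/commgP/chain_comm. Qed.

(** As z commutes with y, [y^2, s] = z^2, which is not 1; but [Gam] centralises D_5. *)
Lemma chain_y2 : [/\ y ^+ 2 \in D 4, y ^+ 2 \notin D 5, [~ y ^+ 2, s] = z ^+ 2 & #[y] = 4].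
Proof.
have Dy2 : y ^+ 2 \in D 4 by apply: (@D2X 2).
have y2s : [~ y ^+ 2, s] = z ^+ 2 by rewrite expgS expg1 commMgJ Ez zy.
have ny2 : y ^+ 2 \notin D 5.
  by apply: contra (dim3_sqr Dz nz) => /D5G-/(_ _ Gs); rewrite y2s => ->.
split=> //; apply: (@order_two_power _ y 1); first by rewrite (expgM y 2 2) D4sq.
by apply: contraNneq ny2 => /= ->.
Qed.

(** D_5 = <z^2>, and every layer above it has order 2, represented by y^2, z, y and x in turn. In
    [chain_gen3], [chain_gen2] and [chain_gen1] an arbitrary [w] replaces z, so that x^2 can be used
    as well. *)
Lemma chain_gen4 (M : {group X}) : y ^+ 2 \in M -> z ^+ 2 \in M -> D 4 \subset M.
Proof.
have [Dy2 ny2 _ _] := chain_y2; have [D5E _] := dim3_sqr_cycle Dz nz.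
by move=> My Mz; apply: (index2_sub (B := D 5) _ _ Dy2 ny2); rewrite ?Dle ?c4 ?c5 // D5E cycle_subG.
Qed.

Lemma chain_gen3 (M : {group X}) w : w \in D 3 -> w \notin D 4 ->
  y ^+ 2 \in M -> w \in M -> D 3 \subset M.
Proof.
move=> Dw nw My Mw; apply: (index2_sub (B := D 4) _ _ Dw nw); rewrite ?Dle ?c3 ?c4 //.
apply: chain_gen4 => //.
have [D5E _] := dim3_sqr_cycle Dz nz; have [D5W _] := dim3_sqr_cycle Dw nw.
have : z ^+ 2 \in <[w ^+ 2]> by rewrite -D5W D5E cycle_id.
by apply: subsetP; rewrite cycle_subG groupX.
Qed.

Lemma chain_gen2 (M : {group X}) w : w \in D 3 -> w \notin D 4 ->
  y \in M -> w \in M -> D 2 \subset M.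
Proof.
move=> Dw nw My Mw; apply: (index2_sub (B := D 3) _ _ Dy ny); rewrite ?Dle ?c2 ?c3 //.
by apply: (chain_gen3 Dw nw); rewrite ?groupX.
Qed.

Lemma chain_x : x \notin D 2.
Proof. by apply: contra ny => Dx; rewrite -Ey; apply: DR. Qed.

Lemma chain_gen1 (M : {group X}) w : w \in D 3 -> w \notin D 4 ->
  y \in M -> w \in M -> x \in M -> N \subset M.
Proof.
move=> Dw nw My Mw Mx; apply: (index2_sub (B := D 2) (a := x)); rewrite ?cN ?c2 //.
- exact: (dim_sub pr2 nNG).
- exact: chain_x.
exact: (chain_gen2 Dw nw).
Qed.

Lemma chain_dprod2 : <[y]> \x <[z]> = D 2.
Proof.
have [_ _ _ oy] := chain_y2; have [_ oz] := dim3_sqr_cycle Dz nz.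
apply: cycle_dprod; [exact/commute_sym/chain_comm | apply/eqP | by rewrite c2 oy oz].
rewrite eqEsubset join_subG !cycle_subG Dy (subsetP (Dle _) _ Dz) //=.
by apply: (@chain_gen2 (<[y]> <*> <[z]>)%G z); rewrite // mem_gen // inE cycle_id ?orbT.
Qed.

Lemma chain_dprod3 : <[z]> \x <[y ^+ 2]> = D 3.
Proof.
have [Dy2 _ _ oy] := chain_y2; have [_ oz] := dim3_sqr_cycle Dz nz.
apply: cycle_dprod; [exact/commuteX/chain_comm | apply/eqP | by rewrite c3 orderXdiv oy ?oz].
rewrite eqEsubset join_subG !cycle_subG Dz (subsetP (Dle _) _ Dy2) //=.
by apply: (@chain_gen3 (<[z]> <*> <[y ^+ 2]>)%G z); rewrite // mem_gen // inE cycle_id ?orbT.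
Qed.

(** The generator that is not visibly a commutator is y^2 = [x^2, s] [y, x]^-1, where [y, x] lies in
    L 3. From L 1 = D_2, which contains x^2, it follows that y^2 is in L 2, so L 2 = D_3. By
    [chain_x2] this group contains x^2 too, and the same formula puts y^2 into L 3. *)
Lemma chain_lower : [/\ L 1 = D 2, L 2 = D 3, L 3 = D 4 & L 4 = D 5].
Proof.
have sL i : L i.+1 \subset L i.
  by elim: i => [|i IH]; [rewrite /= commg_subl | apply: commSg].
have LD i : L i \subset D i.+1 := rel_lower_dim nNG i.
have Ly : y \in L 1 by rewrite -Ey mem_commg.
have Lz : z \in L 2 by rewrite -Ez mem_commg.
have e1 : L 1 = D 2.
  by apply: eq_group_sub => //; apply: (chain_gen2 Dz nz) => //; apply: (subsetP (sL 1%N)).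
have Lyx : [~ y, x] \in L 3.
  suff : [~ y, x] \in [~: L 1, Gam, Gam] by [].
  by rewrite e1 (subsetP (DRNs 2)) // mem_commg.
have y2E : y ^+ 2 = [~ x ^+ 2, s] * [~ y, x]^-1 by rewrite rel_y2 mulgK.
have Ly2 : y ^+ 2 \in L 2.
  rewrite y2E groupM ?groupV ?(subsetP (sL 2) _ Lyx) //.
  suff : [~ x ^+ 2, s] \in [~: L 1, Gam] by [].
  by rewrite e1 mem_commg // (D2X (m := 1)).
have e2 : L 2 = D 3 by apply: eq_group_sub => //; apply: (chain_gen3 Dz nz).
have L3y2 : y ^+ 2 \in L 3.
  rewrite y2E groupM ?groupV //; suff : [~ x ^+ 2, s] \in [~: L 2, Gam] by [].
  by rewrite e2 mem_commg // chain_x2.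
have [Dy2 ny2 y2s _] := chain_y2.
have L4z2 : z ^+ 2 \in L 4 by rewrite -y2s mem_commg.
have e3 : L 3 = D 4.
  by apply: eq_group_sub => //; apply: chain_gen4 => //; apply: (subsetP (sL 3)).
split=> //; apply: eq_group_sub => //.
by have [-> _] := dim3_sqr_cycle Dz nz; rewrite cycle_subG.
Qed.

Lemma chain_pow : pow_group (D 2) 2 = D 4.
Proof.
apply: eq_group_sub; first by apply: pow_group_sub => h; apply: (@D2X 2).
by apply: chain_gen4; apply: mem_pow_group => //; apply: (subsetP (Dle _)) Dz.
Qed.

Lemma chain_comm5 : exists2 g, g \in Gam & [~ z, g] \notin D 5.
Proof.
apply/exists_inP; apply: contraT => /exists_inPn h.
have [_ ny2 _ _] := chain_y2; have [_ e2 e3 _] := chain_lower.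
have : D 4 \subset D 5.
  rewrite -{1}e3; suff : [~: L 2, Gam] \subset D 5 by [].
  rewrite e2 gen_subG; apply/subsetP=> _ /imset2P[w g Dw Gg ->].
  have [Dw4|nw] := boolP (w \in D 4); first exact: DR.
  apply: (comm_indep _ Dz nz Dw nw) => //; first by rewrite c3 c4.
  by have := h g Gg; rewrite negbK.
by move/subset_leq_card; rewrite c4 c5.
Qed.

(** N/D_2 has order 2, and [D_2, N] is contained in D_4. *)
Let NN4 u n : u \in N -> n \in N -> [~ u, n] \in D 4.
Proof.
move=> Nu Nn; have [Du|nu] := boolP (u \in D 2); first exact: DRN.
have [Dn|nn] := boolP (n \in D 2); first by rewrite -groupV invg_comm; apply: DRN.
have Dnu : n * u^-1 \in D 2 by apply: (index2_mem (A := N)); rewrite ?(dim_sub pr2 nNG) ?cN ?c2.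
rewrite -(mulgKV u n) commgMJ commgg mul1g DJN // -groupV invg_comm; exact: DRN.
Qed.

(* [~ s, g] acts as an element of [N], hence trivially on [N] modulo [D 4]. *)
Lemma chain_alpha g : g \in Gam -> ([~ x, g] \in D 3) = ([~ y, g] \in D 4).
Proof.
move=> Gg; pose p := [~ x, g]; have Dp : p \in D 2 by apply: (@DR 1).
have Np := DN Dp.
have e1 : x ^ (s * g) = x * p * (y * [~ y, g]) by rewrite conjgM xs conjMg !conjg_mulR.
have e2 : x ^ (g * s) = x * y * (p * [~ p, s])
  by rewrite conjgM (conjg_mulR x) conjMg xs (conjg_mulR p).
have [n Nn nE] := innG Gs Gg.
have Nxgs : x ^ (g * s) \in N by rewrite memJ_norm // (subsetP nNG) // groupM.
have e : [~ x ^ (g * s), n] = (x ^ (g * s))^-1 * x ^ (s * g).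
  by rewrite commgEl -nE // -conjgM -commgC.
have : (x ^ (g * s))^-1 * x ^ (s * g) \in D 4 by rewrite -e NN4.
have -> : (x ^ (g * s))^-1 * x ^ (s * g) = [~ p, s]^-1 * [~ p, y] * [~ y, g].
  have K (a b c d r : X) : (a * b * (c * d))^-1 * (a * c * (b * r)) = d^-1 * (c^-1 * (b^-1 * (c
    * b))) * r.
    by rewrite !invMg -!mulgA mulKg.
  by rewrite e1 e2 K.
have -> : ([~ x, g] \in D 3) = ([~ p, s] \in D 4).
  apply/idP/idP=> [Dp3|]; first exact: DR.
  by apply: contraTT => np; apply: D3y.
move=> h; apply/idP/idP=> [h1|h1].
  by move: h; rewrite groupMl // groupM ?groupV // NN4.
move: h; rewrite groupMr // groupMr ?groupV //; exact: NN4.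
Qed.

(** By [chain_alpha] the condition on [x, s', s'] follows from the one on [x, s']. It remains to
    avoid the kernels of two nontrivial homomorphisms to groups of order 2, given by [x, g] modulo
    D_3 and [z, g] modulo D_5; one of g, s and gs does. *)
Lemma chain_improve : exists s', [/\ s' \in Gam, [~ x, s'] \notin D 3, [~ x, s', s'] \notin D 4
  & [~ x, s', s', s'] \notin D 5].
Proof.
have c43 : #|D 3| = (2 * #|D 4|)%N by rewrite c3 c4.
have c32 : #|D 2| = (2 * #|D 3|)%N by rewrite c2 c3.
have sol s' : s' \in Gam -> [~ x, s'] \notin D 3 -> [~ z, s'] \notin D 5 ->
    [/\ s' \in Gam, [~ x, s'] \notin D 3, [~ x, s', s'] \notin D 4 & [~ x, s', s', s'] \notin D 5].
  move=> Gs' n3 n5; have D2xs : [~ x, s'] \in D 2 by apply: (@DR 1).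
  have n4 : [~ x, s', s'] \notin D 4.
    have : [~ y, s'] \notin D 4 by rewrite -chain_alpha.
    by apply: contra; apply: comm_indep.
  by split=> //; apply: contra n5; apply: comm_indep => //; apply: DR.
have [g Gg zg] := chain_comm5.
have [xg|xg] := boolP ([~ x, g] \in D 3); last by exists g; apply: sol.
have [zs|zs] := boolP ([~ z, s] \in D 5); last by exists s; apply: sol => //; rewrite Ey.
exists (g * s); apply: sol; first exact: groupM.
  by rewrite commgMJ groupMr ?Ey // DJ.
by rewrite commgMJ groupMl // memJ_norm // (subsetP (dim_norm pr2 nNG 5)).
Qed.

(** The formula for [x^2, s] gives [y, x] = y^-2 [x^2, s]. Since x^s = xy, conjugating y by xs and
    by sxy gives the same element, and comparing the two results determines z^x. *)
Let xz2 : x ^+ 2 \in D 4 -> [/\ y ^ x = y^-1 * [~ x ^+ 2, s], [~ x ^+ 2, s] \in D 5 & z ^ x = z^-1].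
Proof.
move=> x4; pose t := [~ x ^+ 2, s]; have Dt : t \in D 5 by apply: DR.
have D4t : t \in D 4 by apply: (subsetP (Dle _)) Dt.
have yx : y ^ x = y^-1 * t.
  by rewrite conjg_mulR /t rel_y2 expgS expg1 -mulgA mulKg.
split=> //; have [w Dw zx] : exists2 w, w \in D 5 & z ^ x = z * w.
  by exists [~ z, x]; [apply: DRN | rewrite conjg_mulR].
have D4w : w \in D 4 by apply: (subsetP (Dle _)) Dw.
have e1 : (y ^ x) ^ s = y^-1 * t * (z * w).
  rewrite -conjgM (conjgC x s) conjgM ys xs conjgM (conjMg y) yx zx.
  have cyt : commute (y^-1 * t * (z * w)) y.
    apply/commute_sym/commuteM; apply/commuteM.
    - exact/commuteV.
    - exact/commute_sym/D4C.
    - exact/commute_sym/chain_comm.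
    - exact/commute_sym/D4C.
  by apply/conjg_fixP/commgP.
have e2 : (y ^ x) ^ s = z^-1 * y^-1 * t.
  by rewrite yx (conjMg y^-1) conjVg ys invMg (conjg_mulR t) D5G ?mulg1.
rewrite zx; apply: (@mulgI _ y^-1); apply: (@mulIg _ t).
have cyz : y^-1 * z^-1 = z^-1 * y^-1 by rewrite -!invMg chain_comm.
rewrite cyz -e2 e1 -[LHS]mulgA -[RHS]mulgA; congr (_ * _).
by apply/commute_sym/D4C; [exact: D4t | exact: groupM Nz (DN Dw)].
Qed.

(** If x^2 is outside D_4, then x has order 8 and [x, y] lies in D_5 = <x^4>: this leaves C_8 x C_4
    and the group 4. Otherwise x^2 is 1, z^2, y^2 or y^2 z^2. In the first two cases x inverts y and
    z, giving the groups 34 and 35; in the other two y^x = y^-1 z^2, giving the group 32. *)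
Lemma chain_cases : [~ z, s] \notin D 5 ->
  N \isog [set: 'Z_8 * 'Z_4] \/
  [\/ N \isog Grp (a : b : (a ^+ 8, b ^+ 4, a ^ b = a ^+ 5)),
      N \isog Grp (a : b : c : (a ^+ 4, b ^+ 4, [~ a, b], c ^+ 2 = a ^+ 2,
                      a ^ c = a * b ^+ 2, b ^ c = a ^+ 2 * b)),
      N \isog Grp (a : b : c : (a ^+ 4, b ^+ 4, [~ a, b], c ^+ 2, a ^ c = a^-1, b ^ c = b^-1))
    | N \isog Grp (a : b : c : (a ^+ 4, b ^+ 4, [~ a, b], c ^+ 2 = b ^+ 2,
                      a ^ c = a^-1, b ^ c = b^-1))].
Proof.
move=> nzs; have [Dy2 ny2 y2s oy] := chain_y2; have [D5E oz] := dim3_sqr_cycle Dz nz.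
have y4 : y ^+ 4 = 1 by rewrite -oy expg_order.
have z4 : z ^+ 4 = 1 by rewrite -oz expg_order.
have genN (M : {group X}) w : M \subset N -> w \in D 3 -> w \notin D 4 ->
    y \in M -> w \in M -> x \in M -> M = N.
  by move=> sMN *; apply: eq_group_sub => //; apply: (@chain_gen1 _ w).
have [x4|nx4] := boolP (x ^+ 2 \in D 4); last first.
  have xxs : [~ x ^+ 2, s] \notin D 5.
    apply: contra nzs; apply: comm_indep; rewrite ?c3 ?c4 ?chain_x2 //.
  have yx : [~ y, x] \in D 5.
    have : [~ x ^+ 2, s] * (y ^+ 2)^-1 \in D 5.
      by apply: (index2_mem (A := D 4)); rewrite ?Dle ?c4 ?c5 // DR // chain_x2.
    rewrite rel_y2 -(D4C (DRN Dy Nx)) ?groupX // mulgK //.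
  have [D5x ox2] := dim3_sqr_cycle chain_x2 nx4.
  have x8 : x ^+ 8 = 1 by rewrite (expgM x 2 4) -ox2 expg_order.
  have ox : #[x] = 8.
    by apply: (@order_two_power _ x 2) => //; rewrite (expgM x 2 2) dim3_sqr ?chain_x2.
  have NE : <[x]> <*> <[y]> = N.
    congr gval; apply: (@genN (<[x]> <*> <[y]>)%G (x ^+ 2)); rewrite ?chain_x2 //.
    - by rewrite join_subG !cycle_subG Nx.
    - by rewrite mem_gen // inE cycle_id orbT.
    - by rewrite groupX // mem_gen // inE cycle_id.
    - by rewrite mem_gen // inE cycle_id.
  have x4x : x ^+ 4 ^+ 2 = 1 by rewrite -expgM.
  have : [~ x, y] \in D 5 by rewrite -groupV invg_comm.
  rewrite D5x -expgM cycle2g; last first.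
    by rewrite orderXdiv ox.
  rewrite !inE => /orP[]/eqP xy.
    left; have cxy : commute x y by apply/commgP/eqP.
    have dxy := cycle_dprod cxy NE; rewrite cN ox oy in dxy.
    by apply: (isog_prod (dxy erefl)); apply: cycle_isog_Zp.
  right; constructor 1; apply: (S32_4_isoGrp NE) => //.
  by rewrite conjg_mulR xy -expgS.
right; have [yx Dt zx] := xz2 x4.
have x2E : x ^+ 2 = 1 \/ x ^+ 2 = z ^+ 2 \/ x ^+ 2 = y ^+ 2 \/ x ^+ 2 = z ^+ 2 * y ^+ 2.
  have oz2 : #[z ^+ 2] = 2 by rewrite orderXdiv oz.
  have [x5|nx5] := boolP (x ^+ 2 \in D 5).
    by move: x5; rewrite D5E cycle2g // !inE => /orP[]/eqP; auto.
  have : x ^+ 2 * (y ^+ 2)^-1 \in D 5.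
    by apply: (index2_mem (A := D 4)); rewrite ?Dle ?c4 ?c5.
  rewrite D5E cycle2g // !inE => /orP[]/eqP/(canRL (mulgKV _)); rewrite ?mul1g; auto.
have NE : <[y]> <*> <[z]> <*> <[x]> = N.
  congr gval; apply: (@genN (<[y]> <*> <[z]> <*> <[x]>)%G z) => //.
  - by rewrite !join_subG !cycle_subG Ny Nz.
  - by rewrite (subsetP (joing_subl _ _)) // (subsetP (joing_subl _ _)) // cycle_id.
  - by rewrite (subsetP (joing_subl _ _)) // (subsetP (joing_subr _ _)) // cycle_id.
  - by rewrite (subsetP (joing_subr _ _)) // cycle_id.
have cyz : [~ y, z] = 1 by apply/eqP/commgP/commute_sym/chain_comm.
have [x2|[x2|x2E']] := x2E.
- rewrite x2 comm1g mulg1 in yx.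
  by constructor 3; apply: (S32_34_isoGrp NE).
- have yx' : y ^ x = y^-1 by rewrite yx D5G ?mulg1 // x2 D5E cycle_id.
  by constructor 4; apply: (S32_35_isoGrp NE).
have t : [~ x ^+ 2, s] = z ^+ 2.
  have [->|->] := x2E'; first exact: y2s.
  by rewrite commMgJ D5G ?conj1g ?mul1g // D5E cycle_id.
(* With b = z y^-1 the action becomes y^x = y b^2 and b^x = y^2 b, as in the presentation. When x^2
   = y^2 z^2, the third generator is xy instead of x, because (xy)^2 = x^2 z^2 = y^2. *)
constructor 2; rewrite {}t in yx; pose b := z * y^-1.
have cyz' : commute y z by apply/commute_sym/chain_comm.
have czy' : commute z y^-1 by apply/commuteV/commute_sym.
have y2V : y^-1 ^+ 2 = y ^+ 2.
  by apply/eqP; rewrite expgVn eq_invg_mul -expgD y4.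
have z2V : (z ^+ 2)^-1 = z ^+ 2.
  by apply/eqP; rewrite eq_invg_mul -expgD z4.
have b2 : b ^+ 2 = z ^+ 2 * y ^+ 2 by rewrite expgMn // y2V.
have cz2 n : n \in N -> commute (z ^+ 2) n by move=> ?; apply: D4C => //;
  rewrite (subsetP (Dle _) _ (_ : _ \in D 6)) //; apply: (@D2X 3).
have yV : y ^+ 3 = y^-1 by apply/eqP; rewrite eq_sym eq_invg_mul -expgS y4.
have zV : z^-1 * z ^+ 2 = z by rewrite expgS mulKg.
have cb : [~ y, b] = 1.
  by apply/eqP/commgP/commuteM => //; apply/commuteV.
have b4 : b ^+ 4 = 1 by rewrite (expgM b 2 2) b2 D4sq // groupM
  // (subsetP (Dle _) _ (_ : _ \in D 6)) //; apply: (@D2X 3).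
have rel c : y ^ c = y ^ x -> z ^ c = z ^ x -> y ^ c = y * b ^+ 2 /\ b ^ c = y ^+ 2 * b.
  move=> yc zc; have Ny2 : y ^+ 2 \in N by rewrite groupX.
  split; first by rewrite yc yx b2 (cz2 _ Ny2) (mulgA y) -expgS yV.
  rewrite (conjMg z) conjVg yc zc zx yx invMg invgK z2V mulgA zV.
  by rewrite (D4C Dy2 (groupM Nz (groupVr Ny))) -mulgA expgS expg1 mulKg.
have xy2 : (x * y) ^+ 2 = x ^+ 2 * z ^+ 2.
  have K (u v w : X) : u * (u * (v * w^-1)) * w = u * u * v by rewrite !mulgA mulgKV.
  have -> : (x * y) ^+ 2 = x * (y * x) * y by rewrite expgS expg1 !mulgA.
  by rewrite (conjgC y x) yx -(cz2 _ (groupVr Ny)) K [x ^+ 2]expgS expg1.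
have NE' c : c = x \/ c = x * y -> <[y]> <*> <[b]> <*> <[c]> = N.
  move=> cE; pose M := (<[y]> <*> <[b]> <*> <[c]>)%G.
  have My : y \in M by rewrite (subsetP (joing_subl _ _)) // (subsetP (joing_subl _ _)) // cycle_id.
  have Mb : b \in M by rewrite (subsetP (joing_subl _ _)) // (subsetP (joing_subr _ _)) // cycle_id.
  have Mc : c \in M by rewrite (subsetP (joing_subr _ _)) // cycle_id.
  congr gval; apply: (@genN M z) => //.
  - rewrite !join_subG !cycle_subG Ny groupM ?groupV //.
    by case: cE => ->; rewrite ?groupM.
  - by rewrite -(mulgKV y z) groupM.
  - by case: cE => cE; [rewrite -cE | rewrite -(mulgK y x) groupM ?groupV // -cE].
have [x2|x2] := x2E'.
  have [h1 h2] := rel x erefl erefl.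
  by apply: (S32_32_isoGrp (NE' x _)) => //; left.
have fixy u : commute u y -> u ^ y = u by move=> cu; apply/conjg_fixP/commgP.
have [||h1 h2] := rel (x * y).
- rewrite conjgM yx fixy //; apply/commute_sym/commuteM; first exact/commuteV.
  by apply/commute_sym/cz2.
- by rewrite conjgM zx fixy //; apply/commute_sym/commuteV.
apply: (S32_32_isoGrp (NE' (x * y) _)) => //; first by right.
by rewrite xy2 x2 -mulgA -(cz2 _ (groupX 2 Ny)) mulgA -expgD z4 mul1g.
Qed.

End Chain.

Lemma second_pattern :
  [/\ [/\ L 1 = D 2, L 2 = D 3, L 3 = pow_group (D 2) 2 & L 4 = D 5],
      [/\ D 2 \isog [set: 'Z_4 * 'Z_4], D 3 \isog [set: 'Z_4 * 'Z_2] & D 5 \isog [set: 'Z_2]]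
    & N \isog [set: 'Z_8 * 'Z_4] \/
  [\/ N \isog Grp (a : b : (a ^+ 8, b ^+ 4, a ^ b = a ^+ 5)),
      N \isog Grp (a : b : c : (a ^+ 4, b ^+ 4, [~ a, b], c ^+ 2 = a ^+ 2,
                      a ^ c = a * b ^+ 2, b ^ c = a ^+ 2 * b)),
      N \isog Grp (a : b : c : (a ^+ 4, b ^+ 4, [~ a, b], c ^+ 2, a ^ c = a^-1, b ^ c = b^-1))
    | N \isog Grp (a : b : c : (a ^+ 4, b ^+ 4, [~ a, b], c ^+ 2 = b ^+ 2,
                      a ^ c = a^-1, b ^ c = b^-1))]].
Proof.
have [x [s0 [Nx Gs0 n0 m0]]] := chain_exists.
have [s [Gs ny nz ns]] := chain_improve Nx Gs0 erefl erefl n0 m0.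
have Dz : [~ x, s, s] \in D 3 by apply: DR => //; apply: (@DR 1).
have [D5E oz] := dim3_sqr_cycle Dz nz.
have [_ _ _ oy] := chain_y2 Nx Gs erefl erefl nz.
split; [|split|exact: (chain_cases Nx Gs erefl erefl ny nz ns)].
- by rewrite (chain_pow Nx Gs erefl erefl nz); apply: (chain_lower Nx Gs erefl erefl ny nz).
- by apply: (isog_prod (chain_dprod2 Nx Gs erefl erefl ny nz)); apply: cycle_isog_Zp.
- apply: (isog_prod (chain_dprod3 Nx Gs erefl erefl nz)); apply: cycle_isog_Zp => //.
  by rewrite orderXdiv oy.
- by rewrite D5E; apply: cycle_isog_Zp; rewrite orderXdiv oz.
Qed.

End SecondPattern.

(** * The sum of logarithms under conditions (xii) and (xiv) *)

Lemma pow_group_abelian (X : finGroupType) (H : {group X}) k x :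
  abelian H -> x \in pow_group H k -> exists2 y, y \in H & x = y ^+ k.
Proof.
move=> abH; have gS : group_set [set y ^+ k | y in H].
  apply/group_setP; split=> [|_ _ /imsetP[a Ha ->] /imsetP[b Hb ->]].
    by apply/imsetP; exists 1; rewrite ?expg1n.
  apply/imsetP; exists (a * b); first exact: groupM.
  by rewrite expgMn //; apply: (centsP abH).
by rewrite /= (genGid (Group gS)) => /imsetP[y]; exists y.
Qed.

Section SecondPatternConverse.
Variables (X : finGroupType) (N Gam : {group X}).
Hypothesis nNG : Gam \subset 'N(N).
Hypothesis nilN : exists c, iter c (fun H : {group X} => [~: H, Gam]%G) N :=: 1.
Local Notation D := (dim_series N Gam 2).
Local Notation L := (rel_lower N Gam).
Let pr2 : prime 2 := isT.

(** The terms are L 1, L 2, (L 1)^2 and then twice (L 2)^2, so the sum is 5 + 4 + 3 + 2 + 1 + 1. The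
    commutators of (L 1)^2 fall into (L 2)^2 because [y^2, g] = [y, g]^2 in the abelian group L 1,
    and a group of order 2 is centralised by [Gam]. *)
Lemma dim_log_sum_second : #|N| = 32 -> pow_group N 2 \subset L 1 -> abelian (L 1) ->
    #|L 1| = 16 -> {in L 1, forall x, x ^+ 4 = 1} -> #|pow_group (L 1) 2| = 4 ->
    #|L 2| = 8 -> #|pow_group (L 2) 2| = 2 -> L 3 \subset pow_group (L 1) 2 ->
    pow_group (L 1) 2 \subset L 2 ->
  \sum_(j < (2 ^ 5).+1) dim_log N Gam 2 j.+1 = 16.
Proof.
move=> cN sN ab c1 exp4 c1' c2 c2' s3 s2.
have s21 : L 2 \subset L 1 by apply: commSg; rewrite /= commg_subl.
have DS m : 0 < m -> D m.+1 = ([~: D m, Gam] <*> pow_group (D (m %/ 2).+1) 2)%G.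
  exact: dim_seriesS.
have D2 : D 2 = L 1 by rewrite (DS 1%N) //; apply/val_inj/joing_idPl.
have D3 : D 3 = L 2 by rewrite (DS 2) // D2; apply/val_inj/joing_idPl.
have D4 : D 4 = pow_group (L 1) 2 by rewrite (DS 3) // D3 D2; apply/val_inj/joing_idPr.
have s12 : [~: pow_group (L 1) 2, Gam] \subset pow_group (L 2) 2.
  rewrite gen_subG; apply/subsetP=> _ /imset2P[w g /(pow_group_abelian ab)[y Ly ->] Gg ->].
  have L2y : [~ y, g] \in L 2 by apply: mem_commg.
  have L1y : [~ y, g] \in L 1 by apply: subsetP L2y.
  have yE : [~ y, g] ^ y = [~ y, g] by apply/conjg_fixP/commgP/(centsP ab).
  rewrite expgS expg1 commMgJ yE (_ : _ * _ = [~ y, g] ^+ 2) ?mem_pow_group //.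
have D5 : D 5 = pow_group (L 2) 2.
  by rewrite (DS 4) // D4 D3; apply/val_inj/joing_idPr.
have D6 : D 6 = pow_group (L 2) 2.
  rewrite (DS 5) // D5 D3; apply/val_inj/joing_idPr; rewrite -D5 commg_subl dim_norm //.
have D7 : D 7 :=: 1.
  have e1 : pow_group (D 4) 2 :=: 1.
    apply/trivgP; rewrite D4; apply: pow_group_sub => _ /(pow_group_abelian ab)[y Ly ->].
    by rewrite inE -expgM exp4.
  have D6N := dim_sub pr2 nNG 6; have cG : [~: D 6, Gam] :=: 1.
    have sD : [~: D 6, Gam] \subset D 6 by rewrite commg_subl dim_norm.
    have cD : #|D 6| = 2 by rewrite D6.
    have [cC|cC] := leqP 2 #|[~: D 6, Gam]|; last exact: card_le1_trivg.
    have e : [~: D 6, Gam] = D 6 by apply/eqP; rewrite eqEcard sD cD.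
    by rewrite e; apply: (comm_sub_trivial nNG nilN) => //; rewrite e.
  by rewrite (DS 6) //= cG joing1G.
have eE j k : #|D j| = (2 ^ k)%N -> dim_log N Gam 2 j = k.
  by move=> h; rewrite /dim_log h pfactorK.
rewrite (@dim_log_sum_trunc _ _ _ _ 6) // !big_ord_recr big_ord0 /=.
rewrite (eE 1%N 5) // (eE 2 4) ?D2 // (eE 3 3) ?D3 // (eE 4 2) ?D4 //.
by rewrite (eE 5 1%N) ?D5 // (eE 6 1%N) ?D6.
Qed.
End SecondPatternConverse.

(** * Powers and decompositions of abelian groups *)

Section CyclicProducts.
Variable X : finGroupType.
Implicit Types A B H : {group X}.

Lemma isog_prod_inv (S T : finGroupType) H : H \isog [set: S * T] ->
  exists A B, [/\ A \x B = H, A \isog [set: S] & B \isog [set: T]].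
Proof.
rewrite isog_sym => /isogP[f injf fE].
have dT := setX_dprod [set: S] [set: T].
have eT : setX [set: S] [set: T] = [set: S * T] by apply/setP=> -[a b]; rewrite !inE.
rewrite eT in dT.
exists (f @* setX [set: S] 1)%G, (f @* setX 1 [set: T])%G; split.
- by rewrite -fE; apply: injm_dprod; rewrite ?subsetT.
- rewrite isog_sym; apply: isog_trans (isog_setX1 T [set: S]) _.
  by apply: sub_isog; rewrite ?subsetT.
- rewrite isog_sym; apply: isog_trans (isog_set1X S [set: T]) _.
  by apply: sub_isog; rewrite ?subsetT.
Qed.

Lemma Zp_isog_cycle k H : H \isog [set: 'Z_k.+2] -> exists2 a, H :=: <[a]> & #[a] = k.+2.
Proof.
move=> iH; have /cyclicP[a Ha] : cyclic H.
  by rewrite (isog_cyclic iH); apply/cyclicP; exists (zmodp.Zp1 : 'Z_k.+2); apply: zmodp.Zp_cycle.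
by exists a => //; rewrite orderE -Ha (card_isog iH) cardsT card_ord.
Qed.

Lemma pow_group_dprod A B H k : A \x B = H ->
  pow_group A k \x pow_group B k = pow_group H k.
Proof.
case/dprodP=> _ <- cAB tAB; have sA := pow_group_subset A k; have sB := pow_group_subset B k.
rewrite dprodEY.
- apply/eqP; rewrite eqEsubset join_subG; apply/andP; split.
    by apply/andP; split; apply: pow_groupS; rewrite ?mulG_subl ?mulG_subr.
  rewrite gen_subG; apply/subsetP=> _ /imsetP[_ /mulsgP[a b Aa Bb ->] ->].
  rewrite expgMn; last by apply/commute_sym/(centsP cAB).
  by apply: groupM; [apply: (subsetP (joing_subl _ _)) | apply: (subsetP (joing_subr _ _))];
    apply: mem_pow_group.
- by rewrite (subset_trans sB) // (subset_trans cAB) // centS.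
by apply/trivgP; rewrite -tAB setISS.
Qed.

Lemma cycle_prod_facts k l H : H \isog [set: 'Z_k.+2 * 'Z_l.+2] ->
  exists a b, [/\ <[a]> \x <[b]> = H, #[a] = k.+2 & #[b] = l.+2].
Proof.
case/isog_prod_inv=> A [B [dH /Zp_isog_cycle[a Aa oa] /Zp_isog_cycle[b Bb ob]]].
by exists a, b; rewrite -Aa -Bb.
Qed.

Lemma dprod_cycles_abelian (a b : X) H : <[a]> \x <[b]> = H -> abelian H.
Proof. by case/dprodP=> _ <- cab _; rewrite abelianM !cycle_abelian. Qed.

Lemma dprod_cycles_pow (a b : X) H k : <[a]> \x <[b]> = H ->
  <[a ^+ k]> \x <[b ^+ k]> = pow_group H k.
Proof.
by move=> dH; have := @pow_group_dprod <[a]>%G <[b]>%G H k dH; rewrite !pow_group_cycle.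
Qed.

Lemma dprod_cycles_exp (a b : X) H k : <[a]> \x <[b]> = H -> a ^+ k = 1 -> b ^+ k = 1 ->
  {in H, forall x, x ^+ k = 1}.
Proof.
move=> dH ak bk x Hx; apply/set1P; have := mem_pow_group k Hx.
by have /dprodP[_ /= <- _ _] := dprod_cycles_pow k dH; rewrite ak bk cycle1 mulg1.
Qed.

Lemma abelian_pow_gen (S : {set X}) (Q : {group X}) k : abelian <<S>> ->
  {in S, forall x, x ^+ k \in Q} -> pow_group <<S>> k \subset Q.
Proof.
move=> ab hS; have gS : group_set [set w in <<S>> | w ^+ k \in Q].
  apply/group_setP; split=> [|a b]; first by rewrite inE group1 expg1n group1.
  rewrite !inE => /andP[Sa Qa] /andP[Sb Qb]; rewrite groupM // expgMn ?groupM //.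
  exact: (centsP ab).
suff sG : <<S>> \subset Group gS.
  by apply: (@pow_group_sub _ <<S>>%G) => x Sx; have := subsetP sG _ Sx; rewrite inE => /andP[].
by rewrite gen_subG; apply/subsetP=> x Sx; rewrite inE mem_gen ?hS.
Qed.

End CyclicProducts.

(** * Contradictions behind the vacuous conditions *)

Section ImpossibleCases.
Variables (X : finGroupType) (N Gam : {group X}).
Hypothesis nNG : Gam \subset 'N(N).
Hypothesis innN : forall x, x \in N ->
  exists2 c, c \in [~: Gam, Gam] & {in N, forall y, y ^ x = y ^ c}.
Hypothesis nilN : exists c, iter c (fun H : {group X} => [~: H, Gam]%G) N :=: 1.
Local Notation L := (rel_lower N Gam).

Let LS i : L i.+1 \subset L i.
Proof. by elim: i => [|i IH]; [rewrite /= commg_subl | apply: commSg]. Qed.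
Let LN i : L i \subset N.
Proof. by elim: i => // i IH; apply: subset_trans (LS i) IH. Qed.
Let Lnorm i : Gam \subset 'N(L i).
Proof. by case: i => // i; rewrite /= normsR ?normG //; elim: i => //= i IH;
  rewrite normsR ?normG. Qed.
Let LnormN i : N \subset 'N(L i).
Proof. exact: (inner_norm innN (LN i) (Lnorm i)). Qed.
Let LR i x g : x \in L i -> g \in Gam -> [~ x, g] \in L i.+1.
Proof. exact: mem_commg. Qed.
Let LRN i x n : x \in L i -> n \in N -> [~ x, n] \in L i.+2.
Proof. by move=> Lx Nn; apply: (subsetP (comm_inner innN (LN i) (Lnorm i))); apply: mem_commg. Qed.

Let comm_sqr x g : x \in L 1 -> abelian (L 1) -> g \in Gam -> [~ x ^+ 2, g] = [~ x, g] ^+ 2.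
Proof.
move=> Lx ab Gg; have xE : [~ x, g] ^ x = [~ x, g].
  by apply/conjg_fixP/commgP/(centsP ab) => //; apply: (subsetP (LS 1%N)); apply: LR.
by rewrite expgS expg1 commMgJ xE.
Qed.

(** The generators [w, g] of L 2 satisfy [w, g]^2 = [w^2, g] = 1. This is incompatible with the type
    C_4 x C_2 of gamma_4(G) in (vi) to (xi) and (xiii). *)
Lemma rel_lower2_sqr : abelian (L 1) ->
  {in pow_group (L 1) 2 & Gam, forall x g, [~ x, g] = 1} ->
  {in L 2, forall x, x ^+ 2 = 1}.
Proof.
move=> ab h x Lx; have ab2 : abelian (L 2) := abelianS (LS 1%N) ab.
apply/set1P; have := mem_pow_group 2 Lx; apply/subsetP.
apply: (@abelian_pow_gen _ _ [1 X]) => // _ /imset2P[w g Lw Gg ->].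
by rewrite inE -comm_sqr // h // mem_pow_group.
Qed.

Let comm_sqr_mod x g : x \in N -> g \in Gam ->
  exists2 t, t \in L 3 & [~ x ^+ 2, g] = [~ x, g] ^+ 2 * t.
Proof.
move=> Nx Gg; have L1c : [~ x, g] \in L 1 by apply: (@LR 0).
have Lt : [~ [~ x, g], x] \in L 3 by apply: LRN.
exists ([~ [~ x, g], x] ^ [~ x, g]); first
  by rewrite memJ_norm // (subsetP (LnormN 3)) // (subsetP (LN 1%N)).
rewrite expgS expg1 commMgJ conjg_mulR expgS expg1; move: [~ x, g] => c.
by rewrite -mulgA (conjgC _ c) mulgA.
Qed.

(** [x, g]^2 equals [x^2, g] up to an element of L 3, since [L 1, N] is contained in L 3; hence the
    bound on [i]. *)
Lemma rel_lower_pow_sub i : i <= 3 -> abelian (L 1) ->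
  {in N & Gam, forall x g, [~ x ^+ 2, g] \in L i} -> pow_group (L 1) 2 \subset L i.
Proof.
move=> i3 ab h; apply: (abelian_pow_gen ab) => _ /imset2P[x g Nx Gg ->].
have [t Lt e] := comm_sqr_mod Nx Gg; have := h x g Nx Gg; rewrite e groupMr //.
have mono j : L (i + j) \subset L i.
  by elim: j => [|j IH]; rewrite ?addn0 // addnS (subset_trans (LS _)).
by apply: (subsetP (mono (3 - i)%N)); rewrite subnKC.
Qed.

(** If all squares of [N] lie in L 2, then (L 1)^2 is contained in L 3, and 4 <= 2. If some x^2 does
    not, L 1 is generated by x^2 and L 2, whose commutators with [Gam] all fall into (L 1)^2; so L
    2, of order 8, would be contained in a group of order 4. *)
Lemma rel_lower3_card : abelian (L 1) -> pow_group N 2 \subset L 1 ->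
  #|L 1| = 16 -> #|L 2| = 8 -> #|pow_group (L 1) 2| = 4 ->
  L 3 \subset pow_group (L 1) 2 -> #|L 3| <> 2.
Proof.
move=> ab sN c1 c2 cp s3 c3.
have sN' x : x \in N -> x ^+ 2 \in L 1 by move=> Nx; rewrite (subsetP sN) ?mem_pow_group.
have [/exists_inP[x Nx nx]|/exists_inPn h] := boolP [exists x in N, x ^+ 2 \notin L 2]; last first.
  have : pow_group (L 1) 2 \subset L 3.
    apply: rel_lower_pow_sub => // x g Nx Gg; apply: (@LR 2) => //.
    by have := h x Nx; rewrite negbK.
  by move/subset_leq_card; rewrite cp c3.
have Lxg g : g \in Gam -> [~ x ^+ 2, g] \in pow_group (L 1) 2.
  move=> Gg; have [t Lt ->] := comm_sqr_mod Nx Gg.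
  by rewrite groupM //; [apply/mem_pow_group/(@LR 0) | apply: (subsetP s3)].
have : L 2 \subset pow_group (L 1) 2.
  rewrite gen_subG; apply/subsetP=> _ /imset2P[w g Lw Gg ->].
  have L2g v : v \in L 2 -> [~ v, g] \in pow_group (L 1) 2.
    by move=> Lv; rewrite (subsetP s3) // (@LR 2).
  have [L2w|nw] := boolP (w \in L 2); first exact: L2g.
  have Lwx : w * (x ^+ 2)^-1 \in L 2.
    by apply: (index2_mem (A := L 1) (B := L 2)); rewrite ?LS ?c1 ?c2 ?sN'.
  rewrite -(mulgKV (x ^+ 2) w) commMgJ groupM ?Lxg //.
  rewrite memJ_norm ?L2g //; apply: (subsetP (pow_group_norm 2 (normG (L 1)))); exact: sN'.
by move/subset_leq_card; rewrite c2 cp.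
Qed.

(** [x^4, g] is congruent to [x, g]^4 = 1 modulo L 3. Thus [L 1, Gam] is contained in L 3 =
    [L 2, Gam], and nilpotency kills L 2. *)
Lemma pow_group4_comm : pow_group N 4 \subset L 1 ->
  {in L 1, forall x, x ^+ 4 = 1} -> L 1 \subset pow_group N 4 <*> L 2 -> L 2 :=: 1.
Proof.
move=> s4 exp4 sL.
have gS : group_set [set w in L 1 | [forall g in Gam, [~ w, g] \in L 3]].
  apply/group_setP; split=> [|a b].
    by rewrite inE group1; apply/forall_inP=> g _; rewrite comm1g group1.
  rewrite !inE => /andP[La /forall_inP ha] /andP[Lb /forall_inP hb]; rewrite groupM //.
  apply/forall_inP=> g Gg; rewrite commMgJ groupM ?hb // memJ_norm ?ha //.
  by rewrite (subsetP (LnormN 3)) // (subsetP (LN 1%N)).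
suff sG : L 1 \subset Group gS.
  apply: (comm_sub_trivial nNG nilN (LN 2)); rewrite gen_subG.
  apply/subsetP=> _ /imset2P[w g Lw Gg ->].
  by have := subsetP sG _ Lw; rewrite inE => /andP[_ /forall_inP]; apply.
apply: subset_trans sL _; rewrite join_subG; apply/andP; split; last first.
  apply/subsetP=> w Lw; rewrite inE (subsetP (LS 1%N)) //; apply/forall_inP=> g Gg; exact: (@LR 2).
apply: (@pow_group_sub _ N (Group gS)) => x Nx.
have Lx4 : x ^+ 4 \in L 1 by rewrite (subsetP s4) // mem_pow_group.
rewrite inE Lx4; apply/forall_inP=> g Gg; pose d := [~ x, g].
have Ld : d \in L 1 by apply: (@LR 0).
have Lxd : [~ x, d] \in L 3 by rewrite -groupV invg_comm; apply: (@LRN 1).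
have := expgMn_mod 4 (subsetP (LnormN 3) _ Nx) (subsetP (LnormN 3) _ (subsetP (LN 1%N) _ Ld)) Lxd.
by rewrite (exp4 d Ld) mulg1 -conjg_mulR commgEl conjXg.
Qed.

(** A cyclic L 2 of order 4 would contain (L 1)^2, of order 2. The orders of the product and of the
    intersection then give L 1 = N^4 L 2, which [pow_group4_comm] excludes. This refutes (xviii) to
    (xx). *)
Lemma rel_lower2_card : 2.-group N -> #|N| <= 32 -> #|L 1| = 8 -> abelian (L 1) ->
  {in L 1, forall x, x ^+ 4 = 1} -> #|pow_group (L 1) 2| = 2 -> cyclic (L 2) ->
  #|pow_group (L 1) 2 * pow_group N 4| = 4 ->
  #|pow_group (L 1) 2 * pow_group N 4 :&: L 2| = 2 -> #|L 2| <> 4.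
Proof.
move=> pN cN c1 ab exp4 cp /cyclicP[c L2E] cQ cQL c2.
have nL : L 1 <| N by rewrite /normal LN LnormN.
(* The quotient of [N] by L 1 has order at most 4. *)
have s4 : pow_group N 4 \subset L 1.
  apply: pow_group_sub => x Nx; apply: coset_idr; first by rewrite (subsetP (LnormN 1%N)) ?groupX.
  rewrite morphX ?(subsetP (LnormN 1%N)) //; apply/eqP; rewrite -order_dvdn.
  have Nq : coset (L 1) x \in N / L 1 by apply: mem_quotient.
  apply: dvdn_trans (order_dvdG Nq) _; rewrite card_quotient //.
  have : 2.-group (N / L 1) by apply: quotient_pgroup.
  rewrite /pgroup card_quotient // => /p_natP[k ek].
  have := Lagrange (LN 1%N); rewrite c1 ek => e; rewrite (dvdn_exp2l 2 (n := 2)) //.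
  by have := cN; rewrite -e (_ : 32 = 8 * 2 ^ 2)%N // leq_pmul2l // leq_exp2l.
have oc : #[c] = 4 by rewrite orderE -L2E.
have L2c : c \in L 2 by rewrite L2E cycle_id.
have sA : pow_group (L 1) 2 \subset L 2.
  suff <- : <[c ^+ 2]> = pow_group (L 1) 2 by rewrite cycle_subG groupX.
  apply/eqP; rewrite eqEcard cycle_subG mem_pow_group ?(subsetP (LS 1%N)) //.
  by rewrite cp -orderE orderXdiv oc.
have cAB : pow_group N 4 \subset 'C(pow_group (L 1) 2).
  by rewrite (subset_trans s4) // (subset_trans ab) // centS // pow_group_subset.
have := mul_cardG (pow_group (L 1) 2 <*> pow_group N 4)%G (L 2).
rewrite /= (cent_joinEr cAB) cQ cQL c2 => /(congr1 (divn^~ 2)); rewrite mulnK // => cM.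
have ME : pow_group (L 1) 2 * pow_group N 4 * L 2 = L 1.
  by apply/eqP; rewrite eqEcard c1 -cM !mul_subG ?LS ?pow_group_subset.
have L21 : L 2 :=: 1.
  apply: (pow_group4_comm s4 exp4); rewrite -{1}ME !mul_subG ?joing_subr ?joing_subl //.
  by rewrite (subset_trans sA) // joing_subr.
by move: c2; rewrite L21 cards1.
Qed.

End ImpossibleCases.

(** * Groups of order p^2 for odd p *)

Section OddPrime.
Variables (X : finGroupType) (N Gam : {group X}) (p : nat).
Hypothesis pr_p : prime p.
Hypothesis p_gt2 : 2 < p.
Hypothesis nNG : Gam \subset 'N(N).
Hypothesis nilN : exists c, iter c (fun H : {group X} => [~: H, Gam]%G) N :=: 1.
Hypothesis cN : #|N| = (p ^ 2)%N.
Local Notation D := (dim_series N Gam p).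
Local Notation L := (rel_lower N Gam).

Let pN : p.-group N. Proof. by rewrite /pgroup cN pnatX pnat_id. Qed.
Let D2E : D 2 = ([~: N, Gam] <*> pow_group N p)%G.
Proof. by rewrite dim_seriesS // divn_small // (ltn_trans _ p_gt2). Qed.

(** x^p lies in D_p, and p >= 3 puts it into D_3 = 1. So [N] is elementary abelian and D_2 is made
    of commutators alone. *)
Lemma rank2_dim : #|D 2| = p -> D 3 :=: 1 -> L 1 = D 2 /\
  exists a b, [/\ <[a]> \x <[b]> = N, #[a] = p & #[b] = p].
Proof.
move=> c2 D3; have xp x : x \in N -> x ^+ p = 1.
  move=> Nx; apply/set1P; rewrite -[[set 1]]D3; apply: (subsetP (dim_le pr_p nNG p_gt2)).
  by have := dim_pow pr_p pN nNG (m := 1%N) Nx; rewrite muln1.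
split.
  by rewrite D2E; apply/val_inj/esym/joing_idPl/pow_group_sub => x /xp->.
have ordp x : x \in N -> x != 1 -> #[x] = p by move=> Nx x1; apply: nt_prime_order; rewrite ?xp.
have p1 := prime_gt1 pr_p.
have sN (A : {group X}) : #|A| < p ^ 2 -> exists2 v, v \in N & v \notin A.
  move=> cA; apply/exists_inP; apply: contraLR cA => /exists_inPn h.
  rewrite -leqNgt -cN; apply/subset_leq_card/subsetP=> x Nx; by have := h x Nx; rewrite negbK.
have [a Na] : exists2 a, a \in N & a \notin 1%G by apply: sN; rewrite cards1 (ltn_exp2l 0).
rewrite inE => a1; have oa := ordp a Na a1.
have [b Nb ba] : exists2 b, b \in N & b \notin <[a]>%G.
  by apply: sN; rewrite -orderE oa -{1}(expn1 p) ltn_exp2l.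
have ob : #[b] = p by apply: ordp => //; apply: contraNneq ba => ->.
have ab : abelian N by apply: (p2group_abelian pN); rewrite cN pfactorK.
exists a, b; split=> //; apply: cycle_dprod; first exact: (centsP ab).
  have sM : <[a]> <*> <[b]> \subset N by rewrite join_subG !cycle_subG Na.
  have := cardSg sM; rewrite cN => /(dvdn_pfactor _ _ pr_p)[m m2 cM].
  apply/eqP; rewrite eqEcard sM cN cM leq_exp2l // leqNgt ltnS; apply/negP=> m1.
  have : #|<[a]> <*> <[b]>| <= #|<[a]>| by rewrite cM -orderE oa -{2}(expn1 p) leq_exp2l.
  move=> h; have e : <[a]> :=: <[a]> <*> <[b]> by apply/eqP; rewrite eqEcard joing_subl.
  by case/negP: ba; rewrite /= e (subsetP (joing_subr _ _)) ?cycle_id.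
by rewrite cN oa ob.
Qed.

(** D_3 = [D_2, Gam] is a proper subgroup of a group of order p, so only the logarithms 2 and 1
    contribute. *)
Lemma dim_log_sum_rank2 : {in N, forall x, x ^+ p = 1} -> #|L 1| = p ->
  \sum_(j < (p ^ 2).+1) dim_log N Gam p j.+1 = 3.
Proof.
move=> xp c1; have pN1 : pow_group N p \subset [1 X] by apply: pow_group_sub => x /xp->.
have D2 : D 2 = L 1.
  by rewrite D2E; apply/val_inj/joing_idPl; apply: subset_trans pN1 (sub1G _).
have D3 : D 3 :=: 1.
  have -> : D 3 :=: [~: D 2, Gam].
    rewrite dim_seriesS // divn_small //; have pD1 : pow_group (D 1%N) p :=: 1 := trivgP pN1.
    by apply/joing_idPl; rewrite pD1 sub1G.
  have sD : [~: D 2, Gam] \subset D 2 by rewrite commg_subl dim_norm.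
  have := cardSg sD; rewrite D2 c1 => /(primeP pr_p).2/pred2P[]; first exact: card1_trivg.
  move=> cC; have e : [~: L 1, Gam] = L 1 by apply/eqP; rewrite eqEcard cC c1 -D2 sD leqnn.
  by rewrite e; apply: (comm_sub_trivial nNG nilN); rewrite -?D2 ?(dim_sub pr_p nNG) // D2 e.
rewrite (@dim_log_sum_trunc _ _ _ _ 2) //; last first.
  by apply: ltnW; rewrite ltnS (leq_trans (prime_gt1 pr_p)) // -{1}(expn1 p) leq_exp2l // prime_gt1.
have eE j k : #|D j| = (p ^ k)%N -> dim_log N Gam p j = k.
  by move=> h; rewrite /dim_log h pfactorK.
by rewrite !big_ord_recr big_ord0 (eE 1%N 2) // (eE 2 1%N) // D2 c1 expn1.
Qed.

End OddPrime.

Local Close Scope group_scope.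

From mathcomp Require Import finmap monalg.
From mathcomp Require Import boolp classical_sets functions cardinality.

Import GRing.Theory.

Unset Implicit Arguments.

(** * Upper Lie powers as a multiplicative filtration *)

Section UpperLiePowers.
Local Open Scope classical_set_scope.
Local Open Scope ring_scope.
Variable R : pzRingType.
Implicit Types (x y r : R) (J : set R).

(* The paper's index is shifted by one so that the filtration becomes
   multiplicative: [lie_pow a * lie_pow b] lies in [lie_pow (a + b)]. *)
Definition lie_pow (m : nat) : set R := @upper_lie_power R m.+1.

Definition lie_br x y := x * y - y * x.

Lemma lie_pow0 x : lie_pow 0 x. Proof. by []. Qed.

Lemma ideal_genP (A : set R) : two_sided_ideal (ideal_gen A).
Proof.
split.
- by move=> J [[J0 _ _] _].
- by move=> x y Ix Iy J hJ; have [[_ JB _] _] := hJ; apply: JB; [exact: Ix | exact: Iy].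
move=> r x Ix; split=> J hJ; have [[_ _ JM] _] := hJ;
  by have [] := JM r x (Ix _ hJ).
Qed.

Lemma lie_powP m : two_sided_ideal (lie_pow m).
Proof. by case: m => [|m]; [split | exact: ideal_genP]. Qed.

Lemma lie_pow_r0 m : lie_pow m 0. Proof. by have [] := lie_powP m. Qed.

Lemma lie_powB m x y : lie_pow m x -> lie_pow m y -> lie_pow m (x - y).
Proof. by have [_ + _] := lie_powP m; apply. Qed.

Lemma lie_powN m x : lie_pow m x -> lie_pow m (- x).
Proof. by move=> ?; rewrite -sub0r; apply: lie_powB => //; apply: lie_pow_r0. Qed.

Lemma lie_powD m x y : lie_pow m x -> lie_pow m y -> lie_pow m (x + y).
Proof. by move=> mx my; rewrite -[y]opprK; apply/lie_powB/lie_powN. Qed.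

Lemma lie_powMl m r x : lie_pow m x -> lie_pow m (r * x).
Proof. by have [_ _ h] := lie_powP m => /(h r)[]. Qed.

Lemma lie_powMr m r x : lie_pow m x -> lie_pow m (x * r).
Proof. by have [_ _ h] := lie_powP m => /(h r)[]. Qed.

Lemma lie_pow_br m x r : lie_pow m x -> lie_pow m.+1 (lie_br x r).
Proof. by move=> mx J [_ sJ]; apply: sJ; exists x => //; exists r. Qed.

Lemma lie_pow_ind m J : two_sided_ideal J ->
  (forall x r, lie_pow m x -> J (lie_br x r)) -> forall x, lie_pow m.+1 x -> J x.
Proof. by move=> idJ hJ x; apply; split=> // _ [y my [r _ <-]]; apply: hJ. Qed.

Lemma lie_powS m x : lie_pow m.+1 x -> lie_pow m x.
Proof.
apply: lie_pow_ind; first exact: lie_powP.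
by move=> y r my; apply: lie_powB; [exact: lie_powMr | exact: lie_powMl].
Qed.

Lemma lie_pow_le k m x : (k <= m)%N -> lie_pow m x -> lie_pow k x.
Proof.
move=> /subnKC <-; elim: (m - k)%N => [|j IH]; first by rewrite addn0.
by rewrite addnS => /lie_powS.
Qed.

(** Induction on [b] through x [u, r] = [xu, r] - [x, r] u. *)
Lemma lie_powM a b x y : lie_pow a x -> lie_pow b y -> lie_pow (a + b) (x * y).
Proof.
elim: b a x y => [|b IH] a x y ax; first by rewrite addn0 => _; apply: lie_powMr.
move=> by'; move: y by' a x ax; apply: lie_pow_ind.
  split=> [a x _|u v Ju Jv a x ax|r u Ju].
  - by rewrite mulr0; apply: lie_pow_r0.
  - by rewrite mulrBr; apply: lie_powB; [apply: Ju | apply: Jv].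
  split=> a x ax; first by rewrite mulrA; apply/Ju/lie_powMr.
  by rewrite mulrA; apply/lie_powMr/Ju.
move=> u r bu a x ax; rewrite addnS.
have -> : x * lie_br u r = lie_br (x * u) r - lie_br x r * u.
  by rewrite /lie_br mulrBr mulrBl !mulrA opprB addrA addrNK.
apply: lie_powB; first by apply: lie_pow_br; apply: IH.
by rewrite -addSn; apply: IH => //; apply: lie_pow_br.
Qed.

Lemma lie_powX a k x : lie_pow a x -> lie_pow (a * k) (x ^+ k).
Proof.
move=> ax; elim: k => [|k IH]; first by rewrite muln0; apply: lie_pow0.
by rewrite exprS mulnS; apply: lie_powM.
Qed.

Lemma lie_brBr x u v : lie_br x (u - v) = lie_br x u - lie_br x v.
Proof.
by rewrite /lie_br mulrBr mulrBl !opprB !addrA [LHS](ACl (1*4*3*2)).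
Qed.

Lemma lie_brMr x u v : lie_br x (u * v) = lie_br x u * v + u * lie_br x v.
Proof. by rewrite /lie_br mulrBr mulrBl !mulrA addrA addrNK. Qed.

Lemma lie_brMl_comm a x r : a * r = r * a -> lie_br (a * x) r = a * lie_br x r.
Proof. by move=> ar; rewrite /lie_br mulrBr !mulrA ar. Qed.

Lemma lie_brD x u v : lie_br x (u + v) = lie_br x u + lie_br x v.
Proof. by rewrite /lie_br mulrDr mulrDl opprD addrACA. Qed.

Lemma lie_brDl x u v : lie_br (x + u) v = lie_br x v + lie_br u v.
Proof. by rewrite /lie_br mulrDr mulrDl opprD addrACA. Qed.

Lemma lie_brBl x u v : lie_br (x - u) v = lie_br x v - lie_br u v.
Proof. by rewrite /lie_br mulrBr mulrBl !opprB addrACA [RHS]addrACA; congr (_ + _);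
  apply: addrC. Qed.

Lemma lie_swap x u v : x * u * v = x * v * u + x * lie_br u v.
Proof. by rewrite /lie_br mulrBr !mulrA addrC subrK. Qed.

Lemma lie_brMl u v r : lie_br (u * v) r = lie_br u r * v + u * lie_br v r.
Proof. by rewrite /lie_br mulrBr mulrBl !mulrA [RHS]addrC addrA subrK. Qed.

Lemma sub_mul_swap x y z r : x * r - y * r * z = (x - y * z) * r + y * lie_br z r.
Proof. by rewrite /lie_br mulrBl mulrBr !mulrA addrA subrK. Qed.

Lemma lie_br_sub_mul x y z r :
  lie_br x r - lie_br y r * z = lie_br (x - y * z) r + y * lie_br z r.
Proof. by rewrite lie_brBl lie_brMl opprD addrA subrK. Qed.

Lemma lie_br_jacobi x u r :
  lie_br x (lie_br u r) = lie_br (lie_br x u) r - lie_br (lie_br x r) u.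
Proof.
rewrite /lie_br !mulrBr !mulrBl !mulrA !opprB !addrA.
by rewrite [RHS](ACl (1*8*3*6*(2*5)*(4*7))) /= !addNr !addr0.
Qed.

(** Induction on [b] through the Jacobi identity. The ideal [J] also records membership in the
    power, because [x, ru] = [x, r] u + r [x, u] uses the degree of u itself. *)
Lemma lie_pow_brM a b x y :
  lie_pow a x -> lie_pow b y -> lie_pow (a + b).+1 (lie_br x y).
Proof.
elim: b a x y => [|b IH] a x y ax; first by rewrite addn0 => _; apply: lie_pow_br.
pose J : set R := fun y => lie_pow b.+1 y /\
  forall a x, lie_pow a x -> lie_pow (a + b.+1).+1 (lie_br x y).
suff hJ : forall y, lie_pow b.+1 y -> J y by move=> /hJ[_]; apply.
apply: lie_pow_ind.
  split.
  - split=> [|c z _]; first exact: lie_pow_r0.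
    by rewrite /lie_br mulr0 mul0r subr0; apply: lie_pow_r0.
  - move=> u v [bu Ju] [bv Jv]; split=> [|c z cz]; first exact: lie_powB.
    by rewrite lie_brBr; apply: lie_powB; [apply: Ju | apply: Jv].
  move=> r u [bu Ju]; split; split=> [|c z cz]; try exact: lie_powMl;
    try exact: lie_powMr; rewrite lie_brMr; apply: lie_powD.
  - by rewrite -addSn; apply: lie_powM => //; apply: lie_pow_br.
  - by apply: lie_powMl; apply: Ju.
  - by apply: lie_powMr; apply: Ju.
  by rewrite addnC -addnS; apply: lie_powM; last exact: lie_pow_br.
move=> u r bu; split=> [|c z cz]; first exact: lie_pow_br.
rewrite lie_br_jacobi addnS; apply: lie_powB; first by apply: lie_pow_br; apply: IH.
by rewrite -addSn; apply: IH => //; apply: lie_pow_br.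
Qed.

End UpperLiePowers.

Set Implicit Arguments.
Local Open Scope ring_scope.

(** [lie_pow R M] is the upper Lie power of index M + 1, so the first one to vanish has index M +
    2. *)
Lemma upper_lie_indexE (R : pzRingType) M x :
    lie_pow R M x -> x <> 0 -> (forall y, lie_pow R M.+1 y -> y = 0) ->
  upper_lie_index R = M.+2.
Proof.
move=> Mx x0 M1; apply: xget_unique.
  split=> //.
    by rewrite predeqE => y; split=> [/M1 //|->]; exact: (@lie_pow_r0 R M.+1).
  case=> // m _ m0; rewrite ltnS ltnNge; apply/negP => mM; apply: x0.
  have : [set 0]%classic x by rewrite -m0; apply: lie_pow_le Mx.
  by [].
move=> y [y0 yz ymin]; apply/eqP; rewrite eqn_leq ymin //=; last first.
  by rewrite predeqE => z; split=> [/M1 //|->]; exact: (@lie_pow_r0 R M.+1).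
case: y y0 yz {ymin} => // m _ m0; rewrite ltnS ltnNge; apply/negP => mM; apply: x0.
have : [set 0]%classic x by rewrite -m0; apply: lie_pow_le Mx.
by [].
Qed.

(** * Group elements inside the group algebra *)

Section GroupAlgebraUnits.
Variables (K : fieldType) (G : groupType).
Local Notation KG := (group_algebra K G).
Implicit Types (g h : G) (a b : K).

Definition ga_single a g : KG := << a *g g >>.
Definition ga_unit g : KG := ga_single 1 g.

Lemma ga_singleM a b g h :
  ga_single a g * ga_single b h = ga_single (a * b) (g * h)%g.
Proof.
rewrite {1}/GRing.mul /= /ga_mul /ga_single.
rewrite !msuppU; case: (eqVneq a 0) => [->|a0].
  by rewrite big_seq_fset0 mul0r monalgU0.
case: (eqVneq b 0) => [->|b0].
  by rewrite big_seq_fset1 big_seq_fset0 mulr0 monalgU0.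
by rewrite !big_seq_fset1 !mcoeffUU.
Qed.

Lemma ga_unitM g h : ga_unit (g * h)%g = ga_unit g * ga_unit h.
Proof. by rewrite ga_singleM mulr1. Qed.

Lemma ga_unit1 : ga_unit 1%g = 1. Proof. by []. Qed.

Lemma ga_ind (P : KG -> Prop) :
    (forall x y, P x -> P y -> P (x + y)) -> (forall a g, P (ga_single a g)) ->
  forall x, P x.
Proof.
move=> PD PU x; rewrite (monalgE x); elim/big_ind: _ => [||k _]; last exact: PU.
  by have := PU 0 1%g; rewrite /ga_single monalgU0.
exact: PD.
Qed.

Lemma ga_unit_conj g a h : ga_unit g * ga_single a h = ga_single a h * ga_unit (g ^ h)%g.
Proof. by rewrite !ga_singleM mul1r mulr1 conjgE mulKVg. Qed.

Lemma ga_br_unit g a h :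
  lie_br _ (ga_unit g) (ga_single a h) =
    ga_single a (h * g)%g * (ga_unit [~ g, h]%g - 1).
Proof.
rewrite /lie_br mulrBr mulr1 !ga_singleM mul1r !mulr1; congr (ga_single _ _ - _).
exact: commgC.
Qed.

Lemma ga_pchar p : p \in [pchar K] -> p \in [pchar KG].
Proof.
move=> pK; rewrite !inE (pcharf_prime pK) /=; apply/eqP.
have -> : (p%:R : KG) = ga_single p%:R 1%g.
  elim: p {pK} => [|m IH]; first by rewrite /ga_single monalgU0.
  by rewrite -!natr1 IH /ga_single monalgUD.
by rewrite (pcharf0 pK) /ga_single monalgU0.
Qed.

Lemma ga_unitX g k : ga_unit (g ^+ k)%g = ga_unit g ^+ k.
Proof. by elim: k => // k IH; rewrite expgS exprS ga_unitM IH. Qed.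

Lemma ga_unit_pow p g : p \in [pchar K] -> (ga_unit g - 1) ^+ p = ga_unit (g ^+ p)%g - 1.
Proof.
move=> /ga_pchar pK; rewrite -(pFrobenius_autE pK) pFrobenius_autB_comm; last exact: commr1.
by rewrite !pFrobenius_autE expr1n ga_unitX.
Qed.

(** The scalars as a ring morphism, so that polynomials over K can be evaluated at a group
    element. *)
Definition ga_const a : KG := ga_single a 1%g.

Fact ga_const_additive : zmod_morphism ga_const.
Proof. by move=> a b; rewrite /ga_const /ga_single monalgUB. Qed.
Fact ga_const_multiplicative : monoid_morphism ga_const.
Proof. by split=> // a b; rewrite /ga_const ga_singleM mulg1. Qed.
HB.instance Definition _ := GRing.isZmodMorphism.Build K KG ga_const ga_const_additive.
HB.instance Definition _ := GRing.isMonoidMorphism.Build K KG ga_const ga_const_multiplicative.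

(** Multiplied by X - 1, both polynomials become X^p - 1 in characteristic p. The cancellation takes
    place in K[X], since g - 1 may be a zero divisor in KG. *)
Lemma ga_unit_geom p g : p \in [pchar K] ->
  \sum_(i < p) ga_unit g ^+ i = (ga_unit g - 1) ^+ p.-1.
Proof.
move=> pK; have p_pr := pcharf_prime pK; have p0 := prime_gt0 p_pr.
have pX : p \in [pchar {poly K}] by rewrite pchar_poly.
have E : \sum_(i < p) 'X^i = ('X - 1) ^+ p.-1 :> {poly K}.
  have X0 : 'X - 1 != 0 :> {poly K} by rewrite -[1]/(1%:P) polyXsubC_eq0.
  apply: (mulfI X0); rewrite -subrX1 -exprS prednK //.
  by rewrite -!(pFrobenius_autE pX) rmorphB rmorph1.
have cg : commr_rmorph ga_const (ga_unit g).
  by move=> a; rewrite /GRing.comm /ga_const !ga_singleM mulr1 mul1r mulg1 mul1g.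
have := congr1 (horner_morph cg) E; rewrite rmorph_sum rmorphXn rmorphB rmorph1 /=.
rewrite horner_morphX => <-; apply: eq_bigr => i _.
by rewrite rmorphXn /= horner_morphX.
Qed.

End GroupAlgebraUnits.

Import fintype.

(* [N] is a copy of the commutator subgroup, [Gam] of the group of automorphisms
   that conjugation induces on it. *)
Record derived_model (G : groupType) (X : finGroupType) (N Gam : {group X})
    (e : X -> G) (phi : G -> X) : Prop := DerivedModel {
  dm_morph : {in N &, {morph e : x y / (x * y)%g}};
  dm_inj : {in N &, injective e};
  dm_der : forall g h, exists2 x, x \in N & e x = [~ g, h]%g;
  dm_gamma2 : forall g, lower_central G 2 g <-> exists2 x, x \in N & e x = g;
  dm_act : forall x g, x \in N -> e (x ^ phi g)%g = (e x ^ g)%g;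
  dm_phi : forall g, phi g \in Gam;
  dm_phi_surj : forall c, c \in Gam -> exists g, phi g = c;
  dm_norm : Gam \subset ('N(N))%g;
  dm_inner : forall x, x \in N -> exists2 c, c \in [~: Gam, Gam]%g &
    {in N, forall y, (y ^ x = y ^ c)%g}
}.

(** * The index as a sum of logarithms of orders *)

Section Jennings.
Variables (K : fieldType) (p : nat) (G : groupType) (X : finGroupType).
Variables (N Gam : {group X}) (e : X -> G) (phi : G -> X).
Hypothesis model : derived_model N Gam e phi.
Hypothesis pK : p \in [pchar K].
Hypothesis pN : (p.-group N)%g.
Hypothesis nilN : exists c, iter c (fun H : {group X} => [~: H, Gam]%G) N :=: 1%g.

Local Notation KG := (group_algebra K G).
Local Notation I := (lie_pow KG).
Local Notation D := (dim_series N Gam p).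
Local Notation br := (lie_br KG).

Let pr_p : prime p := pcharf_prime pK.
Let nNG := dm_norm model.
Let innN := dm_inner model.
Let sDN m : D m \subset N := dim_sub pr_p nNG m.
Let DN m h : h \in D m -> h \in N. Proof. exact: (subsetP (sDN m)). Qed.

Let u (x : X) : KG := ga_unit K (e x).

Let e1 : e 1%g = 1%g.
Proof.
have := dm_morph model (group1 N) (group1 N); rewrite mulg1 => h.
by apply: (@mulIg _ (e 1%g)); rewrite mul1g -h.
Qed.

Let eV x : x \in N -> e x^-1%g = (e x)^-1%g.
Proof.
move=> Nx; apply/esym/mulg1_eq.
by rewrite -(dm_morph model) ?groupV // mulgV e1.
Qed.

Let eR x g : x \in N -> e [~ x, phi g]%g = [~ e x, g]%g.
Proof.
move=> Nx; rewrite !commgEl (dm_morph model) ?groupV ?eV ?(dm_act model) //.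
by rewrite memJ_norm // (subsetP nNG) // (dm_phi model).
Qed.

Let u1 : u 1%g = 1. Proof. by rewrite /u e1. Qed.
Let uM x y : x \in N -> y \in N -> u (x * y)%g = u x * u y.
Proof. by move=> Nx Ny; rewrite /u (dm_morph model) // ga_unitM. Qed.
Let uX x k : x \in N -> u (x ^+ k)%g = u x ^+ k.
Proof.
by move=> Nx; elim: k => [|k IH]; rewrite ?u1 // expgS exprS uM ?groupX // IH.
Qed.
Let u_pow x : x \in N -> (u x - 1) ^+ p = u (x ^+ p)%g - 1.
Proof. by move=> Nx; rewrite uX // /u ga_unit_pow // ga_unitX. Qed.

Let uM1 x y : x \in N -> y \in N ->
  u (x * y)%g - 1 = (u x - 1) * (u y - 1) + (u x - 1) + (u y - 1).
Proof.
move=> Nx Ny; rewrite uM // -[in LHS](subrK 1 (u x)) -[in LHS](subrK 1 (u y)).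
by rewrite mulrDl mulrDr mulr1 mul1r addrA addrK.
Qed.

Let conjD m h g : h \in D m -> (h ^ phi g)%g \in D m.
Proof. by move=> Dh; rewrite memJ_norm // (subsetP (dim_norm pr_p nNG m)) // (dm_phi model). Qed.

Let commD m h g : h \in D m -> [~ h, phi g]%g \in D m.+1.
Proof. by move=> Dh; apply: dim_commg => //; apply: dm_phi model _. Qed.

Let u_single h (a : K) g : h \in N ->
  u h * ga_single a g = ga_single a g * u (h ^ phi g)%g.
Proof. by move=> Nh; rewrite /u (dm_act model) // ga_unit_conj. Qed.

Let br_single h (a : K) g : h \in N ->
  br (u h) (ga_single a g) = ga_single a (g * e h)%g * (u [~ h, phi g]%g - 1).
Proof. by move=> Nh; rewrite /u ga_br_unit eR. Qed.

(** [x, g] - 1 is a unit times the Lie commutator of x - 1 with g, and x^p - 1 = (x - 1)^p, where p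
    (floor(m/p) + 1) >= m + 1; so the claim follows the recursion. *)
Lemma dim_lie m h : h \in D m -> I m (u h - 1).
Proof.
elim/ltn_ind: m h => -[|m] IH h; first by move=> _; apply: lie_pow0.
pose S k := [set x in N | `[< I k (u x - 1) >]].
have gS k : group_set (S k).
  apply/group_setP; split=> [|x y].
    by rewrite inE group1; apply/asboolP; rewrite u1 subrr; apply: lie_pow_r0.
  rewrite !inE => /andP[Nx /asboolP hx] /andP[Ny /asboolP hy].
  rewrite groupM //; apply/asboolP; rewrite uM1 //.
  by apply: lie_powD => //; apply: lie_powD => //; apply: lie_powMl.
suff sS : D m.+1 \subset Group (gS m.+1).
  by move/(subsetP sS); rewrite inE => /andP[_ /asboolP].
case: m IH => [|m] IH.
  (* The series starts at the whole of G', whose elements are products of commutators of G; the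
     definition of gamma_2(G) as a smallest subgroup is used here. *)
  apply/subsetP=> x Nx; rewrite inE Nx /=; apply/asboolP.
  have : lower_central G 2 (e x) by rewrite (dm_gamma2 model); exists x.
  move/(_ (fun g => I 1 (ga_unit K g - 1))); apply; split.
    split=> [|a b Ia Ib|a Ia]; first by rewrite ga_unit1 subrr; apply: lie_pow_r0.
      have -> : ga_unit K (a * b)%g - 1 = ga_unit K a * (ga_unit K b - 1) + (ga_unit K a - 1).
        by rewrite ga_unitM mulrBr mulr1 addrA addrNK.
      by apply: lie_powD => //; apply: lie_powMl.
    have -> : ga_unit K a^-1%g - 1 = - (ga_unit K a^-1%g * (ga_unit K a - 1)).
      by rewrite mulrBr mulr1 -ga_unitM mulVg ga_unit1 opprB.
    by apply/lie_powN/lie_powMl.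
  move=> _ [a _ [b _ <-]].
  have -> : ga_unit K [~ a, b]%g - 1 =
      ga_unit K (b * a)^-1%g * br (ga_unit K a) (ga_unit K b).
    by rewrite ga_br_unit mulrA -ga_unitM mulVg mul1r.
  by apply/lie_powMl; apply: lie_pow_br; apply: lie_pow0.
rewrite dim_seriesS // join_subG; apply/andP; split.
  rewrite gen_subG; apply/subsetP=> _ /imset2P[x c Dx Gc ->].
  have [g <-] := dm_phi_surj model Gc; have Nx := DN Dx.
  rewrite inE (DN (commD g Dx)) /=; apply/asboolP.
  have -> : u [~ x, phi g]%g - 1 = ga_unit K (g * e x)^-1%g * br (u x) (ga_unit K g).
    by rewrite br_single // mulrA -ga_unitM mulVg mul1r.
  apply: lie_powMl.
  have -> : br (u x) (ga_unit K g) = br (u x - 1) (ga_unit K g).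
    by rewrite /lie_br mulrBl mulrBr mul1r mulr1 opprB addrA addrNK.
  by apply: lie_pow_br; apply: IH.
apply: pow_group_sub => x Dx; rewrite inE groupX ?(DN Dx) //=; apply/asboolP.
rewrite -u_pow ?(DN Dx) //.
apply: (@lie_pow_le _ _ ((m.+1 %/ p).+1 * p)); first by rewrite ltn_ceil // prime_gt0.
by apply: lie_powX; apply: IH => //; rewrite ltnS ltn_Pdiv // prime_gt1.
Qed.

(* The span of the products r (h_1 - 1) ... (h_k - 1) with h_j in B of weight
   i_j and i_1 + ... + i_k at least m. *)
Inductive prod_span (B : {set X}) : nat -> KG -> Prop :=
| PsBase r : prod_span B 0 r
| PsMul m i x h : prod_span B m x -> h \in B -> h \in D i ->
    prod_span B (m + i) (x * (u h - 1))
| PsLe m k x : (k <= m)%N -> prod_span B m x -> prod_span B k x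
| PsSub m x y : prod_span B m x -> prod_span B m y -> prod_span B m (x - y).

Lemma prod_span_lie B m x : prod_span B m x -> I m x.
Proof.
elim=> {m x} [r|m i x h _ Ix _ Dh|m k x km _ Ix|m x y _ Ix _ Iy].
- exact: lie_pow0.
- by apply: lie_powM => //; apply: dim_lie.
- exact: lie_pow_le Ix.
exact: lie_powB.
Qed.

Lemma prod_span0 (B : {group X}) m : prod_span B m 0.
Proof.
have := PsMul (PsBase B 0) (group1 B) (group1 (D m)).
by rewrite mul0r add0n.
Qed.

Lemma prod_spanN (B : {group X}) m x : prod_span B m x -> prod_span B m (- x).
Proof. by move=> ?; rewrite -sub0r; apply: PsSub => //; apply: prod_span0. Qed.

Lemma prod_spanD (B : {group X}) m x y :
  prod_span B m x -> prod_span B m y -> prod_span B m (x + y).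
Proof. by move=> ? ?; rewrite -[y]opprK; apply/PsSub/prod_spanN. Qed.

Lemma prod_span_mull B m r x : prod_span B m x -> prod_span B m (r * x).
Proof.
elim=> {m x} [s|m i x h _ IH Bh Dh|m k x km _ IH|m x y _ IHx _ IHy].
- exact: PsBase.
- by rewrite mulrA; apply: PsMul.
- exact: PsLe IH.
by rewrite mulrBr; apply: PsSub.
Qed.

Let br_singles (a b : K) g h : prod_span N 1 (br (ga_single a g) (ga_single b h)).
Proof.
have -> : ga_single a g = ga_single a 1%g * ga_unit K g by rewrite ga_singleM mulr1 mul1g.
have -> : br (ga_single a 1%g * ga_unit K g) (ga_single b h) =
    ga_single a 1%g * br (ga_unit K g) (ga_single b h).
  by apply: lie_brMl_comm; rewrite !ga_singleM mulrC mulg1 mul1g.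
rewrite ga_br_unit mulrA; have [x Nx <-] := dm_der model g h.
by have := PsMul (PsBase N (ga_single a 1%g * ga_single b (h * g)%g)) Nx (Nx : x \in D 1).
Qed.

(** The two claims need each other: a bracket with x (h - 1) involves right multiples of x. Moving g
    past h - 1 replaces h by a conjugate of the same weight, and the bracket creates a factor [h, g]
    - 1 of weight one higher. *)
Lemma prod_span_br m x : prod_span N m x ->
  (forall s, prod_span N m (x * s)) /\ (forall s, prod_span N m.+1 (br x s)).
Proof.
elim=> {m x} [r|m i x h Px [IH1 IH2] Nh Dh|m k x km _ [IH1 IH2]|m x y _ [IHx1 IHx2] _ [IHy1 IHy2]].
- split=> s; first exact: PsBase.
  elim/ga_ind: s => [s t Ps Pt|b h]; first by rewrite lie_brD; apply: prod_spanD.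
  elim/ga_ind: r => [r t Pr Pt|a g]; first by rewrite lie_brDl; apply: prod_spanD.
  exact: br_singles.
- have swap (a : K) g : (u h - 1) * ga_single a g = ga_single a g * (u (h ^ phi g)%g - 1).
    by rewrite mulrBl mulrBr mul1r mulr1 u_single.
  split=> s.
    elim/ga_ind: s => [s t Ps Pt|a g]; first by rewrite mulrDr; apply: prod_spanD.
    rewrite -mulrA swap mulrA; apply: PsMul; rewrite ?conjD //.
    exact: DN (conjD _ Dh).
  elim/ga_ind: s => [s t Ps Pt|a g]; first by rewrite lie_brD; apply: prod_spanD.
  have -> : br (x * (u h - 1)) (ga_single a g) =
      x * ga_single a g * u h * (u [~ h, phi g]%g - 1) + br x (ga_single a g) * (u h - 1).
    rewrite {1}/lie_br -[in LHS]mulrA swap.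
    have -> : u (h ^ phi g)%g - 1 = u h * (u [~ h, phi g]%g - 1) + (u h - 1).
      rewrite mulrBr mulr1 -uM ?(DN (commD _ Dh)) // -conjg_mulR.
      by rewrite addrA addrNK.
    by rewrite mulrA mulrDr mulrA -addrA; congr (_ + _); rewrite /lie_br mulrBl !mulrA.
  apply: prod_spanD; last by rewrite -addSn; apply: PsMul.
  rewrite -addnS; apply: PsMul (commD _ Dh); last exact: DN (commD _ Dh).
  by rewrite -mulrA; apply: IH1.
- by split=> s; [apply: PsLe (IH1 s) | apply: PsLe (IH2 s)].
split=> s; first by rewrite mulrBl; apply: PsSub.
rewrite lie_brBl; exact: PsSub.
Qed.

Lemma lie_prod_span m x : I m x -> prod_span N m x.
Proof.
elim: m x => [|m IH] x; first by move=> _; apply: PsBase.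
apply: lie_pow_ind; first split.
- exact: prod_span0.
- by move=> y z; apply: PsSub.
- by move=> r y Py; split; [apply: prod_span_mull | apply: (prod_span_br Py).1].
by move=> y r /IH /prod_span_br[_]; apply.
Qed.

Section ChainStep.
Variables (A B : {group X}) (w : nat) (g : X).
Hypothesis sBA : B \subset A.
Hypothesis sAD : A \subset D w.
Hypothesis sDB : D w.+1 \subset B.
Hypothesis w_gt0 : (0 < w)%N.
Hypothesis cardA : (#|A| = p * #|B|)%N.
Hypothesis Ag : g \in A.
Hypothesis nBg : g \notin B.

Let AN h : h \in A -> h \in N. Proof. by move/(subsetP sAD)/DN. Qed.
Let BN h : h \in B -> h \in N. Proof. by move/(subsetP sBA)/AN. Qed.
Let Ng : g \in N := AN Ag.
Let Dg : g \in D w := subsetP sAD _ Ag.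

Lemma chain_step_pow : (g ^+ p)%g \in B.
Proof.
apply: (subsetP sDB); have := dim_pow pr_p pN nNG Dg.
by apply: subsetP; apply: dim_le => //; rewrite ltn_Pmull // prime_gt1.
Qed.

Lemma chain_step_coset h : h \in A -> exists2 k, (k < p)%N & exists2 b, b \in B & h = (g ^+ k *
  b)%g.
Proof.
have nBA : A \subset ('N(B))%g.
  rewrite -commg_subr; apply: subset_trans sDB; apply: subset_trans (dim_comm pr_p nNG w).
  rewrite commGC; apply: subset_trans (commSg _ (subset_trans sBA sAD)) _.
  rewrite gen_subG; apply/subsetP=> _ /imset2P[x y Dx Ay ->].
  have [c Gc cE] := innN (AN Ay); rewrite commgEl cE ?(DN Dx) // -commgEl mem_commg //.
  by apply: subsetP Gc; rewrite commg_subl normG.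
have sgA : (<[g]> * B \subset A)%g by rewrite mul_subG // cycle_subG.
have ngB : <[g]>%g \subset ('N(B))%g by rewrite cycle_subG (subsetP nBA).
have eA : (<[g]> * B)%g = A.
  apply/eqP; rewrite -norm_joinEl //; rewrite -norm_joinEl // in sgA.
  rewrite eqEcard sgA /= cardA.
  have sB : B \subset (<[g]> <*> B)%G by rewrite joing_subr.
  rewrite -(Lagrange sB) mulnC leq_mul2l; apply/orP; right.
  have d : (#|(<[g]> <*> B)%G : B|%g %| p)%N.
    have : (#|B| * #|(<[g]> <*> B)%G : B|%g %| #|A|)%N by rewrite (Lagrange sB) cardSg.
    by rewrite cardA mulnC dvdn_pmul2r.
  have [_ hp] := primeP pr_p; move/hp: d => /pred2P[/eqP|-> //]; rewrite indexg_eq1 => sgB.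
  by case/negP: nBg; apply: (subsetP sgB); rewrite (subsetP (joing_subl _ _)) ?cycle_id.
rewrite -eA => /mulsgP[_ b /cycleP[k ->] Bb ->].
exists (k %% p)%N; first by rewrite ltn_mod prime_gt0.
exists ((g ^+ p) ^+ (k %/ p) * b)%g; first by rewrite groupM //; apply/groupX/chain_step_pow.
by rewrite mulgA -expgM -expgD mulnC addnC -divn_eq.
Qed.

(* prod_span A, with the factors g - 1 moved to the right; modulo one more power
   all factors commute. *)
Inductive coset_span : nat -> KG -> Prop :=
| CsLie m x : I m.+1 x -> coset_span m x
| CsMon m a c y : prod_span B a y -> (c < p)%N -> (m <= a + c * w)%N ->
    coset_span m (y * (u g - 1) ^+ c)
| CsSub m x y : coset_span m x -> coset_span m y -> coset_span m (x - y).

Lemma coset_spanD m x y : coset_span m x -> coset_span m y -> coset_span m (x + y).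
Proof.
move=> Sx Sy; rewrite -[y]opprK; apply: CsSub => //; rewrite -sub0r.
by apply: CsSub => //; apply/CsLie/lie_pow_r0.
Qed.

Lemma coset_span_le k m x : (k <= m)%N -> coset_span m x -> coset_span k x.
Proof.
move=> km Sx; elim: Sx km => {m x} [m x Ix|m a c y Py cp le|m x y _ IHx _ IHy] km.
- by apply: CsLie; apply: lie_pow_le Ix.
- by apply: CsMon Py cp _; apply: leq_trans le.
by apply: CsSub; [apply: IHx | apply: IHy].
Qed.

(** Moving h - 1 to the left of (g - 1)^c costs a bracket of weight wc + i + 1, which falls into the
    next upper Lie power. *)
Lemma coset_span_mulB m i x h : h \in B -> h \in D i -> coset_span m x ->
  coset_span (m + i) (x * (u h - 1)).
Proof.
move=> Bh Dh; elim=> {m x} [m x Ix|m a c y Py cp le|m x y _ IHx _ IHy].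
- by apply: CsLie; rewrite -addSn; apply: lie_powM => //; apply: dim_lie.
- rewrite lie_swap.
  apply: coset_spanD.
    by apply: CsMon cp _; [apply: PsMul Py Bh Dh | rewrite addnAC leq_add2r].
  apply: CsLie; apply: (@lie_pow_le _ _ (a + (w * c + i).+1)).
    by rewrite addnS ltnS addnA leq_add2r mulnC.
  apply: lie_powM; first exact: prod_span_lie Py.
  by apply: lie_pow_brM; [apply/lie_powX/dim_lie | apply: dim_lie].
by rewrite mulrBl; apply: CsSub.
Qed.

(** When the exponent reaches p, the factor (g - 1)^p = g^p - 1 is a factor from [B] of weight at
    least pw. *)
Lemma coset_span_mulg m x : coset_span m x -> coset_span (m + w) (x * (u g - 1)).
Proof.
elim=> {m x} [m x Ix|m a c y Py cp le|m x y _ IHx _ IHy].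
- by apply: CsLie; rewrite -addSn; apply: lie_powM => //; apply: dim_lie.
- rewrite -mulrA -exprSr; move: cp; rewrite leq_eqVlt => /predU1P[cp|cp].
    rewrite cp u_pow // -[_ * _]mulr1 -[X in _ * X](expr0 (u g - 1)).
    apply: CsMon (prime_gt0 pr_p) _.
      by apply: PsMul Py chain_step_pow (dim_pow pr_p pN nNG Dg).
    by rewrite mul0n addn0 -cp mulSn; move: le; clear; lia.
  by apply: CsMon Py cp _; rewrite mulSn addnA addnAC leq_add2r.
by rewrite mulrBl; apply: CsSub.
Qed.

Let stable i h := forall m x, coset_span m x -> coset_span (m + i) (x * (u h - 1)).

Let stableM i h h' : h \in N -> h' \in N -> stable i h -> stable i h' -> stable i (h * h')%g.
Proof.
move=> Nh Nh' sh sh' m x Sx; rewrite uM1 //.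
move: (sh) (sh'); rewrite /stable; move: (u h - 1) (u h' - 1) => a b {}sh {}sh'.
rewrite !mulrDr mulrA.
apply: coset_spanD; last exact: sh'.
apply: coset_spanD; last exact: sh.
by apply: (@coset_span_le _ (m + i + i)); [apply: leq_addr | apply: (sh' _ _ (sh _ _ Sx))].
Qed.

Let stable1 i : stable i 1%g.
Proof. by move=> m x _; rewrite u1 subrr mulr0; apply/CsLie/lie_pow_r0. Qed.

Lemma coset_span_mul m i x h : h \in A -> h \in D i -> coset_span m x ->
  coset_span (m + i) (x * (u h - 1)).
Proof.
move=> Ah Dh; have [iw|wi] := leqP i w; last first.
  by apply: coset_span_mulB => //; apply: (subsetP sDB); apply: subsetP Dh; apply: dim_le.
have [k _ [b Bb hE]] := chain_step_coset Ah.
have Dig : g \in D i by apply: subsetP Dg; apply: dim_le.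
have Db : b \in D i by move: Dh; rewrite hE groupMl ?groupX.
have sg : stable i g.
  by move=> m' y Sy; apply: coset_span_le (coset_span_mulg Sy); rewrite leq_add2l.
move: m x; rewrite -/(stable i h) hE; apply: stableM; [exact: groupX | exact: BN | |]; last first.
  by move=> m' y; apply: coset_span_mulB.
by elim: k {hE} => [|k IH]; [apply: stable1 | rewrite expgS; apply: stableM; rewrite ?groupX].
Qed.

Lemma prod_coset_span m x : prod_span A m x -> coset_span m x.
Proof.
elim=> {m x} [r|m i x h _ IH Ah Dh|m k x km _ IH|m x y _ IHx _ IHy].
- rewrite -[r]mulr1 -[X in _ * X](expr0 (u g - 1)).
  by apply: CsMon (PsBase B r) (prime_gt0 pr_p) _.
- exact: coset_span_mul.
- exact: coset_span_le IH.
exact: CsSub.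
Qed.

(** In a collected monomial y (g - 1)^k with k <= p - 1 and weight above c + (p - 1) w, the part y
    has weight above c, and the hypothesis gains one degree there. *)
Lemma chain_step_span c : (forall m x, (c < m)%N -> prod_span B m x -> I m.+1 x) ->
  forall m x, (c + p.-1 * w < m)%N -> prod_span A m x -> I m.+1 x.
Proof.
move=> hB m x cm /prod_coset_span Sx; elim: Sx cm => {m x} [//|m a k y Py kp le|m x y _ IHx _
  IHy] cm.
  have kw : (k * w <= p.-1 * w)%N by rewrite leq_mul2r -ltnS prednK ?prime_gt0 // kp orbT.
  have ca : (c < a)%N by move: cm le kw; clear; lia.
  apply: (@lie_pow_le _ _ (a.+1 + w * k)); first by rewrite addSn ltnS mulnC.
  by apply: lie_powM; [apply: hB Py | apply/lie_powX/dim_lie].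
by apply: lie_powB; [apply: IHx | apply: IHy].
Qed.

(** The sum over [A] is the sum of the g^i, i < p, times the sum over [B], and the first factor is
    (g - 1)^(p - 1). *)
Lemma chain_step_hat c : I c (\sum_(b in B) u b) -> I (c + p.-1 * w) (\sum_(h in A) u h).
Proof.
move=> IB; pose f (d : 'I_p * X) := (g ^+ d.1 * d.2)%g.
pose E := finset.setX [set: 'I_p]%SET B.
have fE : f @: E = A.
  apply/finset.setP=> h; apply/imsetP/idP=> [[[k b]]|Ah].
    by rewrite inE => /andP[_ /= Bb] ->; rewrite groupM ?groupX // (subsetP sBA).
  have [k kp [b Bb ->]] := chain_step_coset Ah.
  by exists (Ordinal kp, b); rewrite // !inE.
have injf : {in E &, injective f}.
  by apply/imset_injP; rewrite fE cardA cardsX cardsT card_ord.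
have -> : \sum_(h in A) u h = (u g - 1) ^+ p.-1 * \sum_(b in B) u b.
  rewrite -fE big_imset // -ga_unit_geom // mulr_suml.
  rewrite (eq_bigl (fun d => true && (d.2 \in B))); last by move=> d; rewrite !inE.
  rewrite -(pair_big xpredT (fun b => b \in B) (fun (k : 'I_p) b => u (g ^+ k * b)%g)) /=.
  apply: eq_bigr => k _; rewrite mulr_sumr; apply: eq_bigr => b Bb.
  by rewrite uM; [rewrite uX | apply: groupX | apply: BN].
rewrite addnC mulnC; apply: lie_powM => //; exact/lie_powX/dim_lie.
Qed.

(** For a subgroup this is the left ideal of KG generated by the augmentation ideal of its group
    algebra. *)
Inductive aug_span (H : {set X}) : KG -> Prop :=
| AsMul r h : h \in H -> aug_span H (r * (u h - 1))
| AsSub x y : aug_span H x -> aug_span H y -> aug_span H (x - y).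

Lemma aug_span0 (H : {group X}) : aug_span H 0.
Proof. by have := AsMul 0 (group1 H); rewrite mul0r. Qed.

Lemma aug_spanD (H : {group X}) x y : aug_span H x -> aug_span H y -> aug_span H (x + y).
Proof.
move=> Sx Sy; rewrite -[y]opprK; apply: AsSub => //; rewrite -sub0r.
by apply: AsSub => //; apply: aug_span0.
Qed.

Lemma aug_span_mull (H : {group X}) r x : aug_span H x -> aug_span H (r * x).
Proof.
elim=> {x} [s h Hh|x y _ IHx _ IHy]; first by rewrite mulrA; apply: AsMul.
by rewrite mulrBr; apply: AsSub.
Qed.

Let aug_span_mulr s x : aug_span B x -> aug_span B (x * s).
Proof.
elim=> {x} [r h Bh|x y _ IHx _ IHy]; last by rewrite mulrBl; apply: AsSub.
elim/ga_ind: s => [s t Ps Pt|a k]; first by rewrite mulrDr; apply: aug_spanD.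
rewrite -mulrA mulrBl mul1r u_single ?BN // -{2}[ga_single a k]mulr1 -mulrBr mulrA.
apply: AsMul; rewrite conjg_mulR groupM //; apply: (subsetP sDB).
by apply: commD; apply: (subsetP sAD); apply: (subsetP sBA).
Qed.

Let aug_span_br s : aug_span B (br (u g) s).
Proof.
elim/ga_ind: s => [s t Ps Pt|a k]; first by rewrite lie_brD; apply: aug_spanD.
by rewrite br_single //; apply: AsMul; apply: (subsetP sDB); apply: commD.
Qed.

Let aug_span_step x : aug_span A x -> exists y, aug_span B (x - y * (u g - 1)).
Proof.
elim=> {x} [r h Ah|x y _ [a ha] _ [b hb]]; last first.
  exists (a - b).
  have -> : x - y - (a - b) * (u g - 1) = (x - a * (u g - 1)) - (y - b * (u g - 1)).
    rewrite [(a - b) * _]mulrBl !opprB addrACA [RHS]addrACA; congr (_ + _); exact: addrC.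
  exact: AsSub.
have [k _ [b Bb ->]] := chain_step_coset Ah.
exists (r * \sum_(i < k) u g ^+ i).
have -> : r * (u (g ^+ k * b)%g - 1) - r * (\sum_(i < k) u g ^+ i) * (u g - 1) =
    r * u (g ^+ k)%g * (u b - 1).
  have gE : (\sum_(i < k) u g ^+ i) * (u g - 1) = u g ^+ k - 1.
    rewrite subrX1 mulr_suml mulr_sumr; apply: eq_bigr => i _.
    by rewrite mulrBl mulrBr mul1r mulr1 -exprS -exprSr.
  rewrite -(mulrA r (\sum_(i < k) u g ^+ i)) gE -mulrBr -(mulrA r); congr (_ * _).
  rewrite uM; [|exact: groupX|exact: BN].
  by rewrite uX // mulrBr mulr1 opprB addrA subrK.
exact: AsMul.
Qed.

(** Modulo the two-sided ideal attached to [B], z = g - 1 is central, so an element of I (m + j) has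
    the form yz with y in I j. After p such reductions only multiples of z^p = g^p - 1 remain, and
    g^p lies in [B]. *)
Lemma chain_step_nil m : (forall x, I m x -> aug_span A x) ->
  exists m', forall x, I m' x -> aug_span B x.
Proof.
move=> hA; set z := u g - 1.
have brz s : aug_span B (br z s).
  have -> : br z s = br (u g) s by rewrite /z lie_brBl {2}/lie_br mulr1 mul1r subrr subr0.
  exact: aug_span_br.
have shift j x : I (m + j) x -> exists2 y, I j y & aug_span B (x - y * z).
  elim: j x => [|j IH] x.
    by rewrite addn0 => /hA/aug_span_step[y hy]; exists y => //; apply: lie_pow0.
  rewrite addnS; pose J : set KG := fun x => exists2 y, I j.+1 y & aug_span B (x - y * z).
  apply: (@lie_pow_ind _ _ J); first split.
  - by exists 0; [apply: lie_pow_r0 | rewrite mul0r subr0; apply: aug_span0].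
  - move=> x1 x2 [y1 I1 S1] [y2 I2 S2]; exists (y1 - y2); first exact: lie_powB.
    have -> : x1 - x2 - (y1 - y2) * z = (x1 - y1 * z) - (x2 - y2 * z).
      by rewrite mulrBl !opprB addrACA [RHS]addrACA; congr (_ + _); apply: addrC.
    exact: AsSub.
  - move=> r y [y1 I1 S1]; split.
      exists (r * y1); first exact: lie_powMl.
      by rewrite -mulrA -mulrBr; apply: aug_span_mull.
    exists (y1 * r); first exact: lie_powMr.
    rewrite sub_mul_swap.
    by apply: aug_spanD; [apply: aug_span_mulr | apply: aug_span_mull].
  move=> y r /IH[y1 I1 S1]; exists (br y1 r); first exact: lie_pow_br.
  rewrite lie_br_sub_mul.
  apply: aug_spanD; last exact: aug_span_mull.
  by rewrite /lie_br; apply: AsSub; [apply: aug_span_mulr | apply: aug_span_mull].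
have powz i x : I (m * i) x -> exists y, aug_span B (x - y * z ^+ i).
  elim: i x => [|i IH] x.
    by exists x; rewrite expr0 mulr1 subrr; apply: aug_span0.
  rewrite mulnS => /shift[y /IH[y' S'] S]; exists y'.
  have -> : x - y' * z ^+ i.+1 = (x - y * z) + (y - y' * z ^+ i) * z.
    by rewrite mulrBl exprSr mulrA addrA subrK.
  by apply: aug_spanD; last exact: aug_span_mulr.
exists (m * p)%N => x /powz[y S].
have -> : x = (x - y * z ^+ p) + y * z ^+ p by rewrite subrK.
apply: aug_spanD => //; rewrite u_pow //; apply: AsMul; exact: chain_step_pow.
Qed.

End ChainStep.

(** A chain of index p steps from 1 to [A], each inside one layer D_w/D_(w+1). The number [c], the
    sum of (p - 1) w over the steps, is the weight of the product of all the (g - 1)^(p - 1), that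
    is, of the sum of the elements of [A]. *)
Inductive dim_chain : {group X} -> nat -> Prop :=
| DcOne (A : {group X}) : A :=: 1%g -> dim_chain A 0
| DcStep (A B : {group X}) c w g : dim_chain B c -> B \subset A -> A \subset D w ->
    D w.+1 \subset B -> (0 < w)%N -> #|A| = (p * #|B|)%N -> g \in A -> g \notin B ->
    dim_chain A (c + p.-1 * w).

Lemma dim_chain_span A c : dim_chain A c ->
  forall m x, (c < m)%N -> prod_span A m x -> I m.+1 x.
Proof.
elim=> {A c} [A A1 m x m0 Px|A B c w g _ IH sBA sAD sDB w0 cA Ag nBg];
  last exact: (chain_step_span sBA sAD sDB w0 cA Ag nBg IH).
suff -> : x = 0 by apply: lie_pow_r0.
elim: Px m0 => {m x} [//|m i x h _ _|m k x km _ IH k0|m x y _ IHx _ IHy m0].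
- by rewrite A1 => /set1gP-> _ _; rewrite u1 subrr mulr0.
- by apply: IH; apply: leq_trans km.
by rewrite IHx // IHy // subrr.
Qed.

Lemma dim_chain_hat A c : dim_chain A c -> I c (\sum_(h in A) u h).
Proof.
elim=> {A c} [A A1|A B c w g _ IH sBA sAD sDB w0 cA Ag nBg]; first exact: lie_pow0.
exact: (chain_step_hat sBA sAD sDB w0 cA Ag nBg IH).
Qed.

(** [dim_chain_span] alone shows that the powers beyond [c] coincide; this lemma ensures that their
    common value is 0. *)
Lemma dim_chain_nil A c : dim_chain A c -> forall m, (forall x, I m x -> aug_span A x) ->
  exists m', forall x, I m' x -> x = 0.
Proof.
elim=> {A c} [A A1 m hm|A B c w g _ IH sBA sAD sDB w0 cA Ag nBg m hm].
  exists m => x /hm; elim=> {x} [r h|x y _ -> _ ->]; last by rewrite subrr.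
  by rewrite A1 => /set1gP->; rewrite u1 subrr mulr0.
by have [m' /IH] := chain_step_nil sBA sAD sDB w0 cA Ag nBg hm.
Qed.

(** Maximal subgroups of a p-group have index p, so the interval can be refined one step at a
    time. *)
Lemma dim_chain_between w (A : {group X}) c : (0 < w)%N -> dim_chain (D w.+1) c ->
    D w.+1 \subset A -> A \subset D w ->
  dim_chain A (c + p.-1 * (w * (logn p #|A| - logn p #|D w.+1|))).
Proof.
move=> w0 hc; have [k] := ubnP #|A|; elim: k A => // k IH A /ltnSE cA sDA sAD.
have [eA|[M maxM sDM]] := maximal_exists sDA.
  suff -> : A = D w.+1 by rewrite subnn !muln0 addn0.
  by apply/val_inj; rewrite /= eA.
have pA : (p.-group A)%g by apply: pgroupS pN; apply: subset_trans (sDN w).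
have [sMA] := andP (maxgroupp maxM); rewrite -/(A \subset M) => nAM.
have iM := p_maximal_index pA maxM.
have cAM : (#|A| = p * #|M|)%N by rewrite -(Lagrange sMA) iM mulnC.
have [g Ag nMg] := subsetPn nAM.
have M0 : (0 < #|M|)%N := cardG_gt0 M.
have ltM : (#|M| < k)%N by apply: leq_trans cA; rewrite cAM ltn_Pmull // prime_gt1.
have hM := IH M ltM sDM (subset_trans sMA sAD).
have lM : (logn p #|D w.+1| <= logn p #|M|)%N by rewrite dvdn_leq_log // cardSg.
have := DcStep hM sMA sAD sDM w0 cAM Ag nMg.
rewrite cAM (lognM _ (prime_gt0 pr_p) M0) (logn_prime _ pr_p) eqxx addSn add0n subSn // mulnS.
by rewrite [(w + _)%N]addnC mulnDr addnA.
Qed.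

Local Notation elog := (dim_log N Gam p).

(** Summation by parts: each index v >= w occurs in e_v - e_(v+1) steps, and the sum of v (e_v -
    e_(v+1)) is w e_w plus the later e_v. *)
Lemma dim_chain_D w : (0 < w)%N -> forall k, dim_log N Gam p (w + k) = 0%N ->
  dim_chain (D w) (p.-1 * (w * elog w + \sum_(j < k) elog (w + j.+1))).
Proof.
move=> w0 k; elim: k w w0 => [|k IH] w w0 e0.
  have D1 : D w :=: 1%g.
    by apply/eqP; rewrite trivg_card1 card_dim // -[w in elog w]addn0 e0.
  rewrite big_ord0 addn0 -[w in elog w]addn0 e0 !muln0; exact: DcOne.
have h := IH w.+1 isT; rewrite addSnnS in h; have {}h := h e0.
have le := dim_log_le pr_p nNG (leqnSn w).
have := dim_chain_between w0 h (dim_anti pr_p nNG w) (subxx _).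
rewrite -/(elog w) -/(elog w.+1) -mulnDr big_ord_recl addn1.
have -> : (\sum_(j < k) elog (w.+1 + j.+1) = \sum_(j < k) elog (w + (bump 0 j).+1))%N.
  by apply: eq_bigr => j _; rewrite addSnnS.
set S := (\sum_(j < k) _)%N.
suff -> : (w.+1 * elog w.+1 + S + w * (elog w - elog w.+1) = w * elog w + (elog w.+1 + S))%N by [].
rewrite mulSn mulnBr; have : (w * elog w.+1 <= w * elog w)%N by rewrite leq_mul2l le orbT.
clear; lia.
Qed.

Lemma prod_span_aug m x : prod_span N m x -> (0 < m)%N -> aug_span N x.
Proof.
elim=> {m x} [//|m i x h _ _ Nh _ _|m j x jm _ IH j0|m x1 x2 _ IH1 _ IH2 m0].
- exact: AsMul.
- by apply: IH; apply: leq_trans jm.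
by apply: AsSub; [apply: IH1 | apply: IH2].
Qed.

(** The sum of the elements of G' is nonzero and lies in I M. An element of I (M + 1) gains one
    degree again and again, so it lies in every power and hence is 0. *)
Theorem upper_lie_index_dim : upper_lie_index KG =
  (2 + p.-1 * \sum_(j < (p ^ logn p #|N|).+1) elog j.+1)%N.
Proof.
have big j : (p ^ logn p #|N| < j)%N -> elog j = 0%N by apply: dim_log_big.
pose k := (p ^ logn p #|N|)%N.
have := @dim_chain_D 1 isT k; rewrite add1n => /(_ (big _ (ltnSn _))).
rewrite big_ord_recl mul1n.
have -> : (\sum_(j < k) elog (1 + j.+1) = \sum_(j < k) elog (bump 0 j).+1)%N by [].
set M := (p.-1 * _)%N => ch.
rewrite (@upper_lie_indexE KG M (\sum_(h in N) u h)) //.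
- exact: dim_chain_hat.
- move=> /(congr1 (mcoeff 1%g)); rewrite mcoeff0 raddf_sum /= (bigD1 1%g) //= big1.
    by rewrite u1 addr0 mcoeffUU => /eqP; rewrite oner_eq0.
  move=> h /andP[Nh h1]; rewrite /u /ga_unit /ga_single mcoeffU.
  case: eqP => // eh; case/eqP: h1; apply: (dm_inj model) => //.
  by rewrite eh e1.
move=> y Iy; have [m0 nil] : exists m', forall x, I m' x -> x = 0.
  by apply: (dim_chain_nil ch (m := 1)) => x /lie_prod_span/prod_span_aug; apply.
have hI : forall j, I (M.+1 + j) y.
  elim=> [|j IH]; first by rewrite addn0.
  rewrite addnS; apply: (dim_chain_span ch); last exact: lie_prod_span.
  by rewrite addSn ltnS leq_addr.
by apply: nil; apply: lie_pow_le (hI m0); apply: leq_addl.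
Qed.

End Jennings.

Local Close Scope ring_scope.

(** * A finite permutation model of G' with the action of G *)

Section FiniteModel.
Local Open Scope group_scope.
Variable G : groupType.

Lemma card_eq_enum (A : set G) q : (A #= `I_q)%card -> 0 < q ->
  exists io : 'I_q -> G, exists r : G -> 'I_q,
    [/\ forall i, A (io i), forall x, A x -> io (r x) = x & forall i, r (io i) = i].
Proof.
case: q => // q /card_set_bijP[f [fA finj fsurj]] _.
have ex (i : 'I_q.+1) : exists x, A x /\ f x = i.
  by have [x Ax fx] := fsurj i (ltn_ord i); exists x.
have [io ioP] := choice ex; exists io, (fun x => inord (f x)); split=> [i|x Ax|i].
- by have [] := ioP i.
- have [Ai fi] := ioP (inord (f x)); apply: finj; rewrite ?inE // fi.
  by rewrite inordK //; apply: fA.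
by have [_ ->] := ioP i; rewrite inord_val.
Qed.

Lemma lower_central_sub i : subgroup_set (lower_central G i).
Proof.
case: i => [|[|i]]; try by split.
split=> [H [[H1 _ _] _] //|x y hx hy H hH|x hx H hH]; have [[_ HM HV] _] := hH.
  by apply: HM; [apply: hx | apply: hy].
by apply: HV; apply: hx.
Qed.

Lemma lower_centralR i x y : lower_central G i.+1 x -> lower_central G i.+2 [~ x, y].
Proof. by move=> ix H [_ sH]; apply: sH; exists x => //; exists y. Qed.

Lemma lower_central_ind i (P : set G) : subgroup_set P ->
  (forall x y, lower_central G i.+1 x -> P [~ x, y]) ->
  forall x, lower_central G i.+2 x -> P x.
Proof. by move=> sP hP x; apply; split=> // _ [y iy [z _ <-]]; apply: hP. Qed.

Lemma lower_centralS i x : lower_central G i.+2 x -> lower_central G i.+1 x.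
Proof.
elim: i x => [//|i IH]; apply: lower_central_ind; first exact: lower_central_sub.
by move=> x y /IH/lower_centralR-/(_ y).
Qed.

Lemma lower_centralJ i x y : lower_central G i.+1 x -> lower_central G i.+1 (x ^ y).
Proof.
case: i => [//|i] ix; have [_ hM _] := lower_central_sub i.+2.
have -> : x ^ y = x * [~ x, y] by rewrite commgEl mulKVg.
by apply: hM => //; apply: lower_centralR; apply: lower_centralS.
Qed.

Section Model.
Variables (q : nat) (io : 'I_q -> G) (r : G -> 'I_q).
Local Notation A := (lower_central G 2).
Hypothesis ioA : forall i, A (io i).
Hypothesis rK : forall x, A x -> io (r x) = x.
Hypothesis ioK : forall i, r (io i) = i.

Let A1 : A 1. Proof. by have [] := lower_central_sub 2. Qed.
Let AM x y : A x -> A y -> A (x * y). Proof. by have [_ h _] := lower_central_sub 2; apply: h. Qed.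
Let io_inj : injective io := can_inj ioK.

(** Once G' is enumerated, right translation by an element of G' ([rho]) and conjugation by an
    element of G ([sigma]) permute the indices, so one finite symmetric group contains G' and the
    image of a possibly infinite G. *)
Let rho_inj t : injective (fun i => r (io i * io t)).
Proof.
by move=> i j /(congr1 io); rewrite !rK; try exact: AM; move/mulIg/io_inj.
Qed.
Let rho t := perm (@rho_inj t).
Let sigma_inj g : injective (fun i => r (io i ^ g)).
Proof.
by move=> i j /(congr1 io); rewrite !rK; try exact: lower_centralJ; move/conjg_inj/io_inj.
Qed.
Let sigma g := perm (@sigma_inj g).

Let io_rho t i : io (rho t i) = io i * io t.
Proof. by rewrite permE rK //; apply: AM. Qed.
Let io_sigma g i : io (sigma g i) = io i ^ g.
Proof. by rewrite permE rK //; apply: lower_centralJ. Qed.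

Let rhoM s t : rho s * rho t = rho (r (io s * io t)).
Proof.
apply/permP=> i; apply: io_inj; rewrite permM !io_rho rK ?mulgA //; exact: AM.
Qed.
Let sigmaM g h : sigma g * sigma h = sigma (g * h).
Proof. by apply/permP=> i; apply: io_inj; rewrite permM !io_sigma conjgM. Qed.
Let sigma1 : sigma 1 = 1.
Proof. by apply/permP=> i; apply: io_inj; rewrite io_sigma conjg1 perm1. Qed.
Let sigmaV g : (sigma g)^-1 = sigma g^-1.
Proof. by apply/mulg1_eq; rewrite sigmaM mulgV sigma1. Qed.

Let rhoJ t g : rho t ^ sigma g = rho (sigma g t).
Proof.
apply/permP=> i; apply: io_inj; rewrite conjgE !permM sigmaV.
by rewrite !(io_rho, io_sigma) conjMg -conjgM mulVg conjg1.
Qed.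

Let i1 := r 1.
Let io1 : io i1 = 1. Proof. exact: rK. Qed.
Let rho1 : rho i1 = 1.
Proof. by apply/permP=> i; apply: io_inj; rewrite io_rho io1 mulg1 perm1. Qed.

Let N_group : group_set [set rho t | t in 'I_q]%SET.
Proof.
apply/group_setP; split; first by rewrite -rho1; apply: imset_f.
by move=> _ _ /imsetP[s _ ->] /imsetP[t _ ->]; rewrite rhoM; apply: imset_f.
Qed.
Let N : {group {perm 'I_q}} := Group N_group.
Let NP x : reflect (exists t, x = rho t) (x \in N).
Proof. by apply: (iffP imsetP) => [[t _ ->]|[t ->]]; exists t. Qed.

Let Gam_group : group_set [set s : {perm 'I_q} | `[< exists g, s = sigma g >]]%SET.
Proof.
apply/group_setP; split; first by rewrite finset.inE; apply/asboolP; exists 1.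
move=> x y; rewrite !finset.inE => /asboolP hx /asboolP hy; apply/asboolP.
have [g ->] := hx; have [h ->] := hy; by exists (g * h); rewrite sigmaM.
Qed.
Let Gam : {group {perm 'I_q}} := Group Gam_group.
Let GamP x : reflect (exists g, x = sigma g) (x \in Gam).
Proof. by rewrite finset.inE; apply: asboolP. Qed.

Let e (x : {perm 'I_q}) : G := io (x i1).
Let e_rho t : e (rho t) = io t.
Proof. by rewrite /e io_rho io1 mul1g. Qed.

Let sigma_der g : A g -> sigma g \in [~: Gam, Gam].
Proof.
have Gs h : sigma h \in Gam by apply/GamP; exists h.
apply: (@lower_central_ind 0 (fun g => sigma g \in [~: Gam, Gam])).
  split=> [|x y sx sy|x sx]; first by rewrite sigma1.
    by rewrite -sigmaM groupM.
  by rewrite -sigmaV groupV.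
move=> x y _.
have -> : sigma [~ x, y] = [~ sigma x, sigma y] by rewrite !commgEl -?sigmaM -?sigmaV -?sigmaM.
exact: mem_commg.
Qed.

Lemma derived_modelP : derived_model N Gam e sigma /\ #|N| = q.
Proof.
have cN : #|N| = q.
  rewrite card_imset ?card_ord // => s t /(congr1 e); rewrite !e_rho; exact: io_inj.
split=> //; split.
- by move=> _ _ /NP[s ->] /NP[t ->]; rewrite rhoM !e_rho rK //; apply: AM.
- by move=> _ _ /NP[s ->] /NP[t ->]; rewrite !e_rho => /io_inj->.
- move=> g h; exists (rho (r [~ g, h])); first by apply/NP; exists (r [~ g, h]).
  by rewrite e_rho rK //; apply: lower_centralR.
- move=> g; split=> [Ag|[_ /NP[t ->] <-]]; last by rewrite e_rho.
  by exists (rho (r g)); [apply/NP; exists (r g) | rewrite e_rho rK].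
- by move=> _ g /NP[t ->]; rewrite rhoJ !e_rho io_sigma.
- by move=> g; apply/GamP; exists g.
- by move=> c /GamP[g ->]; exists g.
- apply/subsetP=> _ /GamP[g ->]; rewrite finset.inE; apply/subsetP=> _ /imsetP[_ /NP[t ->] ->].
  by rewrite rhoJ; apply/NP; eexists.
(* On [N], conjugation by the translation [rho t] agrees with conjugation by [sigma (io t)], which
   lies in [~: Gam, Gam] because [io t] is in G'. *)
move=> _ /NP[t ->]; exists (sigma (io t)); first exact: sigma_der.
move=> _ /NP[s ->]; rewrite rhoJ; apply/permP=> i; apply: io_inj.
rewrite io_rho io_sigma conjgE !permM io_rho io_rho.
have -> : io ((rho t)^-1 i) = io i * (io t)^-1.
  by apply: (@mulIg _ (io t)); rewrite mulgVK -io_rho permKV.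
by rewrite conjgE !mulgA.
Qed.

End Model.

Lemma exists_derived_model q : (lower_central G 2 #= `I_q)%card -> 0 < q ->
  exists (X : finGroupType) (N Gam : {group X}) e phi,
    derived_model N Gam e (phi : G -> X) /\ #|N| = q.
Proof.
move=> cA q0; have [io [r [h1 h2 h3]]] := card_eq_enum cA q0.
by do 5!eexists; apply: derived_modelP h1 h2 h3.
Qed.

End FiniteModel.

(** * Transfer of conditions between G and its model *)

Section LowerSeries.
Local Open Scope group_scope.
Variables (G : groupType) (X : finGroupType) (N Gam : {group X}).
Variables (e : X -> G) (phi : G -> X).
Hypothesis model : derived_model N Gam e phi.

Local Notation L i := (rel_lower N Gam i).

Lemma rel_lower_sub i : L i \subset N.
Proof.
elim: i => //= i IH; apply: subset_trans (commSg _ IH) _.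
by rewrite commg_subl (dm_norm model).
Qed.

Lemma model_e1 : e 1 = 1.
Proof.
have := dm_morph model (group1 N) (group1 N); rewrite mulg1 => h.
by apply: (@mulIg _ (e 1)); rewrite mul1g -h.
Qed.

Lemma model_eV x : x \in N -> e x^-1 = (e x)^-1.
Proof.
move=> Nx; apply/esym/mulg1_eq.
by rewrite -(dm_morph model) ?groupV // mulgV model_e1.
Qed.

Lemma model_eR x g : x \in N -> e [~ x, phi g] = [~ e x, g].
Proof.
move=> Nx; rewrite !commgEl (dm_morph model) ?groupV ?model_eV ?(dm_act model) //.
by rewrite memJ_norm // (subsetP (dm_norm model)) // (dm_phi model).
Qed.

Lemma rel_lowerP i g : lower_central G i.+2 g <-> exists2 x, x \in L i & e x = g.
Proof.
elim: i g => [|i IH] g; first exact: (dm_gamma2 model).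
split.
  pose P := [set g | exists2 x, x \in L i.+1 & e x = g]%classic.
  apply: (@lower_central_ind _ _ P); first split.
  - by exists 1; rewrite ?group1 ?model_e1.
  - move=> _ _ [x Lx <-] [y Ly <-]; exists (x * y); first by rewrite groupM.
    by rewrite (dm_morph model) ?(subsetP (rel_lower_sub i.+1)).
  - move=> _ [x Lx <-]; exists x^-1; first by rewrite groupV.
    by rewrite model_eV ?(subsetP (rel_lower_sub i.+1)).
  move=> _ y /IH[x Lx <-]; exists [~ x, phi y]; first by rewrite mem_commg // (dm_phi model).
  by rewrite model_eR // (subsetP (rel_lower_sub i)).
move=> [x Lx <-] {g}.
have [_ hM hV] := @lower_central_sub G i.+3; have [h1 _ _] := @lower_central_sub G i.+3.
pose S := [set x in N | `[< lower_central G i.+3 (e x) >]]%SET.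
have gS : group_set S.
  apply/group_setP; split=> [|y z]; first by rewrite finset.inE group1; apply/asboolP;
    rewrite model_e1.
  rewrite !finset.inE => /andP[Ny /asboolP hy] /andP[Nz /asboolP hz]; rewrite groupM //.
  by apply/asboolP; rewrite (dm_morph model) //; apply: hM.
suff: L i.+1 \subset Group gS by move/subsetP/(_ _ Lx); rewrite finset.inE => /andP[_ /asboolP].
rewrite gen_subG; apply/subsetP=> _ /imset2P[y c Ly /(dm_phi_surj model)[h <-] ->].
have Ny := subsetP (rel_lower_sub i) _ Ly.
rewrite finset.inE; apply/andP; split.
  by apply: (subsetP (rel_lower_sub i.+1)); rewrite mem_commg // (dm_phi model).
by apply/asboolP; rewrite model_eR //; apply: lower_centralR; apply/IH; exists y.
Qed.

Lemma model_nilpotent : nilpotent_group G -> exists c, L c :=: 1.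
Proof.
case=> c c1; exists c; apply/trivgP/subsetP=> x Lx.
have : lower_central G c.+2 (e x) by apply/rel_lowerP; exists x.
move/lower_centralS; rewrite c1 => ex; rewrite finset.inE; apply/eqP.
by apply: (dm_inj model); rewrite ?group1 ?(subsetP (rel_lower_sub c)) // model_e1.
Qed.

End LowerSeries.

Lemma card_inj_image (T : finType) (G : choiceType) (A : {set T}) (f : T -> G) :
  {in A &, injective f} -> ([set g | exists2 x, x \in A & f x = g]%classic #= `I_#|A|)%card.
Proof.
move=> fI; pose es := [seq f x | x <- enum A].
have memA g : g \in es <-> exists2 x, x \in A & f x = g.
  split=> [/mapP[x]|[x Ax <-]]; first by rewrite mem_enum => Ax ->; exists x.
  by apply: map_f; rewrite mem_enum.
have ues : uniq es.
  by rewrite map_inj_in_uniq ?enum_uniq // => x y; rewrite !mem_enum; apply: fI.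
apply/card_set_bijP; exists (fun g => index g es); split.
- by move=> g /memA; rewrite -index_mem size_map -cardE.
- move=> g h /set_mem/memA eg /set_mem/memA eh gh.
  by rewrite -(nth_index g eg) gh nth_index.
- move=> i /= iA; have ies : i < size es by rewrite size_map -cardE.
  have [x0 _] : exists x0, x0 \in A by apply/card_gt0P; apply: leq_ltn_trans iA.
  by exists (nth (f x0) es i); [apply/memA/mem_nth | apply: index_uniq].
Qed.

Lemma isog_type_card (G : groupType) (H : set G) (T : finGroupType) :
  isog_type H T -> (H #= `I_#|T|)%card.
Proof.
case=> f [_ [fH fI fS]]; rewrite -cardsT.
have -> : H = [set g | exists2 x, x \in [set: T]%SET & f x = g]%classic.
  apply/predeqP=> g; split=> [Hg|[x _ <-]]; last exact: fH.
  by have [x _ <-] := fS g Hg; exists x; rewrite ?finset.inE.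
by apply: card_inj_image => x y _ _; apply: fI; apply: mem_set.
Qed.

Section Transfer.
Local Open Scope group_scope.
Variables (G : groupType) (X : finGroupType) (N Gam : {group X}).
Variables (e : X -> G) (phi : G -> X).
Hypothesis model : derived_model N Gam e phi.
Local Notation L := (rel_lower N Gam).

Definition eset (A : {set X}) : set G := [set g | exists2 x, x \in A & e x = g]%classic.

Let eM := dm_morph model.
Let eI := dm_inj model.
Let e1 := model_e1 model.
Let eV := model_eV model.

Lemma esetP (A : {set X}) x : A \subset N -> x \in N -> eset A (e x) <-> x \in A.
Proof.
move=> sA Nx; split=> [[y Ay] |Ax]; last by exists x.
by move/(eI (subsetP sA _ Ay) Nx) => <-.
Qed.

Lemma eset_lower i : lower_central G i.+2 = eset (L i).
Proof. by apply/predeqP=> g; apply: rel_lowerP model i g. Qed.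

Lemma eset_sub (A B : {set X}) : A \subset N -> B \subset N ->
  (eset A `<=` eset B)%classic <-> A \subset B.
Proof.
move=> sA sB; split=> [sAB|/subsetP sAB _ [x Ax <-]]; last by exists x; rewrite ?sAB.
apply/subsetP=> x Ax; apply/(esetP sB); first exact: (subsetP sA).
by apply: sAB; exists x.
Qed.

Lemma eset_eq (A B : {set X}) : A \subset N -> B \subset N -> eset A = eset B <-> A = B.
Proof.
move=> sA sB; split=> [AB|->//]; apply/eqP; rewrite finset.eqEsubset.
by apply/andP; split; apply/eset_sub => //; rewrite AB.
Qed.

Lemma eset1 (A : {set X}) : A \subset N -> eset A = [set 1]%classic <-> A = 1.
Proof.
move=> sA; have -> : [set 1]%classic = eset 1.
  by apply/predeqP=> g; split=> [->|[x /finset.set1P-> <-]]; [exists 1; rewrite ?finset.inE|].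
by apply: eset_eq; rewrite ?sub1G.
Qed.

Lemma eset_cap (A B : {set X}) : A \subset N -> B \subset N ->
  (eset A `&` eset B)%classic = eset (A :&: B).
Proof.
move=> sA sB; apply/predeqP=> g; split=> [[[x Ax <-] [y By yx]]|[x /finset.setIP[Ax Bx] <-]].
  exists x => //; rewrite finset.inE Ax.
  by rewrite -(eI (subsetP sB _ By) (subsetP sA _ Ax) yx).
by split; exists x.
Qed.

Lemma eset_mul (A B : {set X}) : A \subset N -> B \subset N ->
  Defs.set_mulg (eset A) (eset B) = eset (A * B).
Proof.
move=> sA sB; apply/predeqP=> g; split=> [[_ [a Aa <-] [_ [b Bb <-] <-]]|[_ /mulsgP[a b Aa Bb
  ->] <-]].
  exists (a * b); first exact: mem_mulg.
  by apply: eM; [apply: (subsetP sA) | apply: (subsetP sB)].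
exists (e a); first by exists a.
exists (e b); first by exists b.
by apply/esym/eM; [apply: (subsetP sA) | apply: (subsetP sB)].
Qed.

Lemma eset_card (A : {set X}) k : A \subset N -> (eset A #= `I_k)%card <-> #|A| = k.
Proof.
move=> sA; have h : (eset A #= `I_#|A|)%card.
  by apply: card_inj_image => x y Ax Ay; apply: eI; apply: (subsetP sA).
split=> [h'|<-//].
by apply/card_eq_II; apply: card_eq_trans h'; apply: card_esym.
Qed.

Lemma eset_pow (A : {group X}) k : A \subset N -> power_subgroup (eset A) k = eset (pow_group A k).
Proof.
move=> sA; have sP := subset_trans (pow_group_subset A k) sA.
have eX x i : x \in N -> e (x ^+ i) = e x ^+ i.
  by move=> Nx; elim: i => [|i IH]; rewrite ?e1 // !expgS eM ?groupX // IH.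
apply/predeqP=> g; split.
  apply; split.
    split; first by exists 1; rewrite ?group1.
      move=> _ _ [x Ax <-] [y Ay <-]; exists (x * y); first exact: groupM.
      by rewrite eM ?(subsetP sP).
    by move=> _ [x Ax <-]; exists x^-1; rewrite ?groupV // eV ?(subsetP sP).
  move=> _ [_ [x Ax <-] <-]; exists (x ^+ k); first exact: mem_pow_group.
  by rewrite eX ?(subsetP sA).
move=> [x Px <-] H [[H1 HM HV] sH].
pose S := [set x in N | `[< H (e x) >]]%SET.
have gS : group_set S.
  apply/group_setP; split=> [|y z]; first by rewrite finset.inE group1; apply/asboolP; rewrite e1.
  rewrite !finset.inE => /andP[Ny /asboolP hy] /andP[Nz /asboolP hz]; rewrite groupM //.
  by apply/asboolP; rewrite eM //; apply: HM.
suff: pow_group A k \subset Group gS by move/subsetP/(_ _ Px);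
  rewrite finset.inE => /andP[_ /asboolP].
apply: pow_group_sub => y Ay; have Ny := subsetP sA _ Ay.
rewrite finset.inE groupX //=; apply/asboolP; rewrite eX //; apply: sH.
by exists (e y) => //; exists y.
Qed.

Lemma eset_isog (A : {group X}) (T : finGroupType) : A \subset N ->
  isog_type (eset A) T <-> A \isog [set: T]%SET.
Proof.
move=> sA; split=> [[f [fM [fA fI fS]]]|].
  have ex t : exists x, x \in A /\ e x = f t by have [x Ax] := fA t I; exists x.
  have [h hP] := choice ex.
  have Nh t : h t \in N by apply: (subsetP sA); have [] := hP t.
  have eh t : e (h t) = f t by have [] := hP t.
  have hM : {in [set: T]%SET &, {morph h : x y / x * y}}.
    move=> x y _ _; apply: eI; [exact: Nh | exact: groupM | ].
    by rewrite eM // !eh fM.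
  rewrite isog_sym; apply/isogP; exists (Morphism hM).
    apply/injmP=> x y _ _ hxy; apply: fI; [exact: mem_set | exact: mem_set |].
    by rewrite -!eh; congr e.
  apply/setP=> x; apply/morphimP/idP=> [[t _ _ ->]|Ax]; first by have [] := hP t.
  have [t _ ft] := fS (e x) (ex_intro2 _ _ x Ax erefl).
  have xE : x = h t by apply: eI; [exact: (subsetP sA) | exact: Nh | rewrite eh ft].
  by exists t; rewrite ?finset.inE.
rewrite isog_sym => /isogP[f injf fE]; exists (e \o f).
have fA t : f t \in A by rewrite -fE mem_morphim ?finset.inE.
have Nf t : f t \in N by apply: (subsetP sA).
split=> [x y|]; first by rewrite /= morphM ?finset.inE // eM.
split=> [t _|x y _ _ /= /eI h|_ [x Ax <-]]; first by exists (f t).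
  by apply: (injmP injf); rewrite ?finset.inE // h.
by move: Ax; rewrite -fE => /morphimP[t _ _ ->]; exists t.
Qed.

End Transfer.

(** * The equation for the index as an equation for the sum of logarithms *)

Section IndexFormula.
Local Open Scope group_scope.
Variables (K : fieldType) (p n : nat) (G : groupType) (X : finGroupType) (N Gam : {group X}).
Variables (e : X -> G) (phi : G -> X).
Hypothesis model : derived_model N Gam e phi.
Hypothesis pK : p \in [pchar K]%R.
Hypothesis cN : #|N| = (p ^ n)%N.
Hypothesis nilN : exists c, iter c (fun H : {group X} => [~: H, Gam]%G) N :=: 1.
Local Notation L := (rel_lower N Gam).
Local Notation D := (dim_series N Gam p).

Let pr_p : prime p := GRing.pcharf_prime pK.
Let nNG := dm_norm model.
Let innN := dm_inner model.
Let pN : p.-group N. Proof. by rewrite /pgroup cN pnatX pnat_id. Qed.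

(** A model does not require [phi] to be a morphism, so the action of [phi a, phi b] is computed in
    G through [e], where it is conjugation by [a, b]. *)
Lemma model_comm : {in Gam &, forall g h,
  exists2 m, m \in N & {in N, forall y, y ^ [~ g, h] = y ^ m}}.
Proof.
move=> _ _ /(dm_phi_surj model)[a <-] /(dm_phi_surj model)[b <-].
have [m Nm em] := dm_der model a b; exists m => // y Ny.
have eJ u v : u \in N -> v \in N -> e (u ^ v) = e u ^ e v.
  by move=> Nu Nv; rewrite !conjgE !(dm_morph model) ?(model_eV model) ?groupM ?groupV.
have nG c : phi c \in 'N(N) by rewrite (subsetP nNG) // (dm_phi model).
have nGV c : (phi c)^-1 \in 'N(N) by rewrite groupV.
have eJV u c : u \in N -> e (u ^ (phi c)^-1) = e u ^ c^-1.
  move=> Nu; apply: (@conjg_inj _ c); rewrite -(dm_act model) ?memJ_norm //.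
  by rewrite -!conjgM !mulVg !conjg1.
apply: (dm_inj model).
- by rewrite memJ_norm // groupR.
- by rewrite memJ_norm // (subsetP (normG N)).
have -> : [~ phi a, phi b] = (phi a)^-1 * (phi b)^-1 * phi a * phi b
  by rewrite commgEl conjgE !mulgA.
rewrite !conjgM !(dm_act model) ?memJ_norm // !eJV ?memJ_norm // -!conjgM eJ // em.
by rewrite commgEl conjgE !mulgA.
Qed.

(** With S the sum of logarithms, 2 + (p - 1) S = p^n - 15 p + 16 becomes (p - 1) (S + 15) = p^n -
    1, which can be divided by p - 1. *)
Lemma index_sumP :
  ((upper_lie_index (group_algebra K G))%:Z = (p ^ n)%N%:Z - 15%:Z * p%:Z + 16%:Z)%R <->
  (\sum_(j < (p ^ n).+1) dim_log N Gam p j.+1 + 15 = \sum_(k < n) p ^ k)%N.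
Proof.
rewrite (upper_lie_index_dim model pK pN nilN) cN pfactorK //.
have h : (p ^ n = (p.-1 * (\sum_(k < n) p ^ k)).+1)%N.
  by rewrite -predn_exp prednK // expn_gt0 prime_gt0.
set S := (\sum_(j < _) _)%N; set P := (\sum_(k < n) _)%N in h *.
have p1 := prime_gt1 pr_p; rewrite h; have pE : p = p.-1.+1 by rewrite prednK // ltnW.
rewrite [in X in (_ - _ * X + _)%R]pE; have p0 : (0 < p.-1)%N by rewrite -subn1 subn_gt0.
move: p.-1 p0 => r r0.
have -> : (S + 15 = P <-> r * (S + 15) = r * P)%N.
  by split=> [->//|/eqP]; rewrite eqn_pmul2l // => /eqP.
rewrite mulnDr; clearbody S P; move: (r * S)%N (r * P)%N => a b; clear; lia.
Qed.

End IndexFormula.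

(** * Invariants of the abelian types that occur *)

Section CyclicProductFacts.
Local Open Scope group_scope.
Variable X : finGroupType.
Implicit Types H : {group X}.

Lemma card_cycle_pow2 (a : X) k : #[a] = (2 * k)%N -> #|<[a ^+ 2]>| = k.
Proof. by move=> oa; rewrite -orderE orderXdiv oa ?dvdn_mulr // mulKn. Qed.

Lemma Zp_isog_prime k H : prime k.+2 -> #|H| = k.+2 -> H \isog [set: 'Z_k.+2]%SET.
Proof.
move=> pr cH; have /cyclicP[a Ha] : cyclic H by apply: prime_cyclic; rewrite cH.
by rewrite Ha; apply: cycle_isog_Zp; rewrite orderE -Ha.
Qed.

Lemma Z44_facts H : H \isog [set: 'Z_4 * 'Z_4]%SET ->
  [/\ abelian H, #|H| = 16, {in H, forall x, x ^+ 4 = 1} & #|pow_group H 2| = 4].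
Proof.
case/cycle_prod_facts=> a [b [dH oa ob]]; split.
- exact: dprod_cycles_abelian dH.
- by rewrite -(dprod_card dH) -!orderE oa ob.
- have a4 : a ^+ 4 = 1 by rewrite -oa expg_order.
  have b4 : b ^+ 4 = 1 by rewrite -ob expg_order.
  exact: dprod_cycles_exp dH a4 b4.
by rewrite -(dprod_card (dprod_cycles_pow 2 dH)) !(@card_cycle_pow2 _ 2).
Qed.

Lemma Z42_facts H : H \isog [set: 'Z_4 * 'Z_2]%SET ->
  [/\ [/\ abelian H, #|H| = 8, {in H, forall x, x ^+ 4 = 1} & #|pow_group H 2| = 2]
    & exists2 x, x \in H & x ^+ 2 != 1].
Proof.
case/cycle_prod_facts=> a [b [dH oa ob]].
have a4 : a ^+ 4 = 1 by rewrite -oa expg_order.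
have b2 : b ^+ 2 = 1 by rewrite -ob expg_order.
split; first split.
- exact: dprod_cycles_abelian dH.
- by rewrite -(dprod_card dH) -!orderE oa ob.
- by apply: (dprod_cycles_exp dH) => //; rewrite (expgM b 2 2) b2 expg1n.
- by rewrite -(dprod_card (dprod_cycles_pow 2 dH)) (@card_cycle_pow2 _ 2) // b2 cycle1 cards1.
exists a; last by rewrite -order_dvdn oa.
by have /dprodP[_ <- _ _] := dH; rewrite (subsetP (mulG_subl _ _)) // cycle_id.
Qed.

Lemma Z422_facts H : H \isog [set: 'Z_4 * 'Z_2 * 'Z_2]%SET -> abelian H /\ #|pow_group H 2| = 2.
Proof.
case/isog_prod_inv=> A [B [dH /Z42_facts[[abA _ _ cA] _] /Zp_isog_cycle[b Bb ob]]].
have b2 : b ^+ 2 = 1 by rewrite -ob expg_order.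
split.
  by have /dprodP[_ <- cAB _] := dH; rewrite abelianM abA Bb cycle_abelian -Bb.
by rewrite -(dprod_card (pow_group_dprod 2 dH)) cA Bb pow_group_cycle b2 cycle1 cards1.
Qed.

Lemma Z162_facts H : H \isog [set: 'Z_16 * 'Z_2]%SET ->
  [/\ #|H| = 32, cyclic (pow_group H 2) & #|pow_group H 2| = 8].
Proof.
case/cycle_prod_facts=> a [b [dH oa ob]].
have b2 : b ^+ 2 = 1 by rewrite -ob expg_order.
have pE : <[a ^+ 2]> = pow_group H 2.
  by rewrite -(dprodg1 <[a ^+ 2]>) -(dprod_cycles_pow 2 dH) b2 cycle1.
split; first by rewrite -(dprod_card dH) -!orderE oa ob.
- by rewrite -pE cycle_cyclic.
by rewrite -pE (@card_cycle_pow2 _ 8).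
Qed.

End CyclicProductFacts.

(** * The individual conditions for p = 2 *)

Section TwoGroups.
Local Open Scope group_scope.
Variables (n : nat) (G : groupType) (X : finGroupType) (N Gam : {group X}).
Variables (e : X -> G) (phi : G -> X).
Hypothesis model : derived_model N Gam e phi.
Hypothesis cN : #|N| = (2 ^ n)%N.
Hypothesis nilN : exists c, iter c (fun H : {group X} => [~: H, Gam]%G) N :=: 1.
Local Notation L := (rel_lower N Gam).
Local Notation D := (dim_series N Gam 2).
Local Notation E := (eset e).

Let pr2 : prime 2 := isT.
Let nNG := dm_norm model.
Let innN := dm_inner model.
Let pN : 2.-group N. Proof. by rewrite /pgroup cN pnatX. Qed.
Let LN i : L i \subset N.
Proof. exact: subset_trans (rel_lower_dim nNG i) (dim_sub pr2 nNG _). Qed.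
Let lc i := eset_lower model i.
Let Epow (A : {group X}) k sA := @eset_pow _ _ _ _ _ _ model A k sA.
Let Esub (A B : {set X}) sA sB := @eset_sub _ _ _ _ _ _ model A B sA sB.
Let Eisog (A : {group X}) T sA := @eset_isog _ _ _ _ _ _ model A T sA.
Let powN (A : {group X}) k : A \subset N -> pow_group A k \subset N.
Proof. exact: subset_trans (pow_group_subset A k). Qed.

Lemma first_pattern_cases : #|N| = 32 -> #|D 2| = 8 -> #|D 3| = 4 -> #|D 4| = 4 ->
    #|D 5| = 2 -> #|D 8| = 2 -> D 9 :=: 1 ->
  ('gamma_2(G) ~= 'Z_16 * 'Z_2 /\ ('gamma_3(G) `<=` 'gamma_2(G) ^^ 2)%classic /\
         ('gamma_4(G) `<=` 'gamma_2(G) ^^ 4)%classic) \/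
  ('gamma_2(G) ~= 'Z_8 * 'Z_2 * 'Z_2 /\
         ('gamma_2(G) ^^ 2 `<=` 'gamma_3(G))%classic /\ 'gamma_3(G) ~= 'Z_8 /\
         ('gamma_4(G) `<=` 'gamma_3(G) ^^ 2)%classic).
Proof.
move=> cN' c2 c3 c4 c5 c8 D9.
have cyc := cyclic_dim2 pN nNG c2 c3 c4 c5 c8 D9.
rewrite (lc 0) (lc 1) (lc 2) !Epow //; try exact: LN.
case: (cyclic_dim2_cases pN nNG innN cN' c2 c3 cyc) => [[iN s1 s2]|[iN s1 i1 s2]]; [left | right].
- split; first by apply/Eisog.
  by split; apply/Esub; rewrite ?LN ?powN.
- split; first by apply/Eisog.
  split; first by apply/Esub; rewrite ?LN ?powN.
  split; first by apply/Eisog; rewrite ?LN.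
  by apply/Esub; rewrite ?powN ?LN.
Qed.

Let S32_subg m (ms : seq nat) : m \in ms -> is_small_group_32 m (subg_of N) -> isog_S32 (E N) ms.
Proof.
by move=> mms sm; exists m => //; exists (subg_of N) => //; apply/Eisog => //; apply: isog_subg.
Qed.

Lemma second_pattern_G : #|N| = 32 -> #|D 2| = 16 -> #|D 3| = 8 -> #|D 4| = 4 ->
    #|D 5| = 2 -> #|D 6| = 2 -> D 7 :=: 1 ->
  (('gamma_2(G) ~= 'Z_8 * 'Z_4 \/
          'gamma_2(G) ~= 'Z_4 * 'Z_4 * 'Z_2) /\
         ('gamma_2(G) ^^ 2 `<=` 'gamma_3(G))%classic /\ 'gamma_3(G) ~= 'Z_4 * 'Z_4 /\
         ('gamma_5(G) `<=` 'gamma_3(G) ^^ 2)%classic /\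
         ('gamma_3(G) ^^ 2 `<=` 'gamma_4(G))%classic /\ 'gamma_4(G) ~= 'Z_4 * 'Z_2) \/
  (isog_S32 'gamma_2(G) [:: 4; 12; 24; 25; 26; 31; 32; 33; 34; 35] /\
         ('gamma_2(G) ^^ 2 `<=` 'gamma_3(G))%classic /\ 'gamma_3(G) ~= 'Z_4 * 'Z_4 /\
         'gamma_4(G) ~= 'Z_4 * 'Z_2 /\ 'gamma_5(G) = 'gamma_3(G) ^^ 2 /\
         'gamma_6(G) ~= 'Z_2).
Proof.
move=> cN' c2 c3 c4 c5 c6 D7.
have [[e1 e2 e3 e4] [i1 i2 i4] iN] :=
  second_pattern pN nNG innN (model_comm model) cN' c2 c3 c4 c5 c6 D7.
rewrite -e1 in i1 e3; rewrite -e2 in i2; rewrite -e4 in i4.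
have sN : pow_group N 2 \subset L 1.
  by rewrite e1 (dim_seriesS _ _ pr2 (m := 1)) // joing_subr.
have s2 : pow_group (L 1) 2 \subset L 2.
  suff : [~: L 2, Gam] \subset L 2 by rewrite -e3.
  by rewrite commg_subl e2 dim_norm.
rewrite (lc 0) (lc 1) (lc 2) (lc 3) (lc 4) !Epow //; try exact: LN.
have c1 : (E (pow_group N 2) `<=` E (L 1))%classic by apply/Esub; rewrite ?powN ?LN.
have h1 : isog_type (E (L 1)) ('Z_4 * 'Z_4)%type by apply/Eisog; rewrite ?LN.
have h2 : isog_type (E (L 2)) ('Z_4 * 'Z_2)%type by apply/Eisog; rewrite ?LN // e2.
case: iN => [iN|iN]; [left | right].
  split; first by left; apply/Eisog.
  split=> //; split=> //; rewrite e3; split=> //.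
  by split=> //; apply/Esub; rewrite ?powN ?LN.
split; last first.
  by split=> //; split=> //; split=> //; rewrite e3; split=> //; apply/Eisog; rewrite ?LN.
have iS : [set: subg_of N] \isog N by rewrite isog_sym isog_subg.
by case: iN => iN; [apply: (@S32_subg 4) | apply: (@S32_subg 32) | apply: (@S32_subg 34)
  | apply: (@S32_subg 35)] => //; apply: isoGrp_trans iS iN.
Qed.

Let sub_of_E (A B : {set X}) : A \subset N -> B \subset N -> (E A `<=` E B)%classic -> A \subset B.
Proof. by move=> sA sB; apply: (Esub sA sB).1. Qed.

Lemma isog_S32_inv ms : isog_S32 (E N) ms ->
  exists m (T : finGroupType), [/\ m \in ms, is_small_group_32 m T & N \isog [set: T]].
Proof. by case=> m mms [T sT iT]; exists m, T; split=> //; apply/Eisog. Qed.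

Lemma isog_S32_card ms :
  {subset ms <= [:: 4; 5; 12; 17; 24; 25; 26; 31; 32; 33; 34; 35; 37; 38]} ->
  isog_S32 (E N) ms -> #|N| <= 32.
Proof.
move=> hms /isog_S32_inv[m [T [mms sT iT]]].
by rewrite (card_isog iT) cardsT (small_group_32_le (hms _ mms) sT).
Qed.

Let n5 : #|N| = 32 -> n = 5.
Proof. by rewrite cN => /(congr1 (logn 2)); rewrite pfactorK // (pfactorK 5). Qed.

Let D2E : D 2 = (L 1 <*> pow_group N 2)%G.
Proof. by rewrite (dim_seriesS _ _ pr2 (m := 1)). Qed.

Let sum_cyclic : #|N| = 32 -> #|D 2| = 8 -> cyclic (D 2) ->
  n = 5 /\ (\sum_(j < (2 ^ n).+1) dim_log N Gam 2 j.+1 = 16)%N.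
Proof.
by move=> cN' c2 cyc; have e5 := n5 cN'; split=> //; rewrite e5; apply: dim_log_sum_cyclic.
Qed.

Lemma case_i : 'gamma_2(G) ~= 'Z_16 * 'Z_2 -> ('gamma_3(G) `<=` 'gamma_2(G) ^^ 2)%classic ->
  n = 5 /\ (\sum_(j < (2 ^ n).+1) dim_log N Gam 2 j.+1 = 16)%N.
Proof.
rewrite (lc 0) (lc 1) Epow // => /Eisog-/(_ (subxx N))/Z162_facts[cN' cyc c8].
move/(sub_of_E (LN 1) (powN _ (subxx N))) => s1.
have e2 : D 2 = pow_group N 2 by rewrite D2E; apply/val_inj/joing_idPr.
by apply: sum_cyclic; rewrite ?e2.
Qed.

Let dim2_Z8 : (E (pow_group N 2) `<=` E (L 1))%classic -> E (L 1) ~= 'Z_8 ->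
  #|D 2| = 8 /\ cyclic (D 2).
Proof.
move/(sub_of_E (powN _ (subxx N)) (LN 1)) => s1 /Eisog-/(_ (LN 1))/Zp_isog_cycle[c Lc oc].
have e2 : D 2 = L 1 by rewrite D2E; apply/val_inj/joing_idPl.
by rewrite e2 Lc cycle_cyclic -orderE oc.
Qed.

Lemma case_ii : 'gamma_2(G) ~= 'Z_8 * 'Z_2 * 'Z_2 ->
  ('gamma_2(G) ^^ 2 `<=` 'gamma_3(G))%classic -> 'gamma_3(G) ~= 'Z_8 ->
  n = 5 /\ (\sum_(j < (2 ^ n).+1) dim_log N Gam 2 j.+1 = 16)%N.
Proof.
rewrite (lc 0) (lc 1) Epow // => /Eisog-/(_ (subxx N))/card_isog cN' s1 i1.
have [c2 cyc] := dim2_Z8 s1 i1; apply: sum_cyclic => //.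
by rewrite cN' cardsT !card_prod !card_ord.
Qed.

Let not_S32 ms : {subset ms <= [:: 17; 37; 38]} -> isog_S32 (E N) ms -> ~~ cyclic (D 2).
Proof.
move=> hms /isog_S32_inv[m [T [mms sT iT]]].
apply: contra (small_group_32_nonabelian (hms _ mms) sT) => cyc.
by rewrite -(isog_abelian iT) (abelian_of_cyclic_dim2 pN nNG innN).
Qed.

(** D_2 would equal the cyclic group gamma_3(G), which makes G' abelian, unlike the groups 17, 37
    and 38. *)
Lemma case_iii ms : {subset ms <= [:: 17; 37; 38]} -> isog_S32 'gamma_2(G) ms ->
  ('gamma_2(G) ^^ 2 `<=` 'gamma_3(G))%classic -> 'gamma_3(G) ~= 'Z_8 -> False.
Proof.
rewrite (lc 0) (lc 1) Epow // => hms /(not_S32 hms)/negP nc s1 i1.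
by apply: nc; have [] := dim2_Z8 s1 i1.
Qed.

Lemma case_v ms : {subset ms <= [:: 17; 37; 38]} -> isog_S32 'gamma_2(G) ms ->
  ('gamma_3(G) `<=` 'gamma_2(G) ^^ 2)%classic -> 'gamma_2(G) ^^ 2 ~= 'Z_8 -> False.
Proof.
rewrite (lc 0) (lc 1) Epow // => hms /(not_S32 hms)/negP nc.
move/(sub_of_E (LN 1) (powN _ (subxx N))) => s1 /Eisog-/(_ (powN _ (subxx N)))/Zp_isog_cycle[c
  Pc _].
have e2 : D 2 = pow_group N 2 by rewrite D2E; apply/val_inj/joing_idPr.
by apply: nc; rewrite e2 Pc cycle_cyclic.
Qed.

Let sqr_comm_trivial : abelian (L 1) -> [~: pow_group (L 1) 2, Gam] :=: 1 ->
  E (L 2) ~= 'Z_4 * 'Z_2 -> False.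
Proof.
move=> ab h /Eisog-/(_ (LN 2))/Z42_facts[_ [x Lx x2]].
case/negP: x2; apply/eqP; apply: (rel_lower2_sqr nNG ab _ Lx) => y g Py Gg.
by apply/set1P; rewrite -[[set 1]]h mem_commg.
Qed.

Let normL i : Gam \subset 'N(L i).
Proof. by elim: i => //= i IH; rewrite normsR ?normG. Qed.

(** gamma_3(G)^2 has order 2, so by nilpotency G centralises it, and then the squares of gamma_4(G)
    are trivial. *)
Lemma case_vi : 'gamma_3(G) ~= 'Z_4 * 'Z_2 * 'Z_2 -> 'gamma_4(G) ~= 'Z_4 * 'Z_2 -> False.
Proof.
rewrite (lc 1) (lc 2) => /Eisog-/(_ (LN 1))/Z422_facts[ab c2]; apply: sqr_comm_trivial => //.
have sP : [~: pow_group (L 1) 2, Gam] \subset pow_group (L 1) 2.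
  by rewrite commg_subl pow_group_norm.
have [cC|cC] := leqP 2 #|[~: pow_group (L 1) 2, Gam]|; last exact: card_le1_trivg.
have eC : [~: pow_group (L 1) 2, Gam] = pow_group (L 1) 2 by apply/eqP; rewrite eqEcard sP c2.
by rewrite eC; apply: (comm_sub_trivial nNG nilN); rewrite ?powN ?LN // eC.
Qed.

Let sum_second : #|N| = 32 -> (E (pow_group N 2) `<=` E (L 1))%classic ->
  E (L 1) ~= 'Z_4 * 'Z_4 -> E (L 2) ~= 'Z_4 * 'Z_2 -> L 3 \subset pow_group (L 1) 2 ->
  pow_group (L 1) 2 \subset L 2 ->
  n = 5 /\ (\sum_(j < (2 ^ n).+1) dim_log N Gam 2 j.+1 = 16)%N.
Proof.
move=> cN' /(sub_of_E (powN _ (subxx N)) (LN 1)) sN.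
move=> /Eisog-/(_ (LN 1))/Z44_facts[ab c1 exp4 cp] /Eisog-/(_ (LN 2))/Z42_facts[[_ c2 _ cp2] _]
  s3 s2.
by have e5 := n5 cN'; split=> //; rewrite e5; apply: dim_log_sum_second.
Qed.

Lemma case_xii : 'gamma_2(G) ~= 'Z_8 * 'Z_4 \/ 'gamma_2(G) ~= 'Z_4 * 'Z_4 * 'Z_2 ->
  ('gamma_2(G) ^^ 2 `<=` 'gamma_3(G))%classic -> 'gamma_3(G) ~= 'Z_4 * 'Z_4 ->
  ('gamma_5(G) `<=` 'gamma_3(G) ^^ 2)%classic -> ('gamma_3(G) ^^ 2 `<=` 'gamma_4(G))%classic ->
  'gamma_4(G) ~= 'Z_4 * 'Z_2 ->
  n = 5 /\ (\sum_(j < (2 ^ n).+1) dim_log N Gam 2 j.+1 = 16)%N.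
Proof.
rewrite (lc 0) (lc 1) (lc 2) (lc 3) !Epow ?LN // => iN sN i1 s3 s2 i2.
apply: sum_second => //; last 2 first.
- by apply: (sub_of_E _ _ s3); rewrite ?powN ?LN.
- by apply: (sub_of_E _ _ s2); rewrite ?powN ?LN.
by case: iN => /Eisog-/(_ (subxx N))/card_isog ->; rewrite cardsT !card_prod !card_ord.
Qed.

(** Here [gamma_3(G)^2, G] = gamma_6(G) = 1, so the squares of gamma_4(G) are again trivial. *)
Lemma case_xiii : 'gamma_3(G) ~= 'Z_4 * 'Z_4 -> 'gamma_4(G) ~= 'Z_4 * 'Z_2 ->
  'gamma_5(G) = 'gamma_3(G) ^^ 2 -> 'gamma_6(G) = [set 1]%classic -> False.
Proof.
rewrite (lc 1) (lc 2) (lc 3) (lc 4) Epow ?LN // => /Eisog-/(_ (LN 1))/Z44_facts[ab _ _ _] i2.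
move=> /(eset_eq model (LN 3) (powN _ (LN 1))) e3 /(eset1 model (LN 4)) e4.
by apply: sqr_comm_trivial => //; rewrite -e3.
Qed.

Lemma case_xiv ms :
  {subset ms <= [:: 4; 5; 12; 17; 24; 25; 26; 31; 32; 33; 34; 35; 37; 38]} ->
  isog_S32 'gamma_2(G) ms -> ('gamma_2(G) ^^ 2 `<=` 'gamma_3(G))%classic ->
  'gamma_3(G) ~= 'Z_4 * 'Z_4 -> 'gamma_4(G) ~= 'Z_4 * 'Z_2 ->
  'gamma_5(G) = 'gamma_3(G) ^^ 2 ->
  n = 5 /\ (\sum_(j < (2 ^ n).+1) dim_log N Gam 2 j.+1 = 16)%N.
Proof.
rewrite (lc 0) (lc 1) (lc 2) (lc 3) !Epow ?LN // => hms /(isog_S32_card hms) cN32 sN i1 i2.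
move=> /(eset_eq model (LN 3) (powN _ (LN 1))) e3.
have [_ c1 _ _] := Z44_facts ((Eisog _ (LN 1)).1 i1).
apply: sum_second => //; last 2 first.
- by rewrite e3.
- suff : [~: L 2, Gam] \subset L 2 by rewrite -e3.
  by rewrite commg_subl normL.
(* Nilpotency makes gamma_3(G), of order 16, a proper subgroup of G', and the presentations bound
   the order of G' by 32; so it is exactly 32. *)
have : L 1 \proper N.
  rewrite finset.properEneq LN andbT; apply/eqP=> e1.
  have := comm_sub_trivial nNG nilN (subxx N).
  rewrite -{1}[[~: N, Gam]]/(gval (L 1)) e1 => /(_ (subxx N)) N1.
  by move: c1; rewrite e1 N1 cards1.
move/proper_card; rewrite c1 => h; move: cN32 h; rewrite cN.
rewrite (_ : 32 = 2 ^ 5)%N // (_ : 16 = 2 ^ 4)%N // leq_exp2l // ltn_exp2l // => n5' n4.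
by congr (2 ^ _)%N; apply/eqP; rewrite eqn_leq n5'.
Qed.

Lemma case_xv : ('gamma_2(G) ^^ 2 `<=` 'gamma_3(G))%classic ->
  'gamma_3(G) ~= 'Z_4 * 'Z_4 -> ('gamma_5(G) `<=` 'gamma_3(G) ^^ 2)%classic ->
  'gamma_4(G) ~= 'Z_4 * 'Z_2 -> 'gamma_5(G) ~= 'Z_2 -> False.
Proof.
rewrite (lc 0) (lc 1) (lc 2) (lc 3) !Epow ?LN // => sN i1 s3 i2 i3.
have [ab c1 _ cp] := Z44_facts ((Eisog _ (LN 1)).1 i1).
have [[_ c2 _ _] _] := Z42_facts ((Eisog _ (LN 2)).1 i2).
apply: (rel_lower3_card nNG innN ab _ c1 c2 cp).
- by apply: (sub_of_E _ _ sN); rewrite ?powN ?LN.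
- by apply: (sub_of_E _ _ s3); rewrite ?powN ?LN.
by rewrite (card_isog ((Eisog _ (LN 3)).1 i3)) cardsT card_ord.
Qed.

(** For x in G' the square x^2 lies in gamma_3(G), so [x^2, g] lies in gamma_4(G). By
    [rel_lower_pow_sub], gamma_3(G)^2 is then contained in gamma_4(G), and the intersection has
    order 4 instead of 2. *)
Lemma case_xvi : ('gamma_2(G) ^^ 2 `<=` 'gamma_3(G))%classic ->
  'gamma_3(G) ~= 'Z_4 * 'Z_4 ->
  (('gamma_3(G) ^^ 2) `&` 'gamma_4(G) #= `I_2)%card%classic -> False.
Proof.
rewrite (lc 0) (lc 1) (lc 2) !Epow ?LN // => sN i1.
have [ab c1 _ cp] := Z44_facts ((Eisog _ (LN 1)).1 i1).
have {}sN : pow_group N 2 \subset L 1 by apply: (sub_of_E _ _ sN); rewrite ?powN ?LN.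
rewrite (eset_cap model) ?powN ?LN //.
move=> /(eset_card model)-/(_ (subset_trans (subsetIr _ _) (LN 2))).
have /finset.setIidPl-> : pow_group (L 1) 2 \subset L 2; last by rewrite cp.
apply: (rel_lower_pow_sub nNG innN) => // x g Nx Gg.
by apply: mem_commg => //; apply: (subsetP sN); apply: mem_pow_group.
Qed.

Lemma case_xviii : #|N| <= 32 -> 'gamma_3(G) ~= 'Z_4 * 'Z_2 -> 'gamma_4(G) ~= 'Z_4 ->
  (('gamma_3(G) ^^ 2 <**> 'gamma_2(G) ^^ 4) `&` 'gamma_4(G) #= `I_2)%card%classic ->
  'gamma_3(G) ^^ 2 <**> 'gamma_2(G) ^^ 4 ~= 'Z_2 * 'Z_2 -> False.
Proof.
rewrite (lc 0) (lc 1) (lc 2) !Epow ?LN // => cN32 i1 i2.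
have [[ab c1 exp4 cp] _] := Z42_facts ((Eisog _ (LN 1)).1 i1).
have [c L2E oc] := Zp_isog_cycle ((Eisog _ (LN 2)).1 i2).
rewrite (eset_mul model) ?powN ?LN //.
have sM : pow_group (L 1) 2 * pow_group N 4 \subset N by rewrite mul_subG ?powN ?LN.
rewrite (eset_cap model) ?LN // => /(eset_card model)-/(_ (subset_trans (subsetIr _ _) (LN 2))) cI.
move=> /isog_type_card; rewrite card_prod !card_ord => /(eset_card model)-/(_ sM) cM.
by apply: (rel_lower2_card nNG innN nilN pN cN32 c1 ab exp4 cp _ cM cI);
  rewrite L2E ?cycle_cyclic -?orderE.
Qed.

End TwoGroups.

Unset Implicit Arguments.
Local Open Scope classical_set_scope.
Local Open Scope card_scope.

Theorem theorem2p2 (p n : nat) (K : fieldType) (G : groupType)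
    (charK : p \in [pchar K]%R)
    (nilG : nilpotent_group G)
    (cardG' : 'gamma_2(G) #= `I_(p ^ n)) :
  ((upper_lie_index (group_algebra K G))%:Z
     = (p ^ n)%N%:Z - 15%:Z * p%:Z + 16%:Z)%R
  <->
  (p = 2 /\
    (   (* (i) *)
        ('gamma_2(G) ~= 'Z_16 * 'Z_2 /\ 'gamma_3(G) `<=` 'gamma_2(G) ^^ 2 /\
         'gamma_4(G) `<=` 'gamma_2(G) ^^ 4)
     \/ (* (ii) *)
        ('gamma_2(G) ~= 'Z_8 * 'Z_2 * 'Z_2 /\
         'gamma_2(G) ^^ 2 `<=` 'gamma_3(G) /\ 'gamma_3(G) ~= 'Z_8 /\
         'gamma_4(G) `<=` 'gamma_3(G) ^^ 2)
     \/ (* (iii) *)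
        ((isog_S32 'gamma_2(G) [:: 17; 38] /\
          'gamma_2(G) ^^ 2 `<=` 'gamma_3(G) /\ 'gamma_3(G) ~= 'Z_8 /\
          'gamma_4(G) `<=` 'gamma_3(G) ^^ 2 /\ 'gamma_5(G) = [set 1%g])
         \/ (isog_S32 'gamma_2(G) [:: 17; 38] /\
             'gamma_2(G) ^^ 2 `<=` 'gamma_3(G) /\ 'gamma_3(G) ~= 'Z_8 /\
             'gamma_4(G) = 'gamma_3(G) ^^ 2 /\ 'gamma_5(G) ~= 'Z_2))
     \/ (* (iv) *)
        (isog_S32 'gamma_2(G) [:: 37] /\ 'gamma_2(G) ^^ 2 `<=` 'gamma_3(G) /\
         'gamma_3(G) ~= 'Z_8 /\ 'gamma_4(G) = 'gamma_3(G) ^^ 2 /\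
         'gamma_5(G) ~= 'Z_2)
     \/ (* (v) *)
        (isog_S32 'gamma_2(G) [:: 17] /\ 'gamma_3(G) `<=` 'gamma_2(G) ^^ 2 /\
         'gamma_2(G) ^^ 2 ~= 'Z_8 /\ 'gamma_3(G) ~= 'Z_4)
     \/ (* (vi) *)
        (('gamma_2(G) ~= 'Z_8 * 'Z_2 * 'Z_2 \/
          'gamma_2(G) ~= 'Z_4 * 'Z_4 * 'Z_2 \/
          'gamma_2(G) ~= 'Z_4 * 'Z_2 * 'Z_2 * 'Z_2) /\
         'gamma_2(G) ^^ 2 `<=` 'gamma_3(G) /\
         'gamma_3(G) ~= 'Z_4 * 'Z_2 * 'Z_2 /\ 'gamma_4(G) ~= 'Z_4 * 'Z_2 /\
         'gamma_6(G) `<=` 'gamma_3(G) ^^ 2 /\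
         'gamma_3(G) ^^ 2 = 'gamma_4(G) ^^ 2 /\
         'gamma_4(G) ^^ 2 `<=` 'gamma_5(G) /\ 'gamma_5(G) ~= 'Z_2 * 'Z_2)
     \/ (* (vii) *)
        (isog_S32 'gamma_2(G) [:: 5; 24; 25; 37; 48] /\
         'gamma_2(G) ^^ 2 `<=` 'gamma_3(G) /\
         'gamma_3(G) ~= 'Z_4 * 'Z_2 * 'Z_2 /\ 'gamma_4(G) ~= 'Z_4 * 'Z_2 /\
         'gamma_3(G) ^^ 2 `<=` 'gamma_5(G) /\ 'gamma_5(G) ~= 'Z_2 * 'Z_2 /\
         'gamma_6(G) = [set 1%g])
     \/ (* (viii) *)
        (isog_S32 'gamma_2(G) [:: 28; 29; 30] /\
         'gamma_2(G) ^^ 2 `<=` 'gamma_3(G) /\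
         'gamma_3(G) ~= 'Z_4 * 'Z_2 * 'Z_2 /\ 'gamma_4(G) ~= 'Z_4 * 'Z_2 /\
         'gamma_6(G) = 'gamma_3(G) ^^ 2 /\
         'gamma_3(G) ^^ 2 `<=` 'gamma_5(G) /\ 'gamma_5(G) ~= 'Z_2 * 'Z_2)
     \/ (* (ix) *)
        (isog_S32 'gamma_2(G) [:: 2; 5; 22; 23; 24; 25; 37; 46; 47; 48] /\
         'gamma_2(G) ^^ 2 `<=` 'gamma_3(G) /\
         'gamma_3(G) ~= 'Z_4 * 'Z_2 * 'Z_2 /\ 'gamma_4(G) ~= 'Z_4 * 'Z_2 /\
         'gamma_6(G) = 'gamma_3(G) ^^ 2 /\
         'gamma_3(G) ^^ 2 `<=` 'gamma_5(G) /\ 'gamma_5(G) ~= 'Z_2 * 'Z_2)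
     \/ (* (x) *)
        (('gamma_2(G) ~= 'Z_8 * 'Z_2 * 'Z_2 \/
          'gamma_2(G) ~= 'Z_4 * 'Z_4 * 'Z_2 \/
          'gamma_2(G) ~= 'Z_4 * 'Z_2 * 'Z_2 * 'Z_2) /\
         'gamma_2(G) ^^ 2 `<=` 'gamma_3(G) /\
         'gamma_3(G) ~= 'Z_4 * 'Z_2 * 'Z_2 /\ 'gamma_4(G) ~= 'Z_4 * 'Z_2 /\
         'gamma_3(G) ^^ 2 `<=` 'gamma_4(G) /\ 'gamma_5(G) ~= 'Z_2 /\
         'gamma_5(G) `&` ('gamma_3(G) ^^ 2) = [set 1%g])
     \/ (* (xi) *)
        (isog_S32 'gamma_2(G) [:: 5; 24; 25; 37; 48] /\
         'gamma_2(G) ^^ 2 `<=` 'gamma_3(G) /\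
         'gamma_3(G) ~= 'Z_4 * 'Z_2 * 'Z_2 /\ 'gamma_4(G) ~= 'Z_4 * 'Z_2 /\
         'gamma_3(G) ^^ 2 `<=` 'gamma_4(G) /\ 'gamma_5(G) ~= 'Z_2 /\
         'gamma_5(G) `&` ('gamma_3(G) ^^ 2) = [set 1%g])
     \/ (* (xii) *)
        (('gamma_2(G) ~= 'Z_8 * 'Z_4 \/
          'gamma_2(G) ~= 'Z_4 * 'Z_4 * 'Z_2) /\
         'gamma_2(G) ^^ 2 `<=` 'gamma_3(G) /\ 'gamma_3(G) ~= 'Z_4 * 'Z_4 /\
         'gamma_5(G) `<=` 'gamma_3(G) ^^ 2 /\
         'gamma_3(G) ^^ 2 `<=` 'gamma_4(G) /\ 'gamma_4(G) ~= 'Z_4 * 'Z_2)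
     \/ (* (xiii) *)
        (isog_S32 'gamma_2(G) [:: 4; 12; 24; 25; 26] /\
         'gamma_2(G) ^^ 2 `<=` 'gamma_3(G) /\ 'gamma_3(G) ~= 'Z_4 * 'Z_4 /\
         'gamma_4(G) ~= 'Z_4 * 'Z_2 /\ 'gamma_5(G) = 'gamma_3(G) ^^ 2 /\
         'gamma_6(G) = [set 1%g])
     \/ (* (xiv) *)
        (isog_S32 'gamma_2(G) [:: 4; 12; 24; 25; 26; 31; 32; 33; 34; 35] /\
         'gamma_2(G) ^^ 2 `<=` 'gamma_3(G) /\ 'gamma_3(G) ~= 'Z_4 * 'Z_4 /\
         'gamma_4(G) ~= 'Z_4 * 'Z_2 /\ 'gamma_5(G) = 'gamma_3(G) ^^ 2 /\
         'gamma_6(G) ~= 'Z_2)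
     \/ (* (xv) *)
        (isog_S32 'gamma_2(G) [:: 4; 12; 24; 25; 26] /\
         'gamma_2(G) ^^ 2 `<=` 'gamma_3(G) /\ 'gamma_3(G) ~= 'Z_4 * 'Z_4 /\
         'gamma_5(G) `<=` 'gamma_3(G) ^^ 2 /\
         'gamma_3(G) ^^ 2 `<=` 'gamma_4(G) /\ 'gamma_4(G) ~= 'Z_4 * 'Z_2 /\
         'gamma_5(G) ~= 'Z_2)
     \/ (* (xvi) *)
        (('gamma_2(G) ~= 'Z_8 * 'Z_4 \/
          'gamma_2(G) ~= 'Z_4 * 'Z_4 * 'Z_2) /\
         'gamma_2(G) ^^ 2 `<=` 'gamma_3(G) /\ 'gamma_3(G) ~= 'Z_4 * 'Z_4 /\
         'gamma_4(G) ~= 'Z_4 /\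
         (('gamma_3(G) ^^ 2) `&` 'gamma_4(G)) #= `I_2 /\
         'gamma_5(G) `<=` 'gamma_3(G) ^^ 2)
     \/ (* (xvii) *)
        (isog_S32 'gamma_2(G) [:: 4; 12; 24; 25; 26] /\
         'gamma_2(G) ^^ 2 `<=` 'gamma_3(G) /\ 'gamma_3(G) ~= 'Z_4 * 'Z_4 /\
         'gamma_4(G) ~= 'Z_4 /\
         (('gamma_3(G) ^^ 2) `&` 'gamma_4(G)) #= `I_2 /\
         'gamma_5(G) `<=` 'gamma_3(G) ^^ 2 /\ 'gamma_5(G) ~= 'Z_2)
     \/ (* (xviii) *)
        (isog_S32 'gamma_2(G) [:: 4; 5; 12; 17] /\
         'gamma_3(G) ~= 'Z_4 * 'Z_2 /\
         (('gamma_2(G) ^^ 2) `&` 'gamma_3(G)) #= `I_4 /\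
         'gamma_4(G) ~= 'Z_4 /\
         (('gamma_3(G) ^^ 2 <**> 'gamma_2(G) ^^ 4) `&` 'gamma_4(G)) #= `I_2 /\
         'gamma_5(G) ~= 'Z_2 /\
         'gamma_5(G) `<=` 'gamma_3(G) ^^ 2 <**> 'gamma_2(G) ^^ 4 /\
         'gamma_3(G) ^^ 2 <**> 'gamma_2(G) ^^ 4 ~= 'Z_2 * 'Z_2)
     \/ (* (xix) *)
        (('gamma_2(G) ~= 'Z_8 * 'Z_2 * 'Z_2 \/
          'gamma_2(G) ~= 'Z_4 * 'Z_4 * 'Z_2) /\
         'gamma_3(G) ~= 'Z_4 * 'Z_2 /\
         (('gamma_2(G) ^^ 2) `&` 'gamma_3(G)) #= `I_2 /\
         'gamma_4(G) ~= 'Z_4 /\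
         (('gamma_3(G) ^^ 2 <**> 'gamma_2(G) ^^ 4) `&` 'gamma_4(G)) #= `I_2 /\
         'gamma_5(G) `<=` 'gamma_3(G) ^^ 2 <**> 'gamma_2(G) ^^ 4 /\
         'gamma_3(G) ^^ 2 <**> 'gamma_2(G) ^^ 4 ~= 'Z_2 * 'Z_2)
     \/ (* (xx) *)
        (isog_S32 'gamma_2(G) [:: 24; 25; 26; 37; 38] /\
         'gamma_3(G) ~= 'Z_4 * 'Z_2 /\
         (('gamma_2(G) ^^ 2) `&` 'gamma_3(G)) #= `I_2 /\
         'gamma_4(G) ~= 'Z_4 /\
         (('gamma_3(G) ^^ 2 <**> 'gamma_2(G) ^^ 4) `&` 'gamma_4(G)) #= `I_2 /\
         'gamma_5(G) ~= 'Z_2 /\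
         'gamma_5(G) `<=` 'gamma_3(G) ^^ 2 <**> 'gamma_2(G) ^^ 4 /\
         'gamma_3(G) ^^ 2 <**> 'gamma_2(G) ^^ 4 ~= 'Z_2 * 'Z_2)))
  \/
  (p = 17 /\ 'gamma_2(G) ~= 'Z_17 * 'Z_17 /\ 'gamma_3(G) ~= 'Z_17).

Proof.
have pr_p := pcharf_prime charK; have p0 := prime_gt0 pr_p.
have [|X [N [Gam [e [phi [model cN]]]]]] := exists_derived_model cardG'.
  by rewrite expn_gt0 p0.
have nilN := model_nilpotent model nilG.
have nNG := dm_norm model; have innN := dm_inner model.
have pN : (p.-group N)%g by rewrite /pgroup cN pnatX pnat_id.
have Sp := index_sumP model charK cN nilN.
have cD := card_dim pr_p pN nNG.
have trivD j : dim_log N Gam p j = 0 -> (dim_series N Gam p j :=: 1)%g.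
  by move=> ej; apply: card1_trivg; rewrite cD ej.
split=> [/Sp.1 S|h].
  have := dim_log_sum_cases pr_p pN nNG innN nilN; rewrite cN pfactorK // => /(_ S).
  case=> [[p17 n2 e2 e3]|[p2 n5 [[e2 e3 e4 e5 [e8 e9]]|[e2 e3 e4 e5 [e6 e7]]]]].
  - right; subst p n; split=> //.
    have c2 : #|dim_series N Gam 17 2| = 17 by rewrite cD e2.
    have [L1 [a [b [dN oa ob]]]] := rank2_dim pr_p isT nNG cN c2 (trivD _ e3).
    rewrite (eset_lower model 0) (eset_lower model 1); split.
      by apply/(eset_isog model) => //; apply: (isog_prod dN); apply: cycle_isog_Zp.
    have sL : rel_lower N Gam 1 \subset N by rewrite L1 dim_sub.
    by apply/(eset_isog model) => //; apply: Zp_isog_prime => //; rewrite L1.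
  - left; subst p n; split=> //.
    have [||||||h|h] := first_pattern_cases model cN cN; rewrite ?cD ?e2 ?e3 ?e4 ?e5 ?e8 //.
    + exact: trivD.
    + by left.
    + by right; left.
  left; subst p n; split=> //.
  have [||||||h|h] := second_pattern_G model cN cN; rewrite ?cD ?e2 ?e3 ?e4 ?e5 ?e6 //.
  + exact: trivD.
  (* The abelian type found for the second pattern is C_8 x C_4, under (xii); the other four types
     satisfy (xiv). *)
  + by do 11!right; left.
  + by do 13!right; left.
apply/Sp; case: h => [[p2 h]|[p17 [iN iL]]]; subst p; last first.
  move: iN iL; rewrite (eset_lower model 0) (eset_lower model 1).
  have sL : rel_lower N Gam 1 \subset N by rewrite /= commg_subl.
  move=> /(eset_isog model _ (subxx N))/cycle_prod_facts[a [b [dN oa ob]]].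
  move=> /(eset_isog model _ sL)/card_isog cL.
  have n2 : n = 2.
    apply: (@expnI 17) => //; rewrite -cN -(dprod_card dN) -!orderE oa ob //.
  subst n; rewrite (dim_log_sum_rank2 pr_p isT nNG nilN cN).
  - by rewrite !big_ord_recr big_ord0.
  - by apply: (dprod_cycles_exp dN); [rewrite -oa expg_order | rewrite -ob expg_order].
  by rewrite cL cardsT card_ord.
(* For p = 2 and n = 5 the required sum is 1 + 2 + 4 + 8 + 16 - 15 = 16; the contradictory
   conditions yield it vacuously. *)
suff [n5 ->] : n = 5 /\ \sum_(j < (2 ^ n).+1) dim_log N Gam 2 j.+1 = 16.
  by rewrite n5 !big_ord_recr big_ord0.
have sub1 ms : all (mem [:: 17; 37; 38]) ms -> {subset ms <= [:: 17; 37; 38]}.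
  by move/allP=> h' m /h'.
pose ms0 := [:: 4; 5; 12; 17; 24; 25; 26; 31; 32; 33; 34; 35; 37; 38].
have sub2 ms : all (mem ms0) ms -> {subset ms <= ms0} by move/allP=> h' m /h'.
have le32 ms : all (mem ms0) ms -> isog_S32 'gamma_2(G) ms -> #|N| <= 32.
  by move=> /sub2 hms; rewrite (eset_lower model 0); apply: (isog_S32_card model).
case: h => [[iN [s1 _]]|].
  exact: (case_i model cN).
case=> [[iN [s1 [i1 _]]]|].
  exact: (case_ii model cN).
case=> [[[iN [s1 [i1 _]]]|[iN [s1 [i1 _]]]]|].
- by case: (case_iii model cN (sub1 [:: 17; 38] isT) iN s1 i1).
- by case: (case_iii model cN (sub1 [:: 17; 38] isT) iN s1 i1).
case=> [[iN [s1 [i1 _]]]|].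
  by case: (case_iii model cN (sub1 [:: 37] isT) iN s1 i1).
case=> [[iN [s1 [i1 _]]]|].
  by case: (case_v model cN (sub1 [:: 17] isT) iN s1 i1).
(* Conditions (vi) to (xi) all contain gamma_3(G) of type C_4 x C_2 x C_2 and gamma_4(G) of type C_4
   x C_2, which is already contradictory. *)
do 6![case=> [[_ [_ [i1 [i2 _]]]]|]; first by case: (case_vi model nilN i1 i2)].
case=> [[iN [sN [i1 [s3 [s2 i2]]]]]|].
  exact: (case_xii model cN nilN iN sN i1 s3 s2 i2).
case=> [[iN [sN [i1 [i2 [e3 e4]]]]]|].
  by case: (case_xiii model i1 i2 e3 e4).
case=> [[iN [sN [i1 [i2 [e3 e4]]]]]|].
  exact: (case_xiv model cN nilN (sub2 [:: 4; 12; 24; 25; 26; 31; 32; 33; 34;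
    35] isT) iN sN i1 i2 e3).
case=> [[iN [sN [i1 [s3 [s2 [i2 i3]]]]]]|].
  by case: (case_xv model sN i1 s3 i2 i3).
(* Conditions (xvi) and (xvii) fail for the same reason. *)
do 2![case=> [[_ [sN [i1 [_ [cI _]]]]]|]; first by case: (case_xvi model sN i1 cI)].
case=> [[iN [i1 [_ [i2 [cI [_ [_ iQ]]]]]]]|].
  by case: (case_xviii model cN nilN (le32 [:: 4; 5; 12; 17] isT iN) i1 i2 cI iQ).
case=> [[iN [i1 [_ [i2 [cI [_ iQ]]]]]]|].
  case: (case_xviii model cN nilN _ i1 i2 cI iQ); move: iN; rewrite (eset_lower model 0).
  by case=> /(eset_isog model _ (subxx N))/card_isog->; rewrite cardsT !card_prod !card_ord.
case=> [iN [i1 [_ [i2 [cI [_ [_ iQ]]]]]]].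
by case: (case_xviii model cN nilN (le32 [:: 24; 25; 26; 37; 38] isT iN) i1 i2 cI iQ).
Qed.
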